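(* Let $t\geq1$ be an integer, set $g=2t$, and let $\mathbf{x}=(x_1,\dots,x_t)$ be indeterminates. Then, as an identity of formal power series in $T^{1/2}$ whose coefficients are Laurent polynomials in $x_1,\dots,x_t$, $$\sum_{\omega\in\mathcal{SC}_{(2t)}} (-1)^{\lvert H_+(\omega)\rvert+\lvert H_+(\omega)\cap \Delta(\omega)\rvert+d_\omega}\,T^{\lvert\omega\rvert/2}\,\mathrm{so}_{\mu(\omega)}(\mathbf{x}) =\left(T^{1/2};T^{1/2}\right)_\infty\left(T;T\right)_\infty^{t-1}K_T(t,\mathbf{x})\prod_{i=1}^t \left(T^{1/2}x_i,T^{1/2}x_i^{-1};T^{1/2}\right)_\infty,$$ where, for each $\omega$, $\mathbf{v}=(v_1,\dots,v_t)$ is the $V_{g,t}$-coding of $\omega$ and $\mu(\omega)$ is the partition with $\mu_i=v_i+i-2t$ for $1\leq i\leq t$.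
   Context: A partition $\lambda=(\lambda_1\geq\lambda_2\geq\dots)$ (with $\lambda_i=0$ for $i>\ell(\lambda)$) has Ferrers diagram consisting of boxes $(i,j)$ with $1\leq j\leq\lambda_i$; $\lambda'$ is the conjugate partition; $|\lambda|=\sum\lambda_i$. The hook length of a box $s=(i,j)$ is $h_s=\lambda_i-j+\lambda'_j-i+1$. The Durfee size is $d_\lambda=\max\{s:\lambda_s\geq s\}$, and the main diagonal is $\Delta(\lambda)=\{(i,i):1\leq i\leq d_\lambda\}$. For a box $s=(i,j)$, $\varepsilon_s=-1$ if $i>j$ and $\varepsilon_s=1$ otherwise. A partition is a $k$-core if none of its hook lengths is divisible by $k$. $\mathcal{SC}$ is the set of self-conjugate partitions ($\lambda=\lambda'$), and $\mathcal{SC}_{(k)}$ is the set of its elements that are $k$-cores. For $\omega$ and $g=2t$, $H_+(\omega)=\{s\in\omega: h_s<g,\ \varepsilon_s=1\}$. $V_{g,t}$-coding: for a partition $\lambda$ and each residue $r\in\{0,\dots,g-1\}$, let $\beta_r=g+\max\{\lambda_j-j: j\geq 1,\ \lambda_j-j\equiv r \pmod g\}$ ($j$ ranging over all positive integers, $\lambda_j=0$ for $j>\ell(\lambda)$). These are distinct; list them decreasingly $\beta_{\sigma(1)}>\dots>\beta_{\sigma(g)}$. The $V_{g,t}$-coding of $\lambda$ is $(v_1,\dots,v_t)=(\beta_{\sigma(1)},\dots,\beta_{\sigma(t)})$. Odd orthogonal Schur function: for a partition $\mu$ with at most $t$ parts, $\mathrm{so}_\mu(\mathbf{x})=\det_{1\leq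 i,j\leq t}\big(x_j^{\mu_i+t-i+1/2}-x_j^{-(\mu_i+t-i+1/2)}\big)/\det_{1\leq i,j\leq t}\big(x_j^{t-i+1/2}-x_j^{-(t-i+1/2)}\big)$. $(a;q)_\infty=\prod_{j\geq0}(1-aq^j)$, $(a_1,\dots,a_n;q)_\infty=\prod_k (a_k;q)_\infty$, and $K_T(t,\mathbf{x})=\prod_{1\leq i<j\leq t}\left(Tx_ix_j,Tx_i^{-1}x_j^{-1},Tx_ix_j^{-1},Tx_jx_i^{-1};T\right)_\infty$. *)

(* Defs.v *)
From HB Require Import structures.
From mathcomp Require Import all_boot all_order all_algebra.
From mathcomp Require Import fraction.
From mathcomp Require Import mpoly.
Set Implicit Arguments. Unset Strict Implicit. Unset Printing Implicit Defensive.
Import Order.TTheory GRing.Theory Num.Theory.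

Definition is_partition (l : seq nat) : bool :=
  sorted geq l && (0 \notin l).

Definition part (l : seq nat) (i : nat) : nat := nth 0 l i.-1.

Definition psize (l : seq nat) : nat := sumn l.

Definition conj_part (l : seq nat) (j : nat) : nat := count (fun p => j <= p) l.

Definition conj_partition (l : seq nat) : seq nat :=
  [seq conj_part l j | j <- iota 1 (head 0 l)].

Definition self_conjugate (l : seq nat) : bool := conj_partition l == l.

Definition boxes (l : seq nat) : seq (nat * nat) :=
  [seq (i, j) | i <- iota 1 (size l), j <- iota 1 (part l i)].

(* hook length h_s = lambda_i - j + lambda'_j - i + 1 (nonnegative on boxes) *)
Definition hook (l : seq nat) (s : nat * nat) : nat :=
  (part l s.1 - s.2 + conj_part l s.2 - s.1).+1.

Definition is_core (k : nat) (l : seq nat) : bool :=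
  all (fun s => ~~ (k %| hook l s)) (boxes l).

Definition durfee (l : seq nat) : nat :=
  \max_(s < (size l).+1 | s <= part l s) s.

Definition diag (l : seq nat) : seq (nat * nat) :=
  [seq (i, i) | i <- iota 1 (durfee l)].

Definition Hplus (g : nat) (l : seq nat) : seq (nat * nat) :=
  [seq s <- boxes l | (hook l s < g) && (s.1 <= s.2)].

Definition sign_exp (g : nat) (l : seq nat) : nat :=
  size (Hplus g l) + size [seq s <- Hplus g l | s \in diag l] + durfee l.

Local Open Scope ring_scope.

Definition cval (l : seq nat) (j : nat) : int := (part l j)%:Z - j%:Z.

(* beta_r = g + max { lambda_j - j : j >= 1, lambda_j - j = r mod g }.
   The maximum over all j >= 1 is attained for some j <= l(lambda) + g
   (for j > l(lambda) + g, j - g > l(lambda) gives a larger value in the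
   same residue class), and every value is >= -(l(lambda)+g) there, so the
   following finite max with that lower bound as neutral element is exactly
   the paper's beta_r. *)
Definition beta (g : nat) (l : seq nat) (r : nat) : int :=
  g%:Z + \big[Num.max/ - ((size l + g)%N%:Z)]_(1 <= j < (size l + g).+1
                 | ((cval l j - r%:Z) %% g%:Z)%Z == 0) cval l j.

Definition betas_sorted (g : nat) (l : seq nat) : seq int :=
  sort (fun a b => b <= a) [seq beta g l r | r <- iota 0 g].

Definition vcoding (g t : nat) (l : seq nat) (i : nat) : int :=
  nth 0 (take t (betas_sorted g l)) i.-1.

Definition mu_of (t : nat) (l : seq nat) (i : nat) : int :=
  vcoding (2 * t) t l i + i%:Z - (2 * t)%N%:Z.

(* We write x_j = y_j ^ 2, so that x_j^(m + 1/2) = y_j^(2m+1).  For a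
   family mu : nat -> int (mu_i, 1-indexed) with at most t parts: *)
Definition so_fun (F : fieldType) (t : nat) (y : 'I_t -> F) (mu : nat -> int) : F :=
  \det (\matrix_(i < t, j < t)
          (y j ^ (2 * (mu i.+1 + t%:Z - i.+1%:Z) + 1)
           - y j ^ (- (2 * (mu i.+1 + t%:Z - i.+1%:Z) + 1))))
  / \det (\matrix_(i < t, j < t)
          (y j ^ (2 * (t%:Z - i.+1%:Z) + 1)
           - y j ^ (- (2 * (t%:Z - i.+1%:Z) + 1)))).

(* (c q^e ; q^s)_infty = prod_{k >= 0} (1 - c q^(e + s k)), for e, s >= 1,
   truncated: only the factors with k < N.+1 (these include all factors of
   q-degree <= N), so its coefficients of q^n, n <= N, are those of the
   infinite product. *)
Definition qpoch (F : fieldType) (N : nat) (c : F) (e s : nat) : {poly F} :=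
  \prod_(k < N.+1) (1 - c *: 'X^(e + s * k)).

(* Right-hand side, truncated at order N, in the variable q = T^(1/2):
   (q;q)_oo (q^2;q^2)_oo^(t-1) K_{q^2}(t,x) prod_i (q x_i, q x_i^-1; q)_oo *)
Definition rhs_trunc (F : fieldType) (t : nat) (x : 'I_t -> F) (N : nat) : {poly F} :=
  qpoch N 1 1 1
  * (qpoch N 1 2 2) ^+ (t.-1)
  * (\prod_(i < t) \prod_(j < t | (i < j)%N)
       (qpoch N (x i * x j) 2 2 * qpoch N ((x i)^-1 * (x j)^-1) 2 2
        * qpoch N (x i * (x j)^-1) 2 2 * qpoch N (x j * (x i)^-1) 2 2))
  * \prod_(i < t) (qpoch N (x i) 1 1 * qpoch N ((x i)^-1) 1 1).

Definition RatFun (t : nat) : fieldType := {fraction {mpoly int[t]}}.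

Definition yvar (t : nat) (i : 'I_t) : RatFun t := tofrac ('X_i).
Definition xvar (t : nat) (i : 'I_t) : RatFun t := yvar i ^+ 2.

Definition lhs_term (t : nat) (l : seq nat) : RatFun t :=
  (-1) ^+ sign_exp (2 * t) l * so_fun (@yvar t) (mu_of t l).

(* Main.v *)
(* The exponents [lambda_i - i] of a self-conjugate [2t]-core are
   determined by [t] integers [k_i], one for each pair of opposite residues modulo
   [2t]; with [w_i = 2t - 1 - 2i + 4t k_i] (for [i < t]) the size is the quadratic
   form [sum_i 2t k_i^2 + (2t-1-2i) k_i], the half-integer exponents in the numerator
   of the Schur function are the [|w_i| / 2] in decreasing order, and the sign is that
   of [prod_i w_i prod_(i<j) (w_i^2 - w_j^2)], which is exactly the sign absorbed when
   the rows are put back into the order and sign of the [w_i].  Hence the left-hand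
   side times the Weyl denominator of type B_t is a determinant of theta functions
   [phi_i(y_j)], [i, j < t], with [x_j = y_j^2].

   By the Jacobi triple product, the product side is
   [prod_j phi(y_j) prod_(i<j) (B(y_i) A(y_j) - B(y_j) A(y_i))] up to a factor free of
   [y], for two even theta functions [A], [B] of degree 2.  By Vandermonde this is
   [det (phi A^k B^(t-1-k))(y_j)], and each [phi A^k B^(t-1-k)] is a combination of the
   [phi_i] with coefficients in [Z[[q]]] independent of [y].  So both sides agree up to
   a constant, which is found by letting [y_j] be odd powers of a primitive [8t]-th
   root of unity: both sides are then explicit products.

   Power series are handled in algebras where [q] is nilpotent, finally
   [F[q] / q^(n+1)], so that all infinite sums have finite support. *)

Require Import Defs.
From HB Require Import structures.
From mathcomp Require Import all_boot all_order all_algebra.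
From mathcomp Require Import fraction mpoly.
From mathcomp Require Import perm qpoly algC cyclotomic.
From mathcomp Require Import zify ring lra.
Set Implicit Arguments. Unset Strict Implicit. Unset Printing Implicit Defensive.
Import Order.TTheory GRing.Theory Num.Theory.
Local Open Scope ring_scope.

(** * Sums with finite support *)

(** The constant is computed over one field and used over another: the roots of unity live in
    [algC], the theorem in a field of rational functions. Hence all coefficients independent of [y]
    are kept as integer polynomials, chosen before the field, the algebra and [q]. Two of them that
    agree over [algC] modulo [q^(n+1)] have the same integer coefficients below [n+1], because [int]
    embeds in [algC], and so agree in every algebra where [q^(n+1) = 0]. Truncated rings have zero
    divisors, so each cancellation needs a reason: what is removed is a nonzero scalar or a product
    of factors [1 - c q^e] with [e > 0], regular because [q] is nilpotent. The special points
    satisfy [y_j^(4t) = -1]. In a term [y^(c + 4tn)] the index [n] then leaves only the sign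
    [(-1)^n], so [phi_i(y_j)] is a difference of two powers of [y_j] times a product free of [j],
    and the determinant becomes the Weyl denominator, nonzero at these points. On the other side,
    the [x_j] and their inverses exhaust the roots of [z^(2t) = -1], which evaluates the product. *)

Definition sums_to (V : nmodType) (I : eqType) (f : I -> V) (S : V) : Prop :=
  exists s : seq I, [/\ uniq s, forall i, i \notin s -> f i = 0
                      & S = \sum_(i <- s) f i].

Section SumsTo.
Variable V : nmodType.

Lemma big_support (I : eqType) (f : I -> V) (s r : seq I) :
  uniq s -> uniq r -> (forall i, i \notin s -> f i = 0) -> {subset s <= r} ->
  \sum_(i <- r) f i = \sum_(i <- s) f i.
Proof.
move=> us ur f0 sr; rewrite (bigID (mem s)) /= [X in _ + X]big1 ?addr0; last first.
  by move=> i /f0.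
rewrite -big_filter; apply: perm_big; apply: uniq_perm => //.
  exact: filter_uniq.
move=> i; rewrite mem_filter; case: (boolP (i \in s)) => [/sr ->|] //=.
Qed.

Lemma sums_to_seq (I : eqType) (f : I -> V) S r :
  sums_to f S -> uniq r -> (forall i, i \notin r -> f i = 0) ->
  S = \sum_(i <- r) f i.
Proof.
move=> [s [us f0 ->]] ur g0.
have uu := undup_uniq (s ++ r).
rewrite -(@big_support _ f s (undup (s ++ r))) //; last first.
  by move=> i; rewrite mem_undup mem_cat => ->.
apply: big_support => // i.
by rewrite mem_undup mem_cat orbC => ->.
Qed.

Lemma sums_to_unique (I : eqType) (f : I -> V) S S' :
  sums_to f S -> sums_to f S' -> S = S'.
Proof. by move=> h [s [us f0 ->]]; apply: sums_to_seq. Qed.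

Lemma eq_sums_to (I : eqType) (f g : I -> V) S :
  f =1 g -> sums_to f S -> sums_to g S.
Proof.
move=> fg [s [us f0 ->]]; exists s; split=> // [i /f0|]; first by rewrite fg.
exact: eq_bigr.
Qed.

Lemma sums_to_fin (I : finType) (f : I -> V) : sums_to f (\sum_i f i).
Proof.
exists (index_enum I); split=> // [|i]; first exact: index_enum_uniq.
by rewrite mem_index_enum.
Qed.

Lemma sums_to_reindex (I J : eqType) (f : I -> V) (g : J -> I) (h : I -> J) S :
  cancel g h -> cancel h g -> sums_to f S -> sums_to (fun j => f (g j)) S.
Proof.
move=> gK hK [s [us f0 ->]]; exists (map h s); split.
- by rewrite map_inj_uniq //; apply: can_inj hK.
- move=> j jn; apply: f0; apply: contra jn => gs.
  by apply/mapP; exists (g j).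
- by rewrite big_map; apply: eq_bigr => i _; rewrite hK.
Qed.

Lemma sums_to_fubini (I J : eqType) (f : I * J -> V) S (T : I -> V) :
  sums_to f S -> (forall i, sums_to (fun j => f (i, j)) (T i)) -> sums_to T S.
Proof.
move=> [s [us f0 ->]] hT.
(* The rectangle of the two projections contains the support, so its rows can serve as common
   supports of all inner sums. *)
pose s1 := undup (map fst s); pose s2 := undup (map snd s).
have f02 i j : j \notin s2 -> f (i, j) = 0.
  move=> jn; apply: f0; apply: contra jn => js.
  by rewrite mem_undup; apply/mapP; exists (i, j).
have TE i : T i = \sum_(j <- s2) f (i, j).
  apply: (sums_to_seq (hT i)) => [|j]; first exact: undup_uniq.
  exact: f02.
exists s1; split; first exact: undup_uniq.
  move=> i iN; rewrite TE big1 // => j _; apply: f0; apply: contra iN => js.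
  by rewrite mem_undup; apply/mapP; exists (i, j).
under [RHS]eq_bigr do rewrite TE.
rewrite -(big_support (r := [seq (i, j) | i <- s1, j <- s2]) us) //.
- by rewrite big_allpairs.
- by apply: allpairs_uniq; rewrite ?undup_uniq // => -[? ?] [? ?] _ _.
- move=> [i j] ijs; apply/allpairsP; exists (i, j); split=> //=;
  by rewrite mem_undup; apply/mapP; exists (i, j).
Qed.

End SumsTo.

Lemma sums_toM (R : pzSemiRingType) (I J : eqType) (f : I -> R) (g : J -> R) S T :
  sums_to f S -> sums_to g T -> sums_to (fun p : I * J => f p.1 * g p.2) (S * T).
Proof.
move=> [s [us f0 ->]] [r [ur g0 ->]].
exists [seq (i, j) | i <- s, j <- r]; split.
- by apply: allpairs_uniq => // -[? ?] [? ?] _ _.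
- move=> [i j] /= ijN; case: (boolP (i \in s)) => [is_|/f0 ->]; last by rewrite mul0r.
  case: (boolP (j \in r)) => [jr|/g0 ->]; last by rewrite mulr0.
  by case/negP: ijN; apply/allpairsP; exists (i, j).
- by rewrite big_allpairs big_distrl; apply: eq_bigr => i _; rewrite big_distrr.
Qed.

Lemma sums_toZ (K : pzRingType) (V : lmodType K) (I : eqType) (a : K) (f : I -> V) S :
  sums_to f S -> sums_to (fun i => a *: f i) (a *: S).
Proof.
move=> [s [us f0 ->]]; exists s; split=> // [i /f0 ->|]; first by rewrite scaler0.
by rewrite scaler_sumr.
Qed.

Definition int_box (K : nat) : seq int := [seq k%:Z - K%:Z | k <- iota 0 (2 * K).+1].

Lemma int_box_uniq K : uniq (int_box K).
Proof. by rewrite map_inj_uniq ?iota_uniq // => i j; lia. Qed.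

Lemma mem_int_box K (k : int) : (k \in int_box K) = (absz k <= K)%N.
Proof.
apply/mapP/idP => [[i]|kK]; first by rewrite mem_iota => iK ->; lia.
by exists (absz (k + K%:Z)); rewrite ?mem_iota; lia.
Qed.

Lemma sums_to_box (V : nmodType) (f : int -> V) K :
  (forall k : int, (K < absz k)%N -> f k = 0) ->
  sums_to f (\sum_(k <- int_box K) f k).
Proof.
move=> f0; exists (int_box K); split=> //; first exact: int_box_uniq.
by move=> k; rewrite mem_int_box -ltnNge => /f0.
Qed.

Lemma int_box_ord (V : nmodType) (f : int -> V) K :
  \sum_(k <- int_box K) f k = \sum_(i < (2 * K).+1) f (i%:Z - K%:Z).
Proof. by rewrite big_map -(big_mkord xpredT (fun i => f (i%:Z - K%:Z))) /index_iota subn0. Qed.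

(** * The Jacobi triple product *)

(** If [(1 - x) d = 0] then [d = x d = x^n d = 0]. All later cancellations of q-products rest on
    this. *)
Lemma lreg_1B_nilp (R : comPzRingType) (x : R) n : x ^+ n = 0 -> GRing.lreg (1 - x).
Proof.
move=> xn; apply: mulrI0_lreg => d /eqP; rewrite mulrBl mul1r subr_eq0 => /eqP dE.
suff -> : d = x ^+ n * d by rewrite xn mul0r.
by elim: n {xn} => [|n IHn]; rewrite ?expr0 ?mul1r // exprS -mulrA -IHn.
Qed.

Lemma lreg_prod (R : comPzRingType) (I : Type) (s : seq I) (P : pred I) (f : I -> R) :
  (forall i, P i -> GRing.lreg (f i)) -> GRing.lreg (\prod_(i <- s | P i) f i).
Proof. by move=> h; elim/big_ind: _ => //; [apply: lreg1 | apply: lregM]. Qed.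

Lemma expr_nilp_ge (R : pzSemiRingType) (x : R) m n : x ^+ m = 0 -> (m <= n)%N -> x ^+ n = 0.
Proof. by move=> xm /subnK <-; rewrite exprD xm mulr0. Qed.

Lemma prod_stable (R : comPzSemiRingType) (f : nat -> R) m n :
  (forall k, (m <= k)%N -> f k = 1) -> (m <= n)%N -> \prod_(k < n) f k = \prod_(k < m) f k.
Proof.
move=> f1 mn; rewrite -!(big_mkord xpredT f) (big_cat_nat (leq0n m) mn) //=.
rewrite [X in _ * X]big_nat_cond [X in _ * X]big1 ?mulr1 // => i /andP[/andP[mi _] _].
exact: f1.
Qed.

(** The triangular number [n (n + 1) / 2]; it is invariant under [n -> -1 - n], which exchanges
    [Posz m] and [Negz m], hence the common branch. *)
Definition tri (n : int) : nat := match n with Posz m | Negz m => 'C(m.+1, 2) end.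

Lemma tri_eq n : (tri n)%:Z * 2 = n * (n + 1).
Proof.
have tri2 m : ('C(m.+1, 2) * 2 = m * m.+1)%N.
  by have := mul_bin_diag m.+1 1; rewrite bin1 /=; lia.
by case: n => m; rewrite /tri ?NegzE; have := tri2 m; nia.
Qed.

Lemma triS n : (tri (n + 1))%:Z = (tri n)%:Z + n + 1.
Proof. by have := tri_eq n; have := tri_eq (n + 1); nia. Qed.

Section JacobiTriple.
Variables (R : comNzRingType) (a b : R).
Let p := a * b.

(** General term of Ramanujan's two-variable theta function [f(a, b)]. This form of the triple
    product needs no inverse of a variable, and only the product [a b] has to be nilpotent. *)
Definition jt (n : int) : R := a ^+ tri n * b ^+ tri (n - 1).

(** A new factor shifts the index of [jt] at the cost of exactly the power of [p] that occurs in a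
    Pascal rule. *)
Lemma jt_stepa (m : nat) (j : int) : j <= m%:Z ->
  a * p ^+ m * jt j = p ^+ absz (m%:Z - j) * jt (j + 1).
Proof.
move=> jm; rewrite /jt /p !exprMn addrK.
have := triS j; have := triS (j - 1); rewrite subrK.
move: (tri j) (tri (j - 1)) (tri (j + 1)) => u v w h2 h1.
transitivity (a ^+ (1 + m + u) * b ^+ (m + v)).
  by rewrite !exprD expr1; ring.
transitivity (a ^+ (absz (m%:Z - j) + w) * b ^+ (absz (m%:Z - j) + u)).
  by congr (_ ^+ _ * _ ^+ _); lia.
by rewrite !exprD; ring.
Qed.

Lemma jt_stepb (n : nat) (j : int) : - n%:Z <= j ->
  b * p ^+ n * jt j = p ^+ absz (n%:Z + j) * jt (j - 1).
Proof.
move=> jn; rewrite /jt /p !exprMn.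
have := triS (j - 1 - 1); have := triS (j - 1); rewrite !subrK.
move: (tri j) (tri (j - 1)) (tri (j - 1 - 1)) => u v w h1 h2.
transitivity (a ^+ (n + u) * b ^+ (1 + n + v)).
  by rewrite !exprD expr1; ring.
transitivity (a ^+ (absz (n%:Z + j) + v) * b ^+ (absz (n%:Z + j) + w)).
  by congr (_ ^+ _ * _ ^+ _); lia.
by rewrite !exprD; ring.
Qed.

(** Gaussian binomial coefficients in base [p], defined by the Pascal rule so that no division by
    [1 - p^k] occurs. *)
Fixpoint qbin (m k : nat) : R :=
  match m, k with
  | _, 0 => 1
  | 0, _.+1 => 0
  | m'.+1, k'.+1 => qbin m' k' + p ^+ k'.+1 * qbin m' k'.+1
  end.

Lemma qbin0 m : qbin m 0 = 1. Proof. by case: m. Qed.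

Lemma qbin_small m k : (m < k)%N -> qbin m k = 0.
Proof.
elim: m k => [|m IHm] [|k] //= mk; rewrite !IHm ?mulr0 ?addr0 //; exact: ltnW.
Qed.

Lemma qbinn m : qbin m m = 1.
Proof. by elim: m => //= m ->; rewrite qbin_small ?mulr0 ?addr0. Qed.

Lemma qbinS m k : qbin m.+1 k.+1 = qbin m k + p ^+ k.+1 * qbin m k.+1.
Proof. by []. Qed.

Arguments qbin : simpl never.

(** The mirror Pascal rule: factors in [a] are absorbed by this one, factors in [b] by the defining
    one. *)
Lemma qbinS' m k : (k <= m)%N ->
  qbin m.+1 k.+1 = p ^+ (m - k) * qbin m k + qbin m k.+1.
Proof.
elim: m k => [|m IHm] k km.
  by move: km; rewrite leqn0 => /eqP ->; rewrite qbinS !qbinn qbin_small // mulr0 mulr1.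
rewrite qbinS; case: k km => [|k] km.
  rewrite !qbin0 [in LHS]IHm // !subn0 (qbinS m 0) !qbin0.
  by rewrite [p ^+ m.+1]exprS; ring.
have {}km : (k <= m)%N by [].
rewrite [in LHS](IHm k) //; move: km; rewrite leq_eqVlt => /orP[/eqP ->|km].
  by rewrite !qbinS !qbinn !subnn !qbin_small //; ring.
rewrite [in LHS](IHm k.+1) // subSS [in RHS]qbinS (qbinS m k.+1).
have -> : (m - k = (m - k.+1).+1)%N by lia.
by rewrite !exprS; ring.
Qed.

Definition pochp n : R := \prod_(k < n) (1 - p ^+ k.+1).

Lemma qbin_poch i j : qbin (i + j) i * pochp i * pochp j = pochp (i + j).
Proof.
move: {2}(i + j)%N (erefl (i + j)%N) => n; elim: n i j => [|n IHn] [|i] [|j] ijn //;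
  rewrite /pochp ?addn0 ?add0n ?qbin0 ?qbinn ?big_ord0 ?mulr1 ?mul1r //.
rewrite -!/(pochp _) !addSn qbinS.
have h1 := IHn i j.+1; have h2 := IHn i.+1 j.
rewrite !addnS in ijn h1 *; rewrite !addSn in ijn h2.
have pS k : pochp k.+1 = pochp k * (1 - p ^+ k.+1) by rewrite /pochp big_ord_recr.
have {}h1 : qbin (i + j).+1 i * pochp i * pochp j.+1 = pochp (i + j).+1 by apply: h1; lia.
have {}h2 : qbin (i + j).+1 i.+1 * pochp i.+1 * pochp j = pochp (i + j).+1 by apply: h2; lia.
rewrite [RHS]pS -[in RHS]h1 (pS i).
transitivity (pochp (i + j).+1 * (1 - p ^+ i.+1)
  + p ^+ i.+1 * (1 - p ^+ j.+1) * pochp (i + j).+1).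
  rewrite -{1}h1 -h2 (pS i) (pS j); ring.
rewrite h1 -addSn -addnS [in RHS]exprD; ring.
Qed.

(** Finite form of the triple product, equivalent to the q-binomial theorem; factors are added one
    at a time, first those in [a], then those in [b]. *)
Lemma jt_finite m n :
  \prod_(k < m) (1 + a * p ^+ k) * \prod_(k < n) (1 + b * p ^+ k)
  = \sum_(k < (m + n).+1) qbin (m + n) k * jt (k%:Z - n%:Z).
Proof.
elim: n => [|n IHn].
  rewrite big_ord0 mulr1 addn0; elim: m => [|m IHm].
    by rewrite big_ord0 big_ord1 mul1r subr0 /jt /= !mulr1.
  rewrite big_ord_recr /= IHm mulrDr mulr1 mulr_suml.
  rewrite [RHS]big_ord_recl [X in X + _ = _]big_ord_recl /= -addrA !qbin0; congr (_ + _).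
  under [RHS]eq_bigr => k _ do rewrite -[bump 0 k]/(k.+1) (qbinS' (leq_ord k)) mulrDl.
  rewrite big_split /= addrC; congr (_ + _).
    apply: eq_bigr => k _; rewrite !subr0 -mulrA [jt _ * _]mulrC jt_stepa; last first.
      by have := ltn_ord k; lia.
    rewrite mulrA [p ^+ (m - k) * _]mulrC; congr (_ * _ ^+ _ * jt _); last by lia.
    by have := ltn_ord k; lia.
  by rewrite [RHS]big_ord_recr /= qbin_small // mul0r addr0.
rewrite big_ord_recr /= mulrA IHn addnS; set M := (m + n)%N.
rewrite mulrDr mulr1 [RHS]big_ord_recl /= qbin0.
under [X in _ = _ + X]eq_bigr => k _ do rewrite -[bump 0 k]/(k.+1) qbinS mulrDl.
rewrite big_split /= addrCA; congr (_ + _).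
  apply: eq_bigr => k _; congr (_ * jt _); lia.
rewrite mulr_suml big_ord_recl /= !qbin0 !mul1r.
rewrite [in RHS]big_ord_recr /= qbin_small // mulr0 mul0r addr0; congr (_ + _).
  rewrite mulrC jt_stepb ?sub0r // addrN expr0 mul1r; congr jt; lia.
apply: eq_bigr => k _.
rewrite -[bump 0 k]/(k.+1) -mulrA [jt _ * _]mulrC jt_stepb; last by lia.
by rewrite mulrA [qbin _ _ * _]mulrC; congr (_ ^+ _ * _ * jt _); lia.
Qed.

Lemma jt_eq0 N j : p ^+ N = 0 -> (N.+1 < absz j)%N -> jt j = 0.
Proof.
move=> pN Nj; have h1 := tri_eq j; have h2 := tri_eq (j - 1).
have l1 : (N <= tri j)%N by nia.
have l2 : (N <= tri (j - 1))%N by nia.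
by rewrite /jt -(subnK l1) -(subnK l2) !exprD mulrACA -[X in _ * X]exprMn pN mulr0.
Qed.

Lemma pochp_lreg N n : p ^+ N = 0 -> GRing.lreg (pochp n).
Proof.
move=> pN; apply: lreg_prod => k _; apply: (@lreg_1B_nilp _ _ N).
by rewrite -exprM mulSn exprD pN mul0r.
Qed.

Theorem jacobi_triple N K : p ^+ N = 0 -> (N <= K)%N ->
  sums_to jt (\prod_(k < K) ((1 - p ^+ k.+1) * (1 + a * p ^+ k) * (1 + b * p ^+ k))).
Proof.
move=> pN NK; set F := fun k => (1 - p ^+ k.+1) * (1 + a * p ^+ k) * (1 + b * p ^+ k).
have p0 k : (N <= k)%N -> p ^+ k = 0 by apply: expr_nilp_ge.
have F1 k : (N <= k)%N -> F k = 1.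
  by move=> Nk; rewrite /F !p0 ?leqW // !mulr0 subr0 !addr0 !mulr1.
(* Whenever [jt (k - M)] can be nonzero, [|k - M| <= N + 1], so both [k] and [2M - k] exceed [N];
   all the q-factorials involved then equal [pochp N], which cancels. *)
pose M := (2 * N + 4)%N.
have poch1 n : (N <= n)%N -> pochp n = pochp N.
  by apply: (@prod_stable _ (fun k => 1 - p ^+ k.+1)) => k Nk; rewrite p0 ?leqW // subr0.
rewrite (prod_stable F1 NK) -(@prod_stable _ F N M) //; last by rewrite /M; lia.
rewrite 2!big_split /= -/(pochp M) -mulrA jt_finite.
have -> : pochp M * \sum_(k < (M + M).+1) qbin (M + M) k * jt (k%:Z - M%:Z)
  = \sum_(k <- int_box M) jt k.
  rewrite int_box_ord mul2n -addnn mulr_sumr; apply: eq_bigr => k _.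
  case: (leqP (absz (k%:Z - M%:Z)) N.+1) => [kM|kM]; last by rewrite (jt_eq0 pN kM) !mulr0.
  rewrite mulrA; suff -> : pochp M * qbin (M + M) k = 1 by rewrite mul1r.
  apply: (pochp_lreg (n := M) pN); rewrite mulr1 mulrA.
  have kle : (k <= M + M)%N by rewrite -ltnS.
  rewrite poch1; last by rewrite /M; lia.
  have /= := qbin_poch k (M + M - k); rewrite subnKC //.
  rewrite !poch1; [|move: kM kle; rewrite /M; lia..].
  by move=> h; rewrite -[RHS]h; ring.
by apply: sums_to_box => k Mk; apply: (jt_eq0 pN); rewrite /M in Mk; lia.
Qed.
End JacobiTriple.

(** * Theta functions *)

Section Theta.
Variables (F : fieldType) (R : comAlgType F) (N : nat) (q : R).

(* Evaluation of integer polynomials at [q], for coefficients independent of [y]. *)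
Definition qev (P : {poly int}) : R := (map_poly intr P).[q].

HB.instance Definition _ :=
  GRing.RMorphism.copy qev (horner_eval q \o map_poly intr).

Lemma qevXn n : qev 'X^n = q ^+ n.
Proof. by rewrite /qev map_polyXn hornerXn. Qed.

Lemma qev1BXn n : qev (1 - 'X^n) = 1 - q ^+ n.
Proof. by rewrite /qev rmorphB rmorph1 /= map_polyXn !hornerE ?hornerXn. Qed.

(* [int_box N.+2] contains the support of these sums whenever [q ^+ N = 0]; the
   exponents of [q] are nonnegative for [|c| < 2t], so that [absz] is harmless. *)
Definition thetaU (t : nat) (c : int) (y : F) : R :=
  \sum_(n <- int_box N.+2)
    y ^ (c + 4 * t%:Z * n) *: q ^+ absz (2 * t%:Z * n ^+ 2 + c * n).

(** The functions [A] ([b = false]) and [B] ([b = true]) of the overview; the second is the first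
    with [m] shifted by one half, up to a factor [q^(1/2)]. *)
Definition thetaT (b : bool) (y : F) : R :=
  \sum_(m <- int_box N.+2)
    y ^ (4 * m + 2 * b%:Z) *: q ^+ absz (2 * m ^+ 2 + 2 * b%:Z * m).

Definition phi (t : nat) (c : int) (y : F) : R := thetaU t c y - thetaU t c y^-1.

Hypothesis qN : q ^+ N = 0.

(** The exponent is [2t (n^2 - |n|) + (2t |n| + c n)], where [|c| <= 2t - 1]. The bound gives both
    nonnegative exponents and finite support. *)
Lemma thetaU_exp_ge (t : nat) (c n : int) : (absz c < 2 * t)%N ->
  `|n| <= 2 * t%:Z * n ^+ 2 + c * n.
Proof.
move=> ct; have n2 : 0 <= n ^+ 2 - `|n| by rewrite expr2; nia.
have h : 0 <= (2 * t)%:Z * (n ^+ 2 - `|n|) by rewrite mulr_ge0.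
have : 0 <= ((2 * t)%:Z - 1) * `|n| + c * n.
  have [n0|n0] := lerP 0 n.
    by rewrite ger0_norm // -mulrDl mulr_ge0 //; lia.
  by rewrite ltr0_norm // mulrN -mulNr -mulrDl mulr_le0 //; lia.
by move: h; rewrite PoszM; lra.
Qed.

Lemma sums_to_thetaU t c y : (absz c < 2 * t)%N ->
  sums_to (fun n : int => y ^ (c + 4 * t%:Z * n)
             *: q ^+ absz (2 * t%:Z * n ^+ 2 + c * n)) (thetaU t c y).
Proof.
move=> ct; apply: sums_to_box => k kN.
rewrite (expr_nilp_ge qN) ?scaler0 //.
by have := thetaU_exp_ge k ct; lia.
Qed.

Lemma sums_to_thetaT (b : bool) y :
  sums_to (fun m : int => y ^ (4 * m + 2 * b%:Z)
             *: q ^+ absz (2 * m ^+ 2 + 2 * b%:Z * m)) (thetaT b y).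
Proof.
apply: sums_to_box => k kN; rewrite (expr_nilp_ge qN) ?scaler0 //.
by case: b; nia.
Qed.

Lemma thetaU_opp t c y : (absz c < 2 * t)%N -> thetaU t (- c) y = thetaU t c y^-1.
Proof.
move=> ct; have ct' : (absz (- c) < 2 * t)%N by lia.
apply: sums_to_unique (sums_to_thetaU y ct') _.
have h := sums_to_reindex (g := -%R) (h := -%R) (@opprK _) (@opprK _) (sums_to_thetaU y^-1 ct).
apply: eq_sums_to h => n /=; rewrite exprz_inv; congr (_ ^ _ *: q ^+ absz _); ring.
Qed.

Lemma thetaT_inv (b : bool) y : thetaT b y^-1 = thetaT b y.
Proof.
apply: sums_to_unique (sums_to_thetaT b y^-1) _.
pose g (m : int) := - m - b%:Z.
have gK : cancel g g by move=> m; rewrite /g; ring.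
have h := sums_to_reindex gK gK (sums_to_thetaT b y).
apply: eq_sums_to h => n /=; rewrite exprz_inv /g; congr (_ ^ _ *: q ^+ absz _); last by ring.
by ring.
Qed.

Lemma phi_opp t c y : (absz c < 2 * t)%N -> phi t (- c) y = - phi t c y.
Proof. by move=> ct; rewrite /phi !thetaU_opp // invrK opprB. Qed.

Lemma thetaT_exp_ge0 (b : bool) (m : int) : 0 <= 2 * m ^+ 2 + 2 * b%:Z * m.
Proof. by case: b; nia. Qed.

(* The terms [n] of [thetaU t c] and [m] of [thetaT b] are reparametrized by
   [n = n' - k], [m = n' + r + t k], where [r] runs over [t + 1] consecutive integers:
   the exponent of [q] becomes [rho r k] plus that of the term [n'] of
   [thetaU t.+1 (c + 2b + 4r)]. *)
Definition rho (t : nat) (c : int) (b : bool) (r k : int) : int :=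
  2 * t%:Z * k ^+ 2 - c * k + 2 * (r + t%:Z * k) ^+ 2 + 2 * b%:Z * (r + t%:Z * k).

Lemma rho_ge (t : nat) (c : int) (b : bool) r k : (absz c < 2 * t)%N -> `|k| <= rho t c b r k.
Proof.
move=> ct; have ct' : (absz (- c)%R < 2 * t)%N by lia.
have := thetaU_exp_ge k ct'; rewrite /rho.
have := thetaT_exp_ge0 b (r + t%:Z * k).
by rewrite mulNr; lra.
Qed.

(** An integer polynomial rather than an element of [R], so that the same coefficient serves every
    field and algebra. *)
Definition rhoP (t : nat) (c : int) (b : bool) (r : int) : {poly int} :=
  \sum_(k <- int_box N.+2) 'X^(absz (rho t c b r k)).

Lemma sums_to_rhoP (t : nat) (c : int) (b : bool) r : (absz c < 2 * t)%N ->
  sums_to (fun k => q ^+ absz (rho t c b r k)) (qev (rhoP t c b r)).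
Proof.
move=> ct.
have -> : qev (rhoP t c b r) = \sum_(k <- int_box N.+2) q ^+ absz (rho t c b r k).
  rewrite rmorph_sum /=; apply: eq_bigr => k _.
  by rewrite qevXn.
apply: sums_to_box => k kN; rewrite (expr_nilp_ge qN) //.
by have := rho_ge b r k ct; lia.
Qed.

(* The first [r] such that [|c + 2b + 4r| < 2(t + 1)]. *)
Definition rbase (t : nat) (c : int) (b : bool) : int :=
  - (((2 * t)%:Z + 1 + c + 2 * b%:Z) %/ 4)%Z.

Definition cshift (t : nat) (c : int) (b : bool) (r : nat) : int :=
  c + 2 * b%:Z + 4 * (rbase t c b + r%:Z).

Lemma cshift_bound t c (b : bool) r : (r <= t)%N -> odd (absz c) ->
  (absz (cshift t c b r) < 2 * t.+1)%N && odd (absz (cshift t c b r)).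
Proof.
move=> rt oc; rewrite /cshift /rbase.
have := divz_eq ((2 * t)%:Z + 1 + c + 2 * b%:Z) 4.
have := modz_ge0 ((2 * t)%:Z + 1 + c + 2 * b%:Z) (isT : 4 != 0 :> int).
have := ltz_pmod ((2 * t)%:Z + 1 + c + 2 * b%:Z) (isT : 0 < 4 :> int).
move: (_ %/ 4)%Z (_ %% 4)%Z => d m; case: b => /=; lia.
Qed.

Lemma thetaU_mul_thetaT t c (b : bool) (y : F) : odd (absz c) -> (absz c < 2 * t)%N -> y != 0 ->
  thetaU t c y * thetaT b y
  = \sum_(r < t.+1) qev (rhoP t c b (rbase t c b + r%:Z)) * thetaU t.+1 (cshift t c b r) y.
Proof.
move=> oc ct y0; set r0 := rbase t c b.
pose g (p : 'I_t.+1 * (int * int)) : int * int :=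
  (p.2.2 - p.2.1, p.2.2 + (r0 + (val p.1)%:Z) + t%:Z * p.2.1).
(* On the image of [g], [t n + m - r0 = (t + 1) n' + r]; Euclidean division by [t + 1] therefore
   recovers [n'] and [r]. *)
pose D (p : int * int) := t%:Z * p.1 + p.2 - r0.
pose h (p : int * int) : 'I_t.+1 * (int * int) :=
  (inord (absz (D p %% t.+1%:Z)%Z), ((D p %/ t.+1%:Z)%Z - p.1, (D p %/ t.+1%:Z)%Z)).
have gK : cancel g h.
  move=> [r [k n]]; rewrite /h /g /D /=.
  have -> : t%:Z * (n - k) + (n + (r0 + r%:Z) + t%:Z * k) - r0 = n * t.+1%:Z + r%:Z.
    by rewrite intS; ring.
  rewrite divzMDl // modzMDl modz_small; last by have := ltn_ord r; lia.
  rewrite divz_small ?addr0; last by have := ltn_ord r; lia.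
  by rewrite inord_val opprB addrC subrK.
have hK : cancel h g.
  move=> [n m]; rewrite /g /h /=; have /= := divz_eq (D (n, m)) t.+1%:Z.
  have := modz_ge0 (D (n, m)) (isT : t.+1%:Z != 0).
  have := ltz_pmod (D (n, m)) (isT : 0 < t.+1%:Z).
  rewrite inordK; last by lia.
  rewrite {3 6}/D /=; move: (_ %/ _)%Z (_ %% _)%Z => d e e1 e2 e3; congr pair; first by ring.
  by rewrite gez0_abs //; nia.
have hM := sums_toM (sums_to_thetaU y ct) (sums_to_thetaT b y).
have hR := sums_to_reindex gK hK hM.
pose f (p : 'I_t.+1 * (int * int)) : R :=
  q ^+ absz (rho t c b (r0 + (val p.1)%:Z) p.2.1)
  * (y ^ (cshift t c b p.1 + 4 * t.+1%:Z * p.2.2)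
     *: q ^+ absz (2 * t.+1%:Z * p.2.2 ^+ 2 + cshift t c b p.1 * p.2.2)).
have {}hR : sums_to f (thetaU t c y * thetaT b y).
  apply: eq_sums_to hR => -[r [k n]]; rewrite /f /g /=.
  set s := r0 + _.
  rewrite -scalerAl -!scalerAr scalerA -!exprD -exprzDr ?unitfE //.
  have /andP[cb _] := cshift_bound b (leq_ord r) oc.
  have e1 := thetaU_exp_ge n cb; have e2 := thetaU_exp_ge (n - k) ct.
  have e3 := rho_ge b s k ct.
  have e4 := thetaT_exp_ge0 b (n + s + t%:Z * k).
  congr (_ ^ _ *: q ^+ _).
    by rewrite /cshift -/r0 -/s intS; ring.
  apply/eqP; rewrite -eqz_nat !PoszD !gez0_abs; [|lia..].
  by apply/eqP; rewrite /rho /cshift -/r0 -/s intS; ring.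
apply: sums_to_unique (sums_to_fin _).
apply: sums_to_fubini hR _ => r; rewrite /f /=.
have /andP[cb _] := cshift_bound b (leq_ord r) oc.
exact: sums_toM (sums_to_rhoP b _ ct) (sums_to_thetaU y cb).
Qed.

Lemma phi_mul_thetaT t c (b : bool) (y : F) : odd (absz c) -> (absz c < 2 * t)%N -> y != 0 ->
  phi t c y * thetaT b y
  = \sum_(r < t.+1) qev (rhoP t c b (rbase t c b + r%:Z)) * phi t.+1 (cshift t c b r) y.
Proof.
move=> oc ct y0; rewrite /phi mulrBl -[in X in _ - X](thetaT_inv b y).
rewrite !thetaU_mul_thetaT ?invr_eq0 // -sumrB.
by apply: eq_bigr => r _; rewrite mulrBr.
Qed.

End Theta.

(** Twice the Weyl vector [(t - 1/2, ..., 3/2, 1/2)] of type B_t. *)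
Definition w0 (t : nat) (i : nat) : int := (2 * t)%:Z - 1 - 2 * i%:Z.

Lemma w0_bound t (i : 'I_t) : (absz (w0 t i) < 2 * t)%N && odd (absz (w0 t i)).
Proof. by rewrite /w0; have := ltn_ord i; lia. Qed.

(** * Integral spanning by the functions [phi], and the homogeneous Vandermonde determinant *)

Section Spanned.
Variable N : nat.

(** The order of quantifiers is the point: the coefficients [Q] are chosen before the field, the
    algebra and [q]. *)
Definition spanned t (psi : forall (F : fieldType) (R : comAlgType F), R -> F -> R) :=
  exists Q : 'I_t -> {poly int},
  forall (F : fieldType) (R : comAlgType F) (q : R) (y : F), q ^+ N = 0 -> y != 0 ->
    psi F R q y = \sum_i qev q (Q i) * phi N q t (w0 t i) y.

(** Since [c] is odd and less than [2t] in absolute value, [|c|] is one of the [w0 t i]; the sign of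
    [c] goes into the coefficient. *)
Lemma spanned_phi t c : odd (absz c) -> (absz c < 2 * t)%N ->
  spanned t (fun F R q y => phi N q t c y).
Proof.
move=> oc ct.
have it : ((2 * t - 1 - absz c)./2 < t)%N by lia.
pose i0 := Ordinal it.
exists (fun i => if i == i0 then if 0 <= c then 1 else -1 else 0) => F R q y qN y0.
rewrite (bigD1 i0) //= eqxx big1 ?addr0; last first.
  by move=> i /negPf ->; rewrite rmorph0 mul0r.
have : w0 t i0 = `|c| by rewrite /w0 /=; lia.
case: (lerP 0 c) => c0 ->; rewrite ?rmorphN rmorph1 ?mulN1r ?mul1r.
  by rewrite ger0_norm.
by rewrite ltr0_norm // phi_opp ?opprK.
Qed.

Lemma spanned_mul_thetaT t psi (b : bool) :
  spanned t psi -> spanned t.+1 (fun F R q y => psi F R q y * thetaT N q b y).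
Proof.
case=> Q hQ.
have h (i : 'I_t) (r : 'I_t.+1) : exists Q' : {ffun 'I_t.+1 -> {poly int}},
    forall (F : fieldType) (R : comAlgType F) (q : R) (y : F), q ^+ N = 0 -> y != 0 ->
    phi N q t.+1 (cshift t (w0 t i) b r) y
      = \sum_(j < t.+1) qev q (Q' j) * phi N q t.+1 (w0 t.+1 j) y.
  have /andP[ci oi] := w0_bound i.
  have /andP[cr odr] := cshift_bound b (leq_ord r) oi.
  have [Q' hQ'] := spanned_phi odr cr.
  exists (finfun Q') => F R q y qN y0; rewrite hQ' //.
  by apply: eq_bigr => j _; rewrite ffunE.
have /fin_all_exists[Q' hQ'] := fun i => fin_all_exists (h i).
exists (fun j => \sum_i \sum_(r < t.+1)
   Q i * rhoP N t (w0 t i) b (rbase t (w0 t i) b + r%:Z) * Q' i r j) => F R q y qN y0.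
rewrite hQ // mulr_suml.
under [RHS]eq_bigr do rewrite rmorph_sum mulr_suml.
rewrite exchange_big; apply: eq_bigr => i _.
have /andP[ci oi] := w0_bound i.
rewrite -mulrA phi_mul_thetaT // mulr_sumr.
under [RHS]eq_bigr do rewrite rmorph_sum mulr_suml.
rewrite exchange_big; apply: eq_bigr => r _.
rewrite hQ' // [in LHS]mulr_sumr [in LHS]mulr_sumr; apply: eq_bigr => j _.
by rewrite !rmorphM !mulrA.
Qed.

(** Each theta factor raises the level by one, starting from [phi] at level 1. *)
Lemma spanned_theta_powers k l :
  spanned (k + l).+1
    (fun F R q y => phi N q 1 1 y * thetaT N q false y ^+ k * thetaT N q true y ^+ l).
Proof.
elim: l => [|l [Q hQ]].
  rewrite addn0; elim: k => [|k [Q hQ]].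
    have [Q hQ] := @spanned_phi 1 1 isT isT.
    by exists Q => F R q y qN y0; rewrite !expr0 !mulr1 hQ.
  have [Q' hQ'] := @spanned_mul_thetaT _ _ false (ex_intro _ Q hQ).
  exists Q' => F R q y qN y0.
  by rewrite -hQ' // !expr0 !mulr1 exprSr mulrA.
rewrite addnS.
have [Q' hQ'] := @spanned_mul_thetaT _ _ true (ex_intro _ Q hQ).
exists Q' => F R q y qN y0.
by rewrite -hQ' // exprSr mulrA.
Qed.
End Spanned.

Lemma prod_pairs (R : comPzSemiRingType) (t : nat) (A : 'I_t -> R) :
  \prod_(i < t) \prod_(j < t | (i < j)%N) (A i * A j) = \prod_(i < t) A i ^+ (t - 1).
Proof.
under eq_bigr do rewrite big_split.
rewrite big_split /= [X in _ * X](exchange_big_dep xpredT) //= -big_split /=.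
apply: eq_bigr => i _.
have -> : (t - 1 = #|predC1 i|)%N by rewrite cardC1 card_ord subn1.
rewrite -prodr_const [RHS](bigID (fun j : 'I_t => (i < j)%N)) /=; congr (_ * _).
  by apply: eq_bigl => j; rewrite inE -val_eqE /=; lia.
by apply: eq_bigl => j; rewrite inE -val_eqE /=; lia.
Qed.

(** The ordinary Vandermonde determinant in the ratios [B_j / A_j], with column [j] multiplied by
    [A_j^(t-1)]. *)
Lemma hom_Vandermonde (R : comNzRingType) (t : nat) (A A' B : 'I_t -> R) :
  (forall i, A i * A' i = 1) ->
  \prod_(i < t) \prod_(j < t | (i < j)%N) (B j * A i - B i * A j)
  = \det (\matrix_(k < t, j < t) (A j ^+ (t - 1 - k) * B j ^+ k)).
Proof.
move=> AA'.
have -> : \prod_(i < t) \prod_(j < t | (i < j)%N) (B j * A i - B i * A j)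
  = (\prod_(i < t) \prod_(j < t | (i < j)%N) (A i * A j))
    * \prod_(i < t) \prod_(j < t | (i < j)%N) (B j * A' j - B i * A' i).
  rewrite -big_split; apply: eq_bigr => i _; rewrite -big_split; apply: eq_bigr => j _ /=.
  rewrite mulrBr; congr (_ - _).
    by rewrite -[LHS]mulr1 -(AA' j); ring.
  by rewrite -[LHS]mulr1 -(AA' i); ring.
rewrite prod_pairs.
have := det_Vandermonde (\row_(j < t) (B j * A' j)).
under [in RHS]eq_bigr do under eq_bigr do rewrite !mxE.
move=> <-; rewrite mulrC.
transitivity (\det (Vandermonde t (\row_(j < t) (B j * A' j)) *m
   diag_mx (\row_(j < t) A j ^+ (t - 1)))).
  rewrite det_mulmx det_diag; congr (_ * _); apply: eq_bigr => i _; by rewrite mxE.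
congr (\det _); apply/matrixP => k j; rewrite mul_mx_diag !mxE exprMn.
have -> : (t - 1 = k + (t - 1 - k))%N by have := ltn_ord k; lia.
rewrite exprD mulrACA -[RHS]mul1r -[in RHS](expr1n _ k) -(AA' j) exprMn.
have -> : (k + (t - 1 - k) - k = t - 1 - k)%N by lia.
ring.
Qed.

(** The term [m = 0] is 1 and all others are multiples of [q], so a finite geometric series inverts
    the sum. This provides the inverses required by the homogeneous Vandermonde formula. *)
Lemma thetaT0_unit (F : fieldType) (R : comAlgType F) N (q : R) (y : F) :
  q ^+ N = 0 -> exists z, thetaT N q false y * z = 1.
Proof.
move=> qN.
have [z hz] : exists z, thetaT N q false y = 1 - q * z.
  rewrite /thetaT (bigD1_seq (0 : int)) ?int_box_uniq ?mem_int_box //.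
  have -> : absz (2 * 0 ^+ 2 + 2 * false%:Z * 0) = 0%N by [].
  rewrite !mulr0 addr0 expr0z scale1r expr0.
  have [z ->] : exists z, \sum_(m <- int_box N.+2 | m != 0)
    y ^ (4 * m + 2 * false%:Z) *: q ^+ absz (2 * m ^+ 2 + 2 * false%:Z * m) = q * z.
    elim/big_ind: _ => [|x1 x2 [z1 ->] [z2 ->]|m m0].
    - by exists 0; rewrite mulr0.
    - by exists (z1 + z2); rewrite mulrDr.
    have : (0 < absz (2 * m ^+ 2 + 2 * false%:Z * m)%R)%N by rewrite /=; nia.
    case: absz => // e _; exists (y ^ (4 * m + 2 * false%:Z) *: q ^+ e).
    by rewrite exprS scalerAr.
  by exists (- z); rewrite mulrN opprK.
exists (\sum_(k < N) (q * z) ^+ k); rewrite hz.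
have := subrX1 (q * z) N; rewrite exprMn qN mul0r sub0r => h.
by apply: oppr_inj; rewrite -mulNr opprB -h.
Qed.

(** * Weyl denominator and product formulas *)

Lemma det_rev (R : comNzRingType) (t : nat) (M : 'I_t -> 'I_t -> R) :
  \det (\matrix_(i, j) M (rev_ord i) (rev_ord j)) = \det (\matrix_(i, j) M i j).
Proof.
pose s : {perm 'I_t} := perm (@rev_ord_inj t).
have -> : \matrix_(i, j) M (rev_ord i) (rev_ord j)
  = row_perm s (col_perm s (\matrix_(i, j) M i j)).
  by apply/matrixP => i j; rewrite !mxE !permE.
rewrite row_permE col_permE !det_mulmx !det_perm odd_permV mulrCA -signr_addb addbb.
by rewrite mulr1.
Qed.

Lemma prod_pairs_rev (R : comPzSemiRingType) (t : nat) (f : 'I_t -> 'I_t -> R) :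
  \prod_(i < t) \prod_(j < t | (i < j)%N) f (rev_ord j) (rev_ord i)
  = \prod_(i < t) \prod_(j < t | (i < j)%N) f i j.
Proof.
rewrite [RHS](exchange_big_dep xpredT) //= (reindex_inj rev_ord_inj) /=.
apply: eq_bigr => i _; rewrite (reindex_inj rev_ord_inj) /=.
apply: eq_big => [j|j _]; last by rewrite !rev_ordK.
by have := ltn_ord i; have := ltn_ord j; lia.
Qed.

Lemma hom_Vandermonde_rev (R : comNzRingType) (t : nat) (A A' B : 'I_t -> R) :
  (forall i, A i * A' i = 1) ->
  \prod_(i < t) \prod_(j < t | (i < j)%N) (B i * A j - B j * A i)
  = \det (\matrix_(k < t, j < t) (A j ^+ k * B j ^+ (t - 1 - k))).
Proof.
move=> AA'.
have := @hom_Vandermonde R t (A \o @rev_ord t) (A' \o @rev_ord t) (B \o @rev_ord t).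
rewrite (prod_pairs_rev (fun i j => B i * A j - B j * A i)) => -> //=.
rewrite -det_rev; congr (\det _); apply/matrixP => i j; rewrite !mxE rev_ordK /=.
by congr (_ ^+ _ * _ ^+ _); have := ltn_ord i; lia.
Qed.

(** Passing from the powers to monic polynomials of degrees [0, ..., t-1] is a unitriangular change
    of basis. *)
Lemma det_monic_polys (R : comNzRingType) (t : nat) (p : nat -> {poly R}) (X : 'I_t -> R) :
  (forall k, p k \is monic) -> (forall k, size (p k) = k.+1) ->
  \det (\matrix_(k < t, j < t) (p k).[X j])
  = \prod_(i < t) \prod_(j < t | (i < j)%N) (X j - X i).
Proof.
move=> pm sp.
have -> : \matrix_(k < t, j < t) (p k).[X j]
  = (\matrix_(k < t, l < t) (p k)`_l) *m Vandermonde t (\row_j X j).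
  apply/matrixP => k j; rewrite !mxE (@horner_coef_wide _ t) ?sp //.
  by apply: eq_bigr => l _; rewrite !mxE.
rewrite det_mulmx det_Vandermonde det_trig.
  rewrite big1 ?mul1r => [|i _]; last first.
    by rewrite mxE; have /eqP <- := pm i; rewrite lead_coefE sp.
  by apply: eq_bigr => i _; apply: eq_bigr => j _; rewrite !mxE.
by apply/is_trig_mxP => i j ij; rewrite mxE nth_default // sp.
Qed.

(* The odd Chebyshev-like polynomials [y^(2k+1) - y^-(2k+1) = (y - y^-1) P_k(y^2 + y^-2)]. *)
Fixpoint oddcheb (R : nzRingType) (k : nat) : {poly R} :=
  match k with
  | 0 => 1
  | k'.+1 => match k' with
             | 0 => 'X + 1
             | k''.+1 => 'X * oddcheb R k' - oddcheb R k''
             end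
  end.

Lemma oddchebSS (R : nzRingType) k : oddcheb R k.+2 = 'X * oddcheb R k.+1 - oddcheb R k.
Proof. by []. Qed.

Lemma oddcheb_monic (R : nzRingType) k : (oddcheb R k \is monic) && (size (oddcheb R k) == k.+1).
Proof.
suff: ((oddcheb R k \is monic) && (size (oddcheb R k) == k.+1))
   && ((oddcheb R k.+1 \is monic) && (size (oddcheb R k.+1) == k.+2)) by case/andP.
elim: k => [|k /andP[/andP[m0 /eqP s0] /andP[m1 /eqP s1]]].
  rewrite /= monic1 size_poly1 eqxx /=.
  by rewrite -[1]opprK -polyCN monicXsubC size_XsubC.
rewrite m1 s1 eqxx andTb oddchebSS.
have sX : size ('X * oddcheb R k.+1) = k.+3.
  by rewrite -commr_polyX size_mulX ?s1 // monic_neq0.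
have sle : (size (- oddcheb R k)%R < size ('X * oddcheb R k.+1)%R)%N by rewrite size_polyN s0 sX.
rewrite monicE lead_coefDl // size_polyDl // sX eqxx andbT -monicE.
by rewrite -commr_polyX monicMr ?monicX.
Qed.

Lemma oddcheb_eval (F : fieldType) (y : F) k : y != 0 ->
  y ^+ (2 * k).+1 - y^-1 ^+ (2 * k).+1
  = (y - y^-1) * (oddcheb F k).[y ^+ 2 + (y ^+ 2)^-1].
Proof.
move=> y0.
suff: y ^+ (2 * k).+1 - y^-1 ^+ (2 * k).+1
  = (y - y^-1) * (oddcheb F k).[y ^+ 2 + (y ^+ 2)^-1] /\
  y ^+ (2 * k.+1).+1 - y^-1 ^+ (2 * k.+1).+1
  = (y - y^-1) * (oddcheb F k.+1).[y ^+ 2 + (y ^+ 2)^-1] by case.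
elim: k => [|k [IH0 IH1]]; first by rewrite /= !hornerE; split; field.
split=> //; rewrite oddchebSS !hornerE mulrBr mulrCA -IH1 -IH0.
rewrite !mulnS !addSn !add0n !exprS; move: (y ^+ (2 * k)) => u.
move: (y^-1 ^+ (2 * k)) => v; by field.
Qed.

Definition weylden (F : fieldType) (t : nat) (y : 'I_t -> F) : F :=
  \prod_(j < t) (y j - (y j)^-1)
  * \prod_(i < t) \prod_(j < t | (i < j)%N)
      (y i ^+ 2 + (y i ^+ 2)^-1 - (y j ^+ 2 + (y j ^+ 2)^-1)).

(** In reversed order, row [i] is [(y - y^-1) P_i(y^2 + y^-2)] with [P_i] monic of degree [i]. *)
Lemma weyl_denominator (F : fieldType) (t : nat) (y : 'I_t -> F) :
  (forall j, y j != 0) ->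
  \det (\matrix_(i < t, j < t) (y j ^ w0 t i - y j ^ (- w0 t i))) = weylden y.
Proof.
move=> y0; pose X j := y j ^+ 2 + (y j ^+ 2)^-1.
have cheb k := andP (oddcheb_monic F k).
have := @det_monic_polys F t (oddcheb F) (X \o @rev_ord t)
  (fun k => (cheb k).1) (fun k => eqP (cheb k).2).
rewrite (prod_pairs_rev (fun i j => X i - X j)) /weylden => <-.
rewrite mulrC -(det_rev (fun i j => y j ^ w0 t i - y j ^ (- w0 t i))).
transitivity (\det ((\matrix_(k < t, j < t) (oddcheb F k).[X (rev_ord j)])
                *m diag_mx (\row_j (y (rev_ord j) - (y (rev_ord j))^-1)))).
  congr (\det _); apply/matrixP => i j; rewrite mul_mx_diag !mxE mulrC.
  rewrite -oddcheb_eval //; have -> : w0 t (rev_ord i) = (2 * i).+1%:Z.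
    by rewrite /w0 /=; have := ltn_ord i; lia.
  by rewrite -exprnN -exprVn.
rewrite det_mulmx det_diag (reindex_inj rev_ord_inj) /=; congr (_ * _).
by apply: eq_bigr => j _; rewrite mxE rev_ordK.
Qed.

Lemma weylden_neq0 (F : fieldType) (t : nat) (y : 'I_t -> F) :
  (forall j, y j != 0) -> (forall j, y j ^+ 2 != 1) ->
  (forall i j : 'I_t, (i < j)%N -> (y i ^+ 2 != y j ^+ 2) && (y i ^+ 2 * y j ^+ 2 != 1)) ->
  weylden y != 0.
Proof.
move=> y0 y1 yy; apply: mulf_neq0; apply/prodf_neq0 => i _.
  by rewrite subr_eq0 -(inj_eq (mulfI (y0 i))) divff // -expr2 y1.
apply/prodf_neq0 => j /yy/andP[yij yij1].
have -> : y i ^+ 2 + (y i ^+ 2)^-1 - (y j ^+ 2 + (y j ^+ 2)^-1)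
    = (y i ^+ 2 - y j ^+ 2) * (1 - (y i ^+ 2 * y j ^+ 2)^-1).
  by field; rewrite !y0.
by rewrite mulf_neq0 // subr_eq0 // eq_sym invr_eq1.
Qed.

Section Products.
Variables (F : fieldType) (R : comAlgType F) (N : nat) (q : R).

Definition qpr (K : nat) (c : F) (e s : nat) : R :=
  \prod_(k < K) (1 - c *: q ^+ (e + s * k)).

Hypothesis qN : q ^+ N = 0.

Lemma qpr_stable K L c e s :
  (N <= K)%N -> (K <= L)%N -> (0 < s)%N -> qpr L c e s = qpr K c e s.
Proof.
move=> NK KL s0; apply: (@prod_stable _ (fun k => 1 - c *: q ^+ (e + s * k))) => // k Kk.
by rewrite (expr_nilp_ge qN) ?scaler0 ?subr0 //; nia.
Qed.

Lemma qprS K c e s : qpr K.+1 c e s = (1 - c *: q ^+ e) * qpr K c (e + s) s.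
Proof.
rewrite /qpr big_ord_recl muln0 addn0; congr (_ * _); apply: eq_bigr => k _.
by rewrite /= /bump add1n mulnS addnA.
Qed.

Lemma jt_scaled (v : F) (al be : nat) (n : int) : v != 0 ->
  jt (v *: q ^+ al) (v^-1 *: q ^+ be) n
  = v ^ n *: q ^+ (al * tri n + be * tri (n - 1)).
Proof.
move=> v0; rewrite /jt !exprZn -!exprM -scalerAl -scalerAr scalerA -exprD.
congr (_ *: _); rewrite exprVn exprnN exprnP -exprzDr ?unitfE //.
congr (_ ^ _); have := triS (n - 1); rewrite subrK => ->; ring.
Qed.

(** The case [a = v q^al], [b = v^-1 q^be]. Allowing one of [al], [be] to be 0 matters: the factor
    of index 0 is then free of [q], and such factors later produce the Weyl denominator. *)
Lemma jacobi_triple_scaled (v : F) (al be K : nat) :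
  v != 0 -> (0 < al + be)%N -> (N <= K)%N ->
  sums_to (fun n : int => v ^ n *: q ^+ (al * tri n + be * tri (n - 1)))
    (qpr K 1 (al + be) (al + be) * qpr K (- v) al (al + be) * qpr K (- v^-1) be (al + be)).
Proof.
move=> v0 ab0 NK.
have pE : v *: q ^+ al * (v^-1 *: q ^+ be) = q ^+ (al + be).
  by rewrite -scalerAl -scalerAr scalerA divff // scale1r -exprD.
have pN : (v *: q ^+ al * (v^-1 *: q ^+ be)) ^+ N = 0.
  by rewrite pE -exprM (expr_nilp_ge qN) //; nia.
have := jacobi_triple pN NK; rewrite pE => h.
have := eq_sums_to (fun n => jt_scaled al be n v0) h.
suff -> : \prod_(k < K) ((1 - (q ^+ (al + be)) ^+ k.+1)
   * (1 + v *: q ^+ al * (q ^+ (al + be)) ^+ k)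
   * (1 + v^-1 *: q ^+ be * (q ^+ (al + be)) ^+ k))
  = qpr K 1 (al + be) (al + be) * qpr K (- v) al (al + be) * qpr K (- v^-1) be (al + be) by [].
rewrite !big_split /=; congr (_ * _ * _); apply: eq_bigr => k _.
- by rewrite scale1r -exprM mulnS.
- by rewrite scaleNr opprK -scalerAl -exprM -exprD.
- by rewrite scaleNr opprK -scalerAl -exprM -exprD.
Qed.

Lemma exprz_opp_even (x : F) (m : int) : (- x) ^ (2 * m) = x ^ (2 * m).
Proof. by rewrite -!exprz_exp -!exprnP sqrrN. Qed.

(** In [y] times the sum of [(-x)^n q^(n(n+1)/2)], the indices [n = 2m] give [thetaU] at [y] and the
    indices [n = -2m - 1] give minus [thetaU] at [y^-1]. *)
Lemma phi11_product (y : F) K : y != 0 -> (N <= K)%N ->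
  phi N q 1 1 y = (y - y^-1) *: (qpr K 1 1 1 * qpr K (y ^+ 2) 1 1 * qpr K (y ^+ 2)^-1 1 1).
Proof.
move=> y0 NK; set x := y ^+ 2.
have x0 : x != 0 by rewrite expf_neq0.
(* With [K.+1] factors, [K] remain after the factor [1 - x^-1] of index 0 is split off; times [y] it
   becomes [y - y^-1]. *)
have := @jacobi_triple_scaled (- x) 1 0 K.+1.
rewrite oppr_eq0 => /(_ x0 isT (leqW NK)).
rewrite addn0 opprK invrN opprK => h.
have {}h := sums_toZ y h.
pose g (p : bool * int) : int := if p.1 then - (2 * p.2) - 1 else 2 * p.2.
pose g' (n : int) : bool * int :=
  if odd (absz n) then (true, - ((n + 1) %/ 2)%Z) else (false, (n %/ 2)%Z).
have gK : cancel g g'.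
  move=> [[] m]; rewrite /g /g' /=; [rewrite ifT | rewrite ifF]; try lia.
  - by congr pair; lia.
  - by congr pair; lia.
have g'K : cancel g' g.
  by move=> n; rewrite /g' /g; case: (boolP (odd (absz n))) => on /=; lia.
have {}h := sums_to_reindex gK g'K h.
have /sums_to_fubini hf : sums_to (fun p : bool * int =>
    if p.1 then - (y^-1 ^ (1 + 4 * 1%:Z * p.2) *: q ^+ absz (2 * 1%:Z * p.2 ^+ 2 + 1 * p.2))
    else y ^ (1 + 4 * 1%:Z * p.2) *: q ^+ absz (2 * 1%:Z * p.2 ^+ 2 + 1 * p.2))
    (y *: (qpr K.+1 1 1 1 * qpr K.+1 x 1 1 * qpr K.+1 x^-1 0 1)).
  apply: eq_sums_to h => -[b m]; rewrite /g /= mul1n mul0n addn0 scalerA.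
  have e2 (k : int) : x ^ (2 * k) = y ^ (4 * k).
    by rewrite /x exprnP exprz_exp; congr (_ ^ _); ring.
  case: b => /=.
    rewrite -scaleNr; congr (_ *: q ^+ _).
      have -> : - (2 * m) - 1 = 2 * (- m) - 1 by ring.
      rewrite exprzDr ?unitfE ?oppr_eq0 // exprz_opp_even e2 exprN1.
      rewrite exprz_inv.
      have -> : - (1 + 4 * 1%:Z * m) = 4 * - m + (-1) by ring.
      by rewrite exprzDr ?unitfE // invrN /x exprN1; field.
    by have := tri_eq (- (2 * m) - 1); nia.
  rewrite exprz_opp_even e2 exprzDr ?unitfE // expr1z; congr (_ *: q ^+ _).
  by have := tri_eq (2 * m); nia.
pose T (b : bool) := if b then - thetaU N q 1 1 y^-1 else thetaU N q 1 1 y.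
have hT : sums_to T (y *: (qpr K.+1 1 1 1 * qpr K.+1 x 1 1 * qpr K.+1 x^-1 0 1)).
  apply: hf => -[] /=; last exact: sums_to_thetaU.
  rewrite -scaleN1r; have := sums_toZ (-1) (@sums_to_thetaU _ _ _ _ qN 1 1 y^-1 isT).
  by apply: eq_sums_to => m; rewrite scaleN1r.
have -> : phi N q 1 1 y = y *: (qpr K.+1 1 1 1 * qpr K.+1 x 1 1 * qpr K.+1 x^-1 0 1).
  by rewrite (sums_to_unique hT (sums_to_fin T)) big_bool /= addrC.
rewrite (qprS K x^-1) !(@qpr_stable K K.+1) // expr0 add0n.
have -> : (1 - x^-1 *: (1 : R)) = (1 - x^-1) *: 1 by rewrite scalerBl scale1r.
rewrite -scalerAl mul1r -scalerAr scalerA; congr (_ *: _).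
by rewrite /x; field.
Qed.

(** Multiply the triple products for [-x u] and [-x / u] in base [q^2], with indices [m] and [n].
    For [m - n] even, put [m = k + l], [n = k - l] and obtain the first product of thetas; for
    [m - n] odd, put [n = k - l - 1] and obtain the second, with a minus sign. *)
Lemma thetaT_addition (y z : F) K : y != 0 -> z != 0 -> (N <= K)%N ->
  thetaT N q true y * thetaT N q false z - thetaT N q true z * thetaT N q false y
  = (y ^+ 2 + (y ^+ 2)^-1 - (z ^+ 2 + (z ^+ 2)^-1)) *:
    (qpr K 1 2 2 ^+ 2
     * (qpr K (y ^+ 2 * z ^+ 2) 2 2 * qpr K ((y ^+ 2)^-1 * (z ^+ 2)^-1) 2 2
        * qpr K (y ^+ 2 * (z ^+ 2)^-1) 2 2 * qpr K (z ^+ 2 * (y ^+ 2)^-1) 2 2)).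
Proof.
move=> y0 z0 NK; set x := y ^+ 2; set u := z ^+ 2.
have x0 : x != 0 by rewrite expf_neq0.
have u0 : u != 0 by rewrite expf_neq0.
have v0 : - (x * u) != 0 by rewrite oppr_eq0 mulf_neq0.
have w0 : - (x / u) != 0 by rewrite oppr_eq0 mulf_neq0 ?invr_eq0.
have h1 := @jacobi_triple_scaled _ 2 0 K.+1 v0 isT (leqW NK).
have h2 := @jacobi_triple_scaled _ 2 0 K.+1 w0 isT (leqW NK).
have := sums_toZ x (sums_toM h1 h2).
rewrite addn0 !invrN !opprK; set S := x *: _ => h.
pose g (p : bool * (int * int)) : int * int := (p.2.1 + p.2.2, p.2.1 - p.2.2 - p.1%:Z).
pose g' (p : int * int) : bool * (int * int) :=
  (odd (absz (p.1 - p.2)), (p.1 - ((p.1 - p.2) %/ 2)%Z, ((p.1 - p.2) %/ 2)%Z)).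
have gK : cancel g g'.
  by move=> [[] [k l]]; rewrite /g /g' /=; congr (_, (_, _)); lia.
have g'K : cancel g' g.
  move=> [m n]; rewrite /g' /g /=; congr pair; first by lia.
  by case: (boolP (odd _)) => on /=; lia.
have {}h := sums_to_reindex gK g'K h.
have /sums_to_fubini hf : sums_to (fun p : bool * (int * int) =>
    if p.1 then - ((z ^ (4 * p.2.2 + 2 * 1%:Z) *: q ^+ absz (2 * p.2.2 ^+ 2 + 2 * 1%:Z * p.2.2)) *
                   (y ^ (4 * p.2.1 + 2 * 0%:Z) *: q ^+ absz (2 * p.2.1 ^+ 2 + 2 * 0%:Z * p.2.1)))
    else (y ^ (4 * p.2.1 + 2 * 1%:Z) *: q ^+ absz (2 * p.2.1 ^+ 2 + 2 * 1%:Z * p.2.1)) *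
         (z ^ (4 * p.2.2 + 2 * 0%:Z) *: q ^+ absz (2 * p.2.2 ^+ 2 + 2 * 0%:Z * p.2.2))) S.
  apply: eq_sums_to h => -[b [k l]]; rewrite /g /= !mul0n !addn0.
  have xE (n : int) : x ^ n = y ^ (2 * n) by rewrite /x exprnP exprz_exp.
  have uE (n : int) : u ^ n = z ^ (2 * n) by rewrite /u exprnP exprz_exp.
  rewrite -!scalerAl -!scalerAr !scalerA -!exprD.
  have e1 (m : int) : 0 <= 2 * m ^+ 2 + 2 * 1%:Z * m by nia.
  have e0 (m : int) : 0 <= 2 * m ^+ 2 + 2 * 0%:Z * m by nia.
  have tE (m : int) : (2 * tri m)%:Z = m * (m + 1) by rewrite PoszM mulrC tri_eq.
  rewrite -(mulN1r (x * u)) -(mulN1r (x / u)) !(@exprzMl _ (-1)) ?(@exprzMl _ x) ?unitfE ?mulf_neq0 ?invr_eq0 ?oppr_eq0 ?oner_eq0 //.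
  rewrite exprz_inv !xE !uE.
  have sgn1 (a : int) : (-1 : F) ^ (2 * a) = 1.
    by rewrite exprz_opp_even exp1rz.
  have yD (a c : int) : y ^ a * y ^ c = y ^ (a + c) by rewrite exprzDr ?unitfE.
  have zD (a c : int) : z ^ a * z ^ c = z ^ (a + c) by rewrite exprzDr ?unitfE.
  have x1 : x = y ^ 2%:Z by [].
  rewrite {1}x1.
  case: b => /=.
    rewrite -scaleNr; congr (_ *: q ^+ _); last first.
      by apply/eqP; rewrite -eqz_nat [X in X == _]PoszD [X in _ == X]PoszD !tE !gez0_abs //; apply/eqP; ring.
    transitivity (((-1) ^ (k + l) * (-1) ^ (k - l - 1%:Z))
       * (y ^ 2%:Z * y ^ (2 * (k + l)) * y ^ (2 * (k - l - 1%:Z)))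
       * (z ^ (2 * (k + l)) * z ^ (2 * (- (k - l - 1%:Z))))); first by ring.
    rewrite !yD !zD -[RHS]mulN1r mulrA [RHS]mulrAC; congr (_ * _ ^ _ * _ ^ _); [|ring..].
    rewrite -exprzDr ?unitfE ?oppr_eq0 ?oner_eq0 //.
    have -> : k + l + (k - l - 1%:Z) = 2 * (k - 1) + 1 by ring.
    by rewrite exprzDr ?unitfE ?oppr_eq0 ?oner_eq0 // sgn1 mul1r.
  congr (_ *: q ^+ _); last first.
    by apply/eqP; rewrite -eqz_nat [X in X == _]PoszD [X in _ == X]PoszD !tE !gez0_abs //; apply/eqP; ring.
  transitivity (((-1) ^ (k + l) * (-1) ^ (k - l - 0%:Z))
     * (y ^ 2%:Z * y ^ (2 * (k + l)) * y ^ (2 * (k - l - 0%:Z)))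
     * (z ^ (2 * (k + l)) * z ^ (2 * (- (k - l - 0%:Z))))); first by ring.
  rewrite !yD !zD -exprzDr ?unitfE ?oppr_eq0 ?oner_eq0 //.
  have -> : k + l + (k - l - 0%:Z) = 2 * k by ring.
  by rewrite sgn1 mul1r; congr (_ ^ _ * _ ^ _); ring.
pose T (b : bool) := if b then - (thetaT N q true z * thetaT N q false y)
                     else thetaT N q true y * thetaT N q false z.
have hT : sums_to T S.
  apply: hf => -[] /=; last exact: (sums_toM (sums_to_thetaT qN true y) (sums_to_thetaT qN false z)).
  rewrite -scaleN1r [X in sums_to _ (_ *: X)]mulrC.
  have := sums_toZ (-1) (sums_toM (sums_to_thetaT qN false y) (sums_to_thetaT qN true z)).
  by apply: eq_sums_to => -[k l] /=; rewrite scaleN1r [in RHS]mulrC.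
have -> : thetaT N q true y * thetaT N q false z - thetaT N q true z * thetaT N q false y = S.
  by rewrite (sums_to_unique hT (sums_to_fin T)) big_bool /= addrC.
(* The two factors free of [q] combine to [x (1 - 1/(x u)) (1 - u/x) = x + 1/x - u - 1/u]. *)
rewrite /S (qprS K (x * u)^-1) (qprS K (x / u)^-1) !(@qpr_stable K K.+1) // !expr0 !add0n.
have E (a : F) (X : R) : (1 - a *: (1 : R)) * X = (1 - a) *: X.
  by rewrite mulrBl mul1r -scalerAl mul1r scalerBl scale1r.
have E2 (a b : F) (X Y Z W : R) : X * (a *: Y) * (Z * (b *: W)) = (a * b) *: (X * Y * (Z * W)).
  by rewrite -!scalerAr -!scalerAl scalerA mulrC.
rewrite !E invfM invf_div E2 scalerA; congr (_ *: _).
  by field; rewrite x0 u0.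
by ring.
Qed.
End Products.

(** [C] is the determinant of the matrix of coefficients that express the products of powers of [A]
    and [B] in the [phi_i]. As it precedes the field and the algebra, it may be computed in one ring
    and used in another. *)
Lemma theta_det N t : exists C : {poly int},
  forall (F : fieldType) (R : comAlgType F) (q : R) (y : 'I_t -> F),
  q ^+ N = 0 -> (forall j, y j != 0) ->
  \prod_(j < t) phi N q 1 1 (y j)
  * \prod_(i < t) \prod_(j < t | (i < j)%N)
      (thetaT N q true (y i) * thetaT N q false (y j)
       - thetaT N q true (y j) * thetaT N q false (y i))
  = qev q C * \det (\matrix_(i < t, j < t) phi N q t (w0 t i) (y j)).
Proof.
have h (k : 'I_t) : spanned N t (fun F R q y =>
    phi N q 1 1 y * thetaT N q false y ^+ k * thetaT N q true y ^+ (t - 1 - k)).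
  have := spanned_theta_powers N k (t - 1 - k).
  by have -> : (k + (t - 1 - k)).+1 = t by have := ltn_ord k; lia.
have /fin_all_exists[Q hQ] := h.
exists (\det (\matrix_(k < t, i < t) Q k i)) => F R q y qN y0.
have /fin_all_exists[A' hA'] := fun j => thetaT0_unit (y j) qN.
rewrite (hom_Vandermonde_rev _ hA') -det_map_mx -det_mulmx mulrC.
transitivity (\det ((\matrix_(k < t, j < t) (thetaT N q false (y j) ^+ k
      * thetaT N q true (y j) ^+ (t - 1 - k)))
    *m diag_mx (\row_j phi N q 1 1 (y j)))).
  by rewrite det_mulmx det_diag; congr (_ * _); apply: eq_bigr => j _; rewrite mxE.
congr (\det _); apply/matrixP => k j; rewrite mul_mx_diag !mxE.
rewrite mulrC mulrA hQ //; apply: eq_bigr => i _; by rewrite !mxE.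
Qed.

Definition macdonald_prod (F : fieldType) (R : comAlgType F) (q : R) (t : nat)
    (x : 'I_t -> F) (K : nat) : R :=
  qpr q K 1 1 1 * qpr q K 1 2 2 ^+ t.-1
  * (\prod_(i < t) \prod_(j < t | (i < j)%N)
       (qpr q K (x i * x j) 2 2 * qpr q K ((x i)^-1 * (x j)^-1) 2 2
        * qpr q K (x i * (x j)^-1) 2 2 * qpr q K (x j * (x i)^-1) 2 2))
  * \prod_(i < t) (qpr q K (x i) 1 1 * qpr q K ((x i)^-1) 1 1).

(* The factors [(q;q)] and [(q^2;q^2)] by which the product of the triple products
   exceeds the product side of the theorem. *)
Definition excess (t K : nat) : {poly int} :=
  (\prod_(k < K) (1 - 'X^(1 + 1 * k))) ^+ (t - 1)
  * (\prod_(k < K) (1 - 'X^(2 + 2 * k))) ^+ ((t - 1) * (t - 1)).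

Lemma qev_poch (F : fieldType) (R : comAlgType F) (q : R) K e s :
  qev q (\prod_(k < K) (1 - 'X^(e + s * k))) = qpr q K 1 e s.
Proof.
rewrite (rmorph_prod (qev q)); apply: eq_bigr => k _.
by rewrite scale1r -qev1BXn.
Qed.

Lemma theta_prod (F : fieldType) (R : comAlgType F) N (q : R) t (y : 'I_t -> F) K :
  (0 < t)%N -> q ^+ N = 0 -> (forall j, y j != 0) -> (N <= K)%N ->
  \prod_(j < t) phi N q 1 1 (y j)
  * \prod_(i < t) \prod_(j < t | (i < j)%N)
      (thetaT N q true (y i) * thetaT N q false (y j)
       - thetaT N q true (y j) * thetaT N q false (y i))
  = weylden y *: (qev q (excess t K) * macdonald_prod q (fun j => y j ^+ 2) K).
Proof.
move=> t0 qN y0 NK.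
under eq_bigr do rewrite (phi11_product qN (y0 _) NK) -mulrA.
under [X in _ * X]eq_bigr => i _ do
  under eq_bigr => j _ do rewrite (thetaT_addition qN (y0 i) (y0 j) NK) (expr2 (qpr q K 1 2 2)).
rewrite scaler_prod; under [X in _ * X]eq_bigr => i _ do rewrite scaler_prod big_split.
rewrite scaler_prod -scalerAl -scalerAr scalerA; congr (_ *: _).
rewrite [X in X * _]big_split [X in _ * X]big_split /= (prod_pairs (fun=> qpr q K 1 2 2)) !prodr_const card_ord.
have qM P Q : qev q (P * Q) = qev q P * qev q Q by exact: rmorphM.
have qX P n : qev q (P ^+ n) = qev q P ^+ n by exact: rmorphXn.
rewrite /macdonald_prod /excess qM !qX !qev_poch -!exprM.
(* Each of the [t (t - 1) / 2] pairs brings a square of [(q^2; q^2)]; the product side of the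
   theorem keeps [t - 1] of these factors. *)
have -> : ((t - 1) * t = (t - 1) * (t - 1) + t.-1)%N by nia.
have -> : qpr q K 1 1 1 ^+ t = qpr q K 1 1 1 ^+ (t - 1) * qpr q K 1 1 1.
  by rewrite -exprSr; congr (_ ^+ _); lia.
by rewrite exprD; ring.
Qed.

(** * Specialization at roots of unity *)

Lemma prod_1B_prim_root_poly (F : fieldType) (n : nat) (z : F) :
  n.-primitive_root z -> \prod_(i < n) (1 - z ^+ i *: 'X) = 1 - 'X^n :> {poly F}.
Proof.
move=> pz; have n0 := prim_order_gt0 pz.
(* [z^(n-1)] is the inverse of [z], and [1 - z^i X = - z^i (X - z^-i)]. The product of the leading
   scalars is then read off at [X = 0]. *)
have pz' : n.-primitive_root (z ^+ (n - 1)).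
  by rewrite prim_root_exp_coprime // subn1 coprime_sym coprimenP.
have E : \prod_(i < n) (1 - z ^+ i *: 'X)
       = (\prod_(i < n) - z ^+ i) *: ('X^n - 1) :> {poly F}.
  rewrite -(factor_Xn_sub_1 pz') big_mkord -scaler_prod; apply: eq_bigr => i _.
  rewrite scalerBr [X in _ = _ - X](_ : _ = -1); first by rewrite scaleNr opprK addrC.
  rewrite -mul_polyC -polyCM mulNr -exprM -exprD.
  have -> : (i + (n - 1) * i = n * i)%N by nia.
  by rewrite exprM (prim_expr_order pz) expr1n polyCN polyC1.
rewrite E; suff -> : \prod_(i < n) - z ^+ i = -1 by rewrite scaleN1r opprB.
have := congr1 (fun p => p.[0]) E; rewrite horner_prod big1; last first.
  by move=> i _; rewrite !hornerE ?mulr0 ?subr0.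
rewrite !hornerE  expr0n gtn_eqF //= sub0r mulrN1 => h.
by rewrite -[LHS]opprK -h.
Qed.

Lemma prod_1B_prim_root (F : fieldType) (R : comAlgType F) (n : nat) (z : F) (u : R) :
  n.-primitive_root z -> \prod_(i < n) (1 - z ^+ i *: u) = 1 - u ^+ n.
Proof.
move=> pz; have := congr1 (horner_alg u) (prod_1B_prim_root_poly pz).
rewrite rmorph_prod rmorphB rmorph1 rmorphXn /= horner_algX => <-.
apply: eq_bigr => i _; rewrite rmorphB rmorph1 -mul_polyC rmorphM /= horner_algC horner_algX.
by rewrite -scalerAl mul1r.
Qed.

Lemma prod_fold (R : comPzSemiRingType) (f : nat -> R) (t : nat) :
  \prod_(i < 2 * t) f i = \prod_(i < t) (f i * f (2 * t - 1 - i)%N).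
Proof.
rewrite mul2n -addnn big_split_ord /= big_split /=; congr (_ * _).
rewrite (reindex_inj rev_ord_inj) /=; apply: eq_bigr => i _; congr f.
by have := ltn_ord i; lia.
Qed.

Section RootsOfMinusOne.
Variables (F : fieldType) (t : nat) (eta : F).
Hypothesis t0 : (0 < t)%N.
Hypothesis prim_eta : (8 * t)%N.-primitive_root eta.

(** The squares of these points are [eta^(4j+2)]; together with their inverses they are the [2t]
    roots of [z^(2t) = -1], each occurring once. *)
Definition half_period_pt (j : 'I_t) : F := eta ^+ (2 * j + 1).
Let x (j : 'I_t) : F := half_period_pt j ^+ 2.

Lemma eta_neq0 : eta != 0.
Proof.
apply/eqP => e0; have := prim_expr_order prim_eta.
rewrite e0 expr0n muln_eq0 (gtn_eqF t0) /= => /esym/eqP.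
by rewrite oner_eq0.
Qed.

Lemma half_period_pt_neq0 j : half_period_pt j != 0.
Proof. by rewrite expf_neq0 // eta_neq0. Qed.

Lemma eta_half : eta ^+ (4 * t) = -1.
Proof.
have : eta ^+ (4 * t) ^+ 2 == 1.
  by rewrite -exprM -(prim_expr_order prim_eta); apply/eqP; congr (_ ^+ _); lia.
rewrite sqrf_eq1 => /orP[/eqP h|/eqP //].
have := eq_prim_root_expr prim_eta (4 * t) 0.
by rewrite expr0 h eqxx => /esym; rewrite eqn_mod_dvd // subn0 => /dvdn_leq; lia.
Qed.

Lemma half_period_ptX j : half_period_pt j ^ (4 * t%:Z) = -1.
Proof.
rewrite -PoszM -exprnP -exprM mulnC exprM eta_half -signr_odd.
by rewrite oddD oddM.
Qed.

Let x0 j : x j != 0.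
Proof. by rewrite expf_neq0 // half_period_pt_neq0. Qed.

Lemma weylden_half_period_neq0 : weylden half_period_pt != 0.
Proof.
have xE j : half_period_pt j ^+ 2 = eta ^+ (4 * j + 2) by rewrite /half_period_pt -exprM; congr (_ ^+ _); lia.
apply: weylden_neq0 => [j|j|i j ij]; first exact: half_period_pt_neq0.
  rewrite xE -(expr0 eta) (eq_prim_root_expr prim_eta) eqn_mod_dvd // subn0.
  by apply/negP => /dvdn_leq; have := ltn_ord j; lia.
rewrite !xE eq_sym -exprD -[X in _ && (_ != X)](expr0 eta) !(eq_prim_root_expr prim_eta).
rewrite !eqn_mod_dvd // ?subn0; last by lia.
apply/andP; split; apply/negP => /dvdn_leq; have := ltn_ord j; lia.
Qed.

Let prim_eta4 : (2 * t)%N.-primitive_root (eta ^+ 4).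
Proof.
have e : (8 * t = 4 * (2 * t))%N by lia.
have h : (2 * t %| 8 * t)%N by rewrite e dvdn_mull.
by have := dvdn_prim_root prim_eta h; rewrite e mulnK ?muln_gt0.
Qed.

Let prim_eta8 : t.-primitive_root (eta ^+ 8).
Proof.
have h : (t %| 8 * t)%N by rewrite dvdn_mull.
by have := dvdn_prim_root prim_eta h; rewrite mulnK.
Qed.

Let xE j : x j = eta ^+ (4 * j + 2).
Proof. by rewrite /x /half_period_pt -exprM; congr (_ ^+ _); lia. Qed.

Let xVE (j : 'I_t) (k : nat) : (4 * j + 2 + k = 8 * t)%N -> (x j)^-1 = eta ^+ k.
Proof.
move=> jk; apply: (mulfI (x0 j)); rewrite divff // xE -exprD jk.
by rewrite (prim_expr_order prim_eta).
Qed.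

(** The inverse of [x j] is the root [eta^(4i+2)] with [i = 2t - 1 - j], so folding the product over
    all [2t] roots pairs each root with its inverse. *)
Lemma prod_all_roots (R : comAlgType F) (u : R) :
  \prod_(j < t) ((1 - x j *: u) * (1 - (x j)^-1 *: u)) = 1 + u ^+ (2 * t).
Proof.
have := prod_1B_prim_root (eta ^+ 2 *: u) prim_eta4.
rewrite exprZn -exprM mulnA eta_half scaleN1r opprK => <-.
rewrite (prod_fold (fun i => 1 - eta ^+ 4 ^+ i *: (eta ^+ 2 *: u))).
apply: eq_bigr => j _; rewrite !scalerA -!exprM -!exprD xE; congr (_ * (1 - _ *: _)).
by rewrite -xE; apply: xVE; have := ltn_ord j; lia.
Qed.

Definition pairfac (R : comAlgType F) (u : R) (i j : 'I_t) : R :=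
  (1 - (x i * x j) *: u) * (1 - ((x i)^-1 * (x j)^-1) *: u)
  * (1 - (x i * (x j)^-1) *: u) * (1 - (x j * (x i)^-1) *: u).

Lemma prod_sym (R : comAlgType F) (g : 'I_t -> 'I_t -> R) : (forall i j, g i j = g j i) ->
  \prod_(i < t) \prod_(j < t) g i j
  = \prod_(i < t) g i i * (\prod_(i < t) \prod_(j < t | (i < j)%N) g i j) ^+ 2.
Proof.
move=> gC.
have E (i : 'I_t) : \prod_(j < t) g i j = g i i *
    ((\prod_(j < t | (i < j)%N) g i j) * (\prod_(j < t | (j < i)%N) g i j)).
  rewrite (bigD1 i) //=; congr (_ * _).
  rewrite (bigID (fun j : 'I_t => (i < j)%N)) /=; congr (_ * _);
    by apply: eq_bigl => j; rewrite -val_eqE /=; lia.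
under eq_bigr do rewrite E.
rewrite !big_split /= expr2; congr (_ * (_ * _)).
rewrite (exchange_big_dep xpredT) //=.
by apply: eq_bigr => i _; apply: eq_bigr => j _; rewrite gC.
Qed.

(** The product over all ordered pairs is computed row by row with [prod_all_roots]. By symmetry it
    is the diagonal times the square of the product over [i < j], and the diagonal is known because
    the [x_i^2] are the [t]-th roots of -1. *)
Lemma pairfac_square (R : comAlgType F) (u : R) :
  ((\prod_(i < t) \prod_(j < t | (i < j)%N) pairfac u i j) * (1 + u ^+ t) * (1 - u) ^+ t) ^+ 2
  = ((1 - u ^+ (2 * t)) ^+ t) ^+ 2.
Proof.
have gC i j : pairfac u i j = pairfac u j i.
  by rewrite /pairfac [x i * x j]mulrC [(x i)^-1 * (x j)^-1]mulrC; ring.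
have x2t j : x j ^+ (2 * t) = -1.
  by have := half_period_ptX j; rewrite -PoszM -exprnP /x -exprM mulnA.
have all : \prod_(i < t) \prod_(j < t) pairfac u i j = ((1 - u ^+ (2 * t)) ^+ t) ^+ 2.
  rewrite exprAC -[X in _ = _ ^+ X](card_ord t) -prodr_const; apply: eq_bigr => i _.
  transitivity (\prod_(j < t) ((1 - x j *: (x i *: u)) * (1 - (x j)^-1 *: (x i *: u)))
    * \prod_(j < t) ((1 - x j *: ((x i)^-1 *: u)) * (1 - (x j)^-1 *: ((x i)^-1 *: u)))).
    rewrite -big_split; apply: eq_bigr => j _; rewrite /pairfac !scalerA.
    by rewrite /= ![x j * _]mulrC ![(x j)^-1 * _]mulrC; ring.
  by rewrite !prod_all_roots !exprZn exprVn x2t invrN1 scaleN1r expr2.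
have diag : \prod_(i < t) pairfac u i i = (1 + u ^+ t) ^+ 2 * (1 - u) ^+ (2 * t).
  have e1 : \prod_(i < t) (1 - (x i * x i) *: u) = 1 + u ^+ t.
    have := prod_1B_prim_root (eta ^+ 4 *: u) prim_eta8.
    rewrite exprZn -exprM eta_half scaleN1r opprK => <-; apply: eq_bigr => i _.
    by rewrite scalerA xE -exprM -!exprD; congr (1 - _ ^+ _ *: _); lia.
  have e2 : \prod_(i < t) (1 - ((x i)^-1 * (x i)^-1) *: u) = 1 + u ^+ t.
    rewrite -e1 (reindex_inj rev_ord_inj) /=; apply: eq_bigr => i _.
    congr (1 - _ *: _); have il := ltn_ord i.
    have nz : x (rev_ord i) * x (rev_ord i) != 0 by rewrite mulf_neq0.
    rewrite -invfM; apply: (mulfI nz); rewrite divff // !xE -!exprD -(prim_expr_order prim_eta) /=.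
    by congr (_ ^+ _); lia.
  transitivity (\prod_(i < t) ((1 - (x i * x i) *: u) * (1 - ((x i)^-1 * (x i)^-1) *: u)
     * ((1 - u) * (1 - u)))).
    by apply: eq_bigr => i _; rewrite /pairfac divff // scale1r !mulrA.
  by rewrite !big_split /= e1 e2 !prodr_const card_ord -exprD addnn -mul2n expr2.
rewrite -all (prod_sym gC) diag !exprMn -(exprM (1 - u)) [(t * 2)%N]mulnC.
by move: ((1 - u) ^+ (2 * t)) => v; ring.
Qed.

(* [pairfac_square] determines the product up to sign; the sign is read off at [0]. *)
Lemma prod_pairfac_poly :
  (\prod_(i < t) \prod_(j < t | (i < j)%N) pairfac ('X : {poly F}) i j)
    * (1 + 'X ^+ t) * (1 - 'X) ^+ t = (1 - 'X ^+ (2 * t)) ^+ t.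
Proof.
have /eqP := pairfac_square ('X : {poly F}); rewrite eqf_sqr => /orP[/eqP //|/eqP h].
have := congr1 (fun p => p.[0]) h; rewrite !hornerE horner_prod big1; last first.
  move=> i _; rewrite horner_prod big1 // => j _.
  by rewrite /pairfac !hornerE ?mulr0 ?subr0 ?mulr1.
rewrite !expr0n muln_eq0 !(gtn_eqF t0) /= !subr0 addr0 !mulr1 expr1n => /eqP.
(* The wrong sign would give [1 = -1], that is [eta^0 = eta^(4t)], against the order of [eta]. *)
rewrite mul1r -eta_half -[X in X == _](expr0 eta) (eq_prim_root_expr prim_eta) eq_sym eqn_mod_dvd // subn0.
by move=> /dvdn_leq; lia.
Qed.

(** With nilpotents a square does not determine its root up to sign; hence the detour through
    [F[X]], a domain, followed by evaluation at [u]. *)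
Lemma prod_pairfac (R : comAlgType F) (u : R) :
  (\prod_(i < t) \prod_(j < t | (i < j)%N) pairfac u i j)
    * (1 + u ^+ t) * (1 - u) ^+ t = (1 - u ^+ (2 * t)) ^+ t.
Proof.
pose phiu : {rmorphism {poly F} -> R} := horner_alg u.
have pX : phiu 'X = u by exact: horner_algX.
have pB (a : F) : phiu (1 - a *: 'X) = 1 - a *: u.
  by rewrite rmorphB rmorph1 -mul_polyC rmorphM /= horner_algC horner_algX -scalerAl mul1r.
have := congr1 phiu prod_pairfac_poly.
rewrite !rmorphM !rmorphXn rmorphD !rmorphB !rmorph1 !rmorphXn pX => <-.
congr (_ * _ * _); rewrite rmorph_prod; apply: eq_bigr => i _.
rewrite rmorph_prod; apply: eq_bigr => j _.
by rewrite /pairfac !rmorphM !pB.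
Qed.
End RootsOfMinusOne.

Lemma prod_progression (R : comPzSemiRingType) (f : nat -> R) a K :
  \prod_(m < a * K) f m = \prod_(j < a) \prod_(k < K) f (j + a * k)%N.
Proof.
elim: K => [|K IHK].
  by rewrite muln0 big_ord0 big1 // => j _; rewrite big_ord0.
rewrite mulnS addnC big_split_ord /= IHK -big_split; apply: eq_bigr => j _ /=.
by rewrite big_ord_recr /= [(_ + j)%N]addnC.
Qed.

Section Specialization.
Variables (F : fieldType) (R : comAlgType F) (N : nat) (q : R).
Hypothesis qN : q ^+ N = 0.

Lemma qpr_lreg K c e s : (0 < e)%N -> GRing.lreg (qpr q K c e s).
Proof.
move=> e0; apply: lreg_prod => k _; apply: (@lreg_1B_nilp _ _ N).
by rewrite exprZn -exprM (expr_nilp_ge qN) ?scaler0 //; nia.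
Qed.

(** As [y^(4t) = -1], the term [n] of [thetaU] is [y^c (-1)^n q^(2tn^2 + cn)]: the triple product
    for [v = -1] with exponents [2t + c] and [2t - c]. *)
Lemma phi_half_period (y : F) (t : nat) (c : int) K :
  y != 0 -> y ^ (4 * t%:Z) = -1 -> (absz c < 2 * t)%N -> (N <= K)%N ->
  phi N q t c y = (y ^ c - y ^ (- c)) *:
    (qpr q K 1 (4 * t) (4 * t)
     * (qpr q K 1 (absz ((2 * t)%:Z + c)) (4 * t) * qpr q K 1 (absz ((2 * t)%:Z - c)) (4 * t))).
Proof.
move=> y0 y4 ct NK.
set al := absz ((2 * t)%:Z + c); set be := absz ((2 * t)%:Z - c).
have abE : (al + be = 4 * t)%N by rewrite /al /be; lia.
have h := @jacobi_triple_scaled F R N q qN (-1) al be K.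
have {}h := h _ _ NK; rewrite oppr_eq0 oner_eq0 abE in h.
have {h} := h isT; rewrite muln_gt0 /= => /(_ ltac:(lia)).
rewrite invrN1 !opprK -mulrA; set P := (X in sums_to _ X) => h.
have U (z : F) : z != 0 -> z ^ (4 * t%:Z) = -1 -> thetaU N q t c z = z ^ c *: P.
  move=> z0 z4; apply: sums_to_unique (sums_to_thetaU qN z ct) _.
  apply: eq_sums_to (sums_toZ (z ^ c) h) => n.
  rewrite scalerA exprzDr ?unitfE // -exprz_exp z4; congr (_ *: q ^+ _).
  have e0 : 0 <= 2 * t%:Z * n ^+ 2 + c * n by have := thetaU_exp_ge n ct; lia.
  have ea : al%:Z = 2 * t%:Z + c by rewrite /al; lia.
  have eb : be%:Z = 2 * t%:Z - c by rewrite /be; lia.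
  have e1 := tri_eq n; have := triS (n - 1); rewrite !subrK => e2.
  have {}e2 : (tri (n - 1))%:Z = (tri n)%:Z - n by lia.
  apply/eqP; rewrite -eqz_nat PoszD !PoszM gez0_abs // ea eb e2; apply/eqP.
  transitivity (2 * t%:Z * ((tri n)%:Z * 2) - 2 * t%:Z * n + c * n); first by ring.
  by rewrite e1; ring.
rewrite /phi !U ?invr_eq0 ?exprz_inv // -?scalerBl //.
by rewrite -exprz_inv exprz_inv -invr_expz y4 invrN1.
Qed.

(** The root-of-unity products are applied to each power of [q] separately. They give the pair
    product only after multiplication by [G] and [(q^2; q^2)^t], which are regular and cancel at the
    end. *)
Lemma macdonald_prod_spec (t : nat) (eta : F) K :
  (0 < t)%N -> (8 * t)%N.-primitive_root eta -> (N <= K)%N ->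
  macdonald_prod q (fun j : 'I_t => half_period_pt eta j ^+ 2) K
  = qpr q K 1 1 2 * qpr q K 1 (4 * t) (4 * t) ^+ t.
Proof.
move=> t0 peta NK.
pose G := qpr q K (-1) (2 * t) (2 * t).
pose H := \prod_(i < t) \prod_(j < t | (i < j)%N)
       (qpr q K (half_period_pt eta i ^+ 2 * half_period_pt eta j ^+ 2) 2 2
        * qpr q K ((half_period_pt eta i ^+ 2)^-1 * (half_period_pt eta j ^+ 2)^-1) 2 2
        * qpr q K (half_period_pt eta i ^+ 2 * (half_period_pt eta j ^+ 2)^-1) 2 2
        * qpr q K (half_period_pt eta j ^+ 2 * (half_period_pt eta i ^+ 2)^-1) 2 2).
have hH : H * G * qpr q K 1 2 2 ^+ t = qpr q K 1 (4 * t) (4 * t) ^+ t.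
  have -> : H = \prod_(k < K) \prod_(i < t) \prod_(j < t | (i < j)%N)
      pairfac eta (q ^+ (2 + 2 * k)) i j.
    rewrite exchange_big; apply: eq_bigr => i _; rewrite exchange_big.
    by apply: eq_bigr => j _; rewrite /pairfac !big_split.
  rewrite /G /qpr -!prodrXl -big_split -big_split; apply: eq_bigr => k _ /=.
  rewrite !scale1r scaleN1r opprK.
  have := prod_pairfac t0 peta (q ^+ (2 + 2 * k)); rewrite -!exprM.
  have -> : ((2 + 2 * k) * t = 2 * t + 2 * t * k)%N by ring.
  have -> // : ((2 + 2 * k) * (2 * t) = 4 * t + 4 * t * k)%N by ring.
have hG : \prod_(i < t) (qpr q K (half_period_pt eta i ^+ 2) 1 1 * qpr q K ((half_period_pt eta i ^+ 2)^-1) 1 1) = G.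
  transitivity (\prod_(k < K) \prod_(i < t) ((1 - half_period_pt eta i ^+ 2 *: q ^+ (1 + 1 * k))
      * (1 - (half_period_pt eta i ^+ 2)^-1 *: q ^+ (1 + 1 * k)))).
    by rewrite exchange_big; apply: eq_bigr => i _; rewrite [RHS]big_split.
  apply: eq_bigr => k _.
  rewrite prod_all_roots // scaleN1r opprK -exprM.
  by congr (1 + _ ^+ _); ring.
have hP : qpr q K 1 1 1 = qpr q K 1 1 2 * qpr q K 1 2 2.
  rewrite -(@qpr_stable _ _ _ _ qN K (2 * K)) //; last by lia.
  rewrite /qpr (prod_progression (fun m => 1 - 1 *: q ^+ (1 + 1 * m)) 2 K).
  rewrite big_ord_recl big_ord1 /=; congr (_ * _); apply: eq_bigr => k _;
    by congr (1 - 1 *: q ^+ _); rewrite /bump /=; lia.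
have Greg : GRing.lreg G by apply: qpr_lreg; lia.
have Preg : GRing.lreg (qpr q K 1 2 2) by apply: qpr_lreg.
have Ptreg : GRing.lreg (qpr q K 1 2 2 ^+ t) by apply: lregX.
apply: Greg; apply: Ptreg.
rewrite /macdonald_prod -/H hG hP.
transitivity (qpr q K 1 1 2 * (qpr q K 1 2 2 * qpr q K 1 2 2 ^+ t.-1) * G
   * (H * G * qpr q K 1 2 2 ^+ t)); first by ring.
by rewrite hH -exprS prednK //; ring.
Qed.

(** The matrix is a diagonal matrix times the Weyl matrix. The numbers [2i + 1] and
    [2(2t - 1 - i) + 1] for [i < t] are all odd residues modulo [4t], so the diagonal products
    assemble into [(q; q^2)]. *)
Lemma theta_det_spec (t : nat) (eta : F) K :
  (0 < t)%N -> (8 * t)%N.-primitive_root eta -> (N <= K)%N ->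
  \det (\matrix_(i < t, j < t) phi N q t (w0 t i) (half_period_pt eta j))
  = weylden (@half_period_pt F t eta) *: (qpr q K 1 1 2 * qpr q K 1 (4 * t) (4 * t) ^+ t).
Proof.
move=> t0 peta NK.
pose th (i : 'I_t) := qpr q K 1 (4 * t) (4 * t)
  * (qpr q K 1 (2 * (2 * t - 1 - i) + 1) (4 * t) * qpr q K 1 (2 * i + 1) (4 * t)).
have -> : \matrix_(i < t, j < t) phi N q t (w0 t i) (half_period_pt eta j)
  = diag_mx (\row_i th i) *m map_mx (in_alg R)
     (\matrix_(i < t, j < t) (half_period_pt eta j ^ w0 t i - half_period_pt eta j ^ (- w0 t i))).
  apply/matrixP => i j; rewrite mul_diag_mx !mxE /=.
  have /andP[wb _] := w0_bound i.
  rewrite (phi_half_period _ (half_period_ptX t0 peta j) wb NK) ?half_period_pt_neq0 //.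
  have -> : absz ((2 * t)%:Z + w0 t i) = (2 * (2 * t - 1 - i) + 1)%N.
    by rewrite /w0; have := ltn_ord i; lia.
  have -> : absz ((2 * t)%:Z - w0 t i) = (2 * i + 1)%N.
    by rewrite /w0; have := ltn_ord i; lia.
  by rewrite -scalerAr mulr1.
rewrite det_mulmx det_diag det_map_mx weyl_denominator; last first.
  by move=> j; apply: half_period_pt_neq0.
rewrite /= -scalerAr mulr1; congr (_ *: _).
under eq_bigr do rewrite mxE.
rewrite big_split /= prodr_const card_ord mulrC; congr (_ * _).
(* Extending the product to [2 t K] factors makes it split evenly into [2t] progressions of length
   [K]. *)
rewrite -(@qpr_stable _ _ _ _ qN K (2 * t * K)) //; last by nia.
rewrite /qpr (prod_progression (fun m => 1 - 1 *: q ^+ (1 + 2 * m)) (2 * t) K).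
rewrite (prod_fold (fun j => \prod_(k < K) (1 - 1 *: q ^+ (1 + 2 * (j + 2 * t * k))))).
apply: eq_bigr => i _; rewrite mulrC; congr (_ * _); apply: eq_bigr => k _;
  by congr (1 - 1 *: q ^+ _); lia.
Qed.
End Specialization.

(** * Transfer of the constant between coefficient rings, and coefficients of the product side *)

Lemma qev_low (P : {poly int}) N : (forall i, (i < N)%N -> P`_i = 0) ->
  forall (F : fieldType) (R : comAlgType F) (q : R), q ^+ N = 0 -> qev q P = 0.
Proof.
move=> P0 F R q qN; rewrite /qev horner_poly big1 // => i _.
case: (ltnP i N) => iN; first by rewrite P0 // mulr0z mul0r.
by rewrite (expr_nilp_ge qN) ?mulr0.
Qed.

Lemma in_qpoly_coef (A : nzRingType) (n : nat) (p : {poly A}) i :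
  in_qpoly ('X^(n.+1) : {poly A}) p = 0 -> (i < n.+1)%N -> p`_i = 0.
Proof.
move=> /(congr1 (fun z : {poly %/ ('X^(n.+1) : {poly A})} => (z : {poly A}))) /=; rewrite mk_monic_Xn => p0 iN.
by rewrite (Pdiv.RingMonic.rdivp_eq (monicXn A n.+1) p) p0 addr0 coefMXn iN.
Qed.

Lemma qev_in_qpoly (F : fieldType) (h : {poly F}) (P : {poly int}) :
  qev (in_qpoly h 'X) P = in_qpoly h (map_poly intr P).
Proof.
have qD A B : qev (in_qpoly h 'X) (A + B) = qev (in_qpoly h 'X) A + qev (in_qpoly h 'X) B.
  exact: rmorphD.
have qM A B : qev (in_qpoly h 'X) (A * B) = qev (in_qpoly h 'X) A * qev (in_qpoly h 'X) B.
  exact: rmorphM.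
have qZ (c : int) : qev (in_qpoly h 'X) c%:P = c%:~R by rewrite /qev map_polyC hornerC.
elim/poly_ind: P => [|P c IHP].
  by rewrite /qev !rmorph0 horner0.
have qX : qev (in_qpoly h 'X) 'X = in_qpoly h 'X by rewrite -[X in qev _ X]expr1 qevXn expr1.
rewrite qD qM IHP qZ qX.
rewrite !rmorphD !rmorphM /= map_polyX map_polyC /=; congr (_ + _).
by rewrite [c%:~R%:P]rmorph_int rmorph_int.
Qed.

(** At the special points over [algC] both evaluations contain the same nonzero scalar and the same
    regular element; cancelling them identifies [C] with [excess] up to order [n]. Over [R] the
    constant is then itself regular, and cancels. *)
Theorem macdonald_identity (F : fieldType) (R : comAlgType F) (n : nat) (q : R)
    (t : nat) (y : 'I_t -> F) K :
  (0 < t)%N -> q ^+ n.+1 = 0 -> (forall j, y j != 0) -> (n < K)%N ->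
  \det (\matrix_(i < t, j < t) phi n.+1 q t (w0 t i) (y j))
  = weylden y *: macdonald_prod q (fun j => y j ^+ 2) K.
Proof.
move=> t0 qN y0 NK; have [C hC] := theta_det n.+1 t.
have [eta peta] := C_prim_root_exists (ltac:(by rewrite muln_gt0) : (0 < 8 * t)%N).
pose R1 : comAlgType algC := {poly %/ ('X^(n.+1) : {poly algC})}.
pose q1 : R1 := in_qpoly ('X^(n.+1) : {poly algC}) 'X.
have q1N : q1 ^+ n.+1 = 0.
  rewrite /q1 -rmorphXn; apply/val_inj => /=.
  by rewrite mk_monic_Xn Pdiv.RingMonic.rmodpp ?monicXn.
have spec0 j := @half_period_pt_neq0 _ t eta t0 peta j.
have := hC _ _ q1 _ q1N spec0.
rewrite (theta_prod t0 q1N spec0 NK) (macdonald_prod_spec q1N t0 peta NK).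
rewrite (theta_det_spec q1N t0 peta NK) -scalerAr.
move=> /(scalerI (weylden_half_period_neq0 t0 peta)).
set D := _ * _ ^+ t; have Dreg : GRing.lreg D.
  apply: lregM; first exact: (qpr_lreg q1N).
  by apply: lregX; apply: (qpr_lreg q1N); rewrite muln_gt0.
rewrite ![_ * D]mulrC => /Dreg /eqP; rewrite -subr_eq0 => /eqP hE.
have CE : qev q (excess t K) = qev q C.
  apply/eqP; rewrite -subr_eq0; apply/eqP.
  have -> : qev q (excess t K) - qev q C = qev q (excess t K - C) by rewrite rmorphB.
  apply: (@qev_low _ n.+1) => // i iN.
  (* The equality in [algC[X] / X^(n+1)] is read coefficientwise and descends to the integers. *)
  have : (map_poly (intr : int -> algC) (excess t K - C))`_i = 0.
    apply: (@in_qpoly_coef _ n) => //.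
    by rewrite -qev_in_qpoly -hE; exact: rmorphB.
  by rewrite coef_map /= => /eqP; rewrite intr_eq0 => /eqP.
have := hC _ _ q y qN y0; rewrite (theta_prod t0 qN y0 NK) CE scalerAr.
have Creg : GRing.lreg (qev q C).
  have qM P Q : qev q (P * Q) = qev q P * qev q Q by exact: rmorphM.
  have qX P k : qev q (P ^+ k) = qev q P ^+ k by exact: rmorphXn.
  rewrite -CE /excess qM !qX !qev_poch.
  by apply: lregM; apply: lregX; apply: (qpr_lreg qN).
by move=> /Creg.
Qed.

Lemma det_sum_rows (R : comNzRingType) (t : nat) (I : finType) (G : 'I_t -> I -> 'I_t -> R) :
  \det (\matrix_(i < t, j < t) \sum_(k : I) G i k j)
  = \sum_(v : {ffun 'I_t -> I}) \det (\matrix_(i < t, j < t) G i (v i) j).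
Proof.
rewrite /determinant [RHS]exchange_big; apply: eq_bigr => s _ /=.
rewrite -mulr_sumr; congr (_ * _).
under eq_bigr do rewrite mxE.
rewrite bigA_distr_bigA; apply: eq_bigr => v _.
by apply: eq_bigr => i _; rewrite mxE.
Qed.

Definition wvec (t : nat) (k : 'I_t -> int) (i : 'I_t) : int := w0 t i + 4 * t%:Z * k i.

Definition wexp (t : nat) (k : 'I_t -> int) : nat :=
  \sum_(i < t) absz (2 * t%:Z * k i ^+ 2 + w0 t i * k i)%R.

Definition boxvec (t K : nat) (v : {ffun 'I_t -> 'I_(2 * K).+1}) (i : 'I_t) : int :=
  (v i)%:Z - K%:Z.

Definition wdet (F : fieldType) (t : nat) (y : 'I_t -> F) (w : 'I_t -> int) : F :=
  \det (\matrix_(i < t, j < t) (y j ^ w i - y j ^ (- w i))).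

Lemma in_qpolyX (F : fieldType) (h : {poly F}) e :
  in_qpoly h 'X^e = in_qpoly h 'X ^+ e.
Proof. exact: rmorphXn. Qed.

(** Multilinearity expands the determinant of the [phi_i] over the box of vectors with entries in
    [[-n-3, n+3]], the range of summation in [phi n.+1]. [P] lifts this expansion to polynomials,
    and congruence modulo [X^(n+1)] preserves the coefficient of index [n]. *)
Lemma rhs_trunc_coef (F : fieldType) (t : nat) (y : 'I_t -> F) (n : nat) :
  (0 < t)%N -> (forall j, y j != 0) ->
  weylden y * (rhs_trunc (fun j => y j ^+ 2) n)`_n
  = \sum_(v : {ffun 'I_t -> 'I_(2 * n.+3).+1} | wexp (boxvec v) == n)
       wdet y (wvec (boxvec v)).
Proof.
move=> t0 y0; pose h : {poly F} := 'X^(n.+1).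
pose q := in_qpoly h 'X.
have qN : q ^+ n.+1 = 0.
  rewrite /q -in_qpolyX; apply/val_inj => /=.
  by rewrite mk_monic_Xn Pdiv.RingMonic.rmodpp ?monicXn.
have hX (c : F) e : in_qpoly h (c *: 'X^e) = c *: q ^+ e by rewrite in_qpolyZ in_qpolyX.
have hpoch c e s : in_qpoly h (qpoch n c e s) = qpr q n.+1 c e s.
  rewrite /qpoch rmorph_prod; apply: eq_bigr => k _.
  by rewrite -hX -(in_qpoly1 h); exact: rmorphB.
have hrhs : in_qpoly h (rhs_trunc (fun j => y j ^+ 2) n)
    = macdonald_prod q (fun j => y j ^+ 2) n.+1.
  rewrite /rhs_trunc /macdonald_prod !in_qpolyM !hpoch.
  have -> : in_qpoly h (qpoch n 1 2 2 ^+ t.-1) = qpr q n.+1 1 2 2 ^+ t.-1.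
    by rewrite -hpoch; exact: rmorphXn.
  congr (_ * _ * _); rewrite rmorph_prod; apply: eq_bigr => i _.
    rewrite rmorph_prod; apply: eq_bigr => j _.
    by rewrite /= !in_qpolyM !hpoch.
  by rewrite /= in_qpolyM !hpoch.
pose P : {poly F} := \sum_(v : {ffun 'I_t -> 'I_(2 * n.+3).+1})
   wdet y (wvec (boxvec v)) *: 'X^(wexp (boxvec v)).
have hP : in_qpoly h P = in_qpoly h (weylden y *: rhs_trunc (fun j => y j ^+ 2) n).
  rewrite in_qpolyZ hrhs -(macdonald_identity t0 qN y0 (ltnSn n)).
  have -> : \matrix_(i < t, j < t) phi n.+1 q t (w0 t i) (y j)
    = \matrix_(i < t, j < t) \sum_(k < (2 * n.+3).+1)
       (y j ^ (w0 t i + 4 * t%:Z * (k%:Z - n.+3%:Z)) - y j ^ (- (w0 t i + 4 * t%:Z * (k%:Z - n.+3%:Z))))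
        *: q ^+ absz (2 * t%:Z * (k%:Z - n.+3%:Z) ^+ 2 + w0 t i * (k%:Z - n.+3%:Z)).
    apply/matrixP => i j; rewrite !mxE /phi /thetaU !int_box_ord -sumrB.
    by apply: eq_bigr => k _; rewrite exprz_inv scalerBl.
  rewrite (det_sum_rows (fun i (k : 'I_(2 * n.+3).+1) j =>
       (y j ^ (w0 t i + 4 * t%:Z * (k%:Z - n.+3%:Z)) - y j ^ (- (w0 t i + 4 * t%:Z * (k%:Z - n.+3%:Z))))
        *: q ^+ absz (2 * t%:Z * (k%:Z - n.+3%:Z) ^+ 2 + w0 t i * (k%:Z - n.+3%:Z)))).
  rewrite raddf_sum; apply: eq_bigr => v _; rewrite /= hX.
  transitivity (\det (diag_mx (\row_i q ^+ absz (2 * t%:Z * boxvec v i ^+ 2 + w0 t i * boxvec v i))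
    *m map_mx (in_alg _)
      (\matrix_(i < t, j < t) (y j ^ wvec (boxvec v) i - y j ^ (- wvec (boxvec v) i))))).
    rewrite det_mulmx det_diag det_map_mx -/(wdet y _) /= -scalerAr mulr1; congr (_ *: _).
    rewrite /wexp -prodrXr; apply: eq_bigr => i _; by rewrite mxE.
  congr (\det _); apply/matrixP => i j; rewrite mul_diag_mx !mxE /=.
  by rewrite -scalerAr mulr1.
have : (P - weylden y *: rhs_trunc (fun j => y j ^+ 2) n)`_n = 0.
  apply: (@in_qpoly_coef _ n) => //.
  by rewrite -/h -[RHS](subrr (in_qpoly h P)) {2}hP; exact: rmorphB.
rewrite coefB coefZ => /eqP; rewrite subr_eq0 => /eqP <-.
rewrite /P coef_sum [RHS]big_mkcond; apply: eq_bigr => v _.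
by rewrite coefZ coefXn eq_sym; case: ifP => _; rewrite ?mulr1 ?mulr0.
Qed.

(** * Self-conjugate cores *)

(* Membership in the set of all [lambda_i - i], [i >= 1]: as [lambda_i = 0] for
   [i > size l], the value [k] can only be attained at some [i <= size l + |k| + 1]. *)
Definition maya (l : seq nat) (k : int) : bool :=
  has (fun i => cval l i.+1 == k) (iota 0 (size l + absz k).+1).

Lemma cvalE l i : cval l i.+1 = (nth 0%N l i)%:Z - i%:Z - 1.
Proof. by rewrite /cval /part /=; lia. Qed.

Lemma cval_out l i : (size l <= i)%N -> cval l i.+1 = - i%:Z - 1.
Proof. by move=> li; rewrite cvalE nth_default //; lia. Qed.

Lemma mayaP l k : reflect (exists i, cval l i.+1 = k) (maya l k).
Proof.
apply: (iffP hasP) => [[i _ /eqP]|[i ai]]; first by exists i.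
exists i; last by rewrite ai.
rewrite mem_iota /=; case: (leqP (size l) i) => li; last by lia.
by move: ai; rewrite cval_out //; lia.
Qed.

Lemma geq_trans : transitive geq.
Proof. by move=> a b c /= h1 h2; apply: leq_trans h2 h1. Qed.

Section Partition.
Variable l : seq nat.
Hypothesis pl : is_partition l.

Lemma part_mono i j : (i <= j)%N -> (nth 0%N l j <= nth 0%N l i)%N.
Proof.
move=> ij; case: (ltnP j (size l)) => jl; last by rewrite nth_default.
have /andP[sl _] := pl.
have := sorted_leq_nth geq_trans (fun x => leqnn x) 0%N sl.
by move=> /(_ i j); rewrite !inE => h; apply: h => //; lia.
Qed.

Lemma lt_size_part i : (i < size l)%N = (0 < nth 0%N l i)%N.
Proof.
apply/idP/idP => [il|]; last by case: (ltnP i (size l)) => // li; rewrite nth_default.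
have /andP[_ n0] := pl; rewrite lt0n; apply: contra n0 => /eqP <-; exact: mem_nth.
Qed.

Lemma conj_partP p i : (0 < p)%N -> (i < conj_part l p)%N = (p <= nth 0%N l i)%N.
Proof.
move=> p0; have /andP[sl _] := pl; rewrite /conj_part.
have : sorted geq l by [].
elim: {sl} l i => [|x s IHs] i /=; first by move=> _; rewrite nth_nil; lia.
move=> ps; have ss := path_sorted ps.
have /allP hx := order_path_min geq_trans ps.
case: (leqP p x) => px.
  case: i => [|i] /=; first by rewrite px add1n.
  by rewrite add1n ltnS IHs.
have c0 : count (fun q => p <= q)%N s = 0%N.
  apply/eqP; rewrite -leqn0 leqNgt -has_count; apply/hasPn => y ys.
  by rewrite -ltnNge; apply: leq_ltn_trans px; apply: hx.
rewrite c0 /=; case: i => [|i] /=; first by rewrite (leqNgt p x) px.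
by have := IHs i ss; rewrite c0 => <-.
Qed.

(** The classical fact that the numbers [lambda_i - i] and [j - 1 - lambda'_j] partition the
    integers. *)
Lemma maya_compl k :
  reflect (exists p : nat, k = p%:Z - (conj_part l p.+1)%:Z) (~~ maya l k).
Proof.
apply: (iffP idP) => [nk|[p ->]]; last first.
  apply/mayaP => -[i]; rewrite cvalE.
  by have := conj_partP i (ltn0Sn p); case: (ltnP i _) => h1 /esym h2; lia.
(* For the least [i] whose value is below [k], all earlier values exceed [k], as [k] is not a value;
   so column [k + i + 1] has exactly [i] boxes. *)
have hex : exists i, cval l i.+1 < k.
  exists (size l + absz k)%N; rewrite cval_out; lia.
case: (ex_minnP hex) => i ik imin.
have ge0 : 0 <= k + i%:Z by move: ik; rewrite cvalE; lia.
exists (absz (k + i%:Z)); have -> : conj_part l (absz (k + i%:Z)).+1 = i; last by lia.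
apply/eqP; rewrite eqn_leq; apply/andP; split.
  rewrite leqNgt conj_partP // -ltnNge; move: ik; rewrite cvalE; lia.
case: i ik imin ge0 => // i ik imin ge0.
rewrite conj_partP //.
have : ~~ (cval l i.+1 < k) by apply/negP => /imin; rewrite ltnn.
have : cval l i.+1 != k by apply: contra nk => /eqP h; apply/mayaP; exists i.
by rewrite cvalE; lia.
Qed.

Lemma cval_decr i j : (i < j)%N -> cval l j.+1 < cval l i.+1.
Proof. by move=> ij; rewrite !cvalE; have := part_mono (ltnW ij); lia. Qed.

Lemma cval_inj i j : cval l i.+1 = cval l j.+1 -> i = j.
Proof. by case: (ltngtP i j) => // /cval_decr; lia. Qed.

Section SelfConjugate.
Hypothesis sl : self_conjugate l.

Lemma conj_partE p : conj_part l p.+1 = nth 0%N l p.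
Proof.
have /eqP cE := sl; rewrite -[in RHS]cE /conj_partition.
case: (ltnP p (head 0%N l)) => ph.
  by rewrite (nth_map 0%N) ?size_iota // nth_iota // add1n.
rewrite nth_default ?size_map ?size_iota //.
apply/eqP; rewrite -leqn0 leqNgt conj_partP // nth0 -ltnNge ltnS //.
Qed.

Lemma maya_sym k : maya l (-1 - k) = ~~ maya l k.
Proof.
apply/idP/idP => [/mayaP[i hi]|/maya_compl[p kp]].
  by apply/maya_compl; exists i; rewrite conj_partE; move: hi; rewrite cvalE; lia.
by apply/mayaP; exists p; rewrite cvalE -conj_partE; lia.
Qed.

Lemma hook_cval i j : (j < nth 0%N l i)%N ->
  (hook l (i.+1, j.+1))%:Z = cval l i.+1 + cval l j.+1 + 1.
Proof.
move=> ji; rewrite /hook /= conj_partE /part /= !cvalE.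
have ij : (i < nth 0%N l j)%N by rewrite -conj_partE conj_partP.
by lia.
Qed.

(** By self-conjugacy, [j < lambda_i] and [i < lambda_j] (indices from 0) hold or fail together, so
    the sum is [>= 0] or [<= -2]. Conditions on boxes thereby become conditions on pairs of
    values. *)
Lemma box_cval i j : (j < nth 0%N l i)%N = (0 <= cval l i.+1 + cval l j.+1).
Proof.
rewrite !cvalE; have := conj_partP i (ltn0Sn j); rewrite conj_partE.
by case: (ltnP i _) => h1 /esym h2; lia.
Qed.

End SelfConjugate.
End Partition.

Lemma mem_boxes l i j :
  ((i, j) \in boxes l) = [&& (0 < i)%N, (0 < j)%N & (j <= nth 0%N l i.-1)%N].
Proof.
apply/allpairsPdep/idP => [[i' [j' []]]|].
  by rewrite !mem_iota => hi hj [-> ->]; rewrite /part in hj; lia.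
case/and3P => i0 j0 ji; exists i, j; split=> //; rewrite mem_iota; last by rewrite /part; lia.
by case: (ltnP i.-1 (size l)) => [|h]; [lia | move: ji; rewrite nth_default //; lia].
Qed.

Section Core.
Variables (g : nat) (l : seq nat).
Hypotheses (g0 : (0 < g)%N) (pl : is_partition l) (sl : self_conjugate l).

(** If [k] is a value and [k - g] is not, [maya_compl] produces a column meeting the row of [k] in a
    box of hook length exactly [g]. *)
Lemma maya_core : is_core g l -> forall k, maya l k -> maya l (k - g%:Z).
Proof.
move=> /allP hcore k /mayaP[i ik]; apply/negPn/negP => /maya_compl-/(_ pl)[j].
rewrite conj_partE // => kj.
have ji : (j < nth 0%N l i)%N by rewrite box_cval //; move: kj; rewrite -ik !cvalE; lia.
have /hcore : (i.+1, j.+1) \in boxes l by rewrite mem_boxes.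
suff -> : hook l (i.+1, j.+1) = g by rewrite dvdnn.
by have := hook_cval pl sl ji; move: kj; rewrite -ik !cvalE; lia.
Qed.

(** A hook length [m g] would place both a value and its mirror image under [z -> -1 - z] in the
    set, against [maya_sym]. *)
Lemma core_of_maya : (forall k, maya l k -> maya l (k - g%:Z)) -> is_core g l.
Proof.
move=> hm; have hmn k m : maya l k -> maya l (k - (m * g)%N%:Z).
  elim: m => [|m IHm] mk; first by rewrite subr0.
  by have := hm _ (IHm mk); rewrite mulSn PoszD; congr maya; ring.
apply/allP => -[i j]; rewrite mem_boxes => /and3P[].
case: i => // i _; case: j => // j _ ji; apply/negP => /dvdnP[m hE].
have := hook_cval pl sl ji; rewrite hE => h.
have /(hmn _ m) : maya l (cval l i.+1) by apply/mayaP; exists i.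
have -> : cval l i.+1 - (m * g)%N%:Z = -1 - cval l j.+1 by rewrite h; ring.
by rewrite maya_sym // => /negP; apply; apply/mayaP; exists j.
Qed.
End Core.

Lemma sum_fold (V : nmodType) (f : nat -> V) (t : nat) :
  \sum_(i < 2 * t) f i = \sum_(i < t) (f i + f (2 * t - 1 - i)%N).
Proof.
rewrite mul2n -addnn big_split_ord /= big_split /=; congr (_ + _).
rewrite (reindex_inj rev_ord_inj) /=; apply: eq_bigr => i _; congr f.
by have := ltn_ord i; lia.
Qed.

Section Beta.
Variables (g : nat) (l : seq nat).
Hypotheses (g0 : (0 < g)%N) (pl : is_partition l) (hm : forall k, maya l k -> maya l (k - g%:Z)).

Lemma maya_iter k m : maya l k -> maya l (k - m%:Z * g%:Z).
Proof.
elim: m => [|m IHm] mk; first by rewrite mul0r subr0.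
by have := hm (IHm mk); rewrite intS; congr maya; ring.
Qed.

Lemma beta_spec r :
  [/\ ((beta g l r - r%:Z) %% g%:Z)%Z = 0,
      maya l (beta g l r - g%:Z)
    & forall k : int, ((k - r%:Z) %% g%:Z)%Z = 0 -> maya l k -> k <= beta g l r - g%:Z].
Proof.
have gz : g%:Z != 0 by lia.
rewrite /beta; set cond := fun j : nat => ((cval l j - r%:Z) %% g%:Z)%Z == 0.
set x0 := - _; set b := \big[_/_]_(_ <= _ < _ | _) _.
have -> : g%:Z + b - g%:Z = b by ring.
have -> : ((g%:Z + b - r%:Z) %% g%:Z)%Z = ((b - r%:Z) %% g%:Z)%Z.
  by rewrite -addrA modzDl.
have ub j : (0 < j < (size l + g).+1)%N -> cond j -> cval l j <= b.
  move=> jr cj; rewrite /b; apply: le_bigmax_seq => //.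
  by rewrite mem_index_iota.
have att : b = x0 \/ exists2 j, (0 < j)%N && cond j & b = cval l j.
  rewrite /b big_nat_cond; apply: (big_ind (fun z => z = x0 \/ exists2 j, (0 < j)%N && cond j & z = cval l j)).
  - by left.
  - by move=> u v hu hv; case: (leP u v).
  - by move=> j /andP[/andP[j1 _] cj]; right; exists j; rewrite ?j1.
(* Among the [g] consecutive values just below [- size l] one lies in the residue class. All of them
   are at least the neutral element of the maximum, which therefore creates no spurious value. *)
have [j0 j0r cj0] : exists2 j, (size l < j < (size l + g).+1)%N & cond j.
  pose d := absz ((- (size l)%:Z - 1 - r%:Z) %% g%:Z)%Z.
  have dE : d%:Z = ((- (size l)%:Z - 1 - r%:Z) %% g%:Z)%Z by rewrite /d gez0_abs // modz_ge0.
  have dg : (d < g)%N by rewrite -ltz_nat dE ltz_pmod.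
  exists (size l + d).+1; first by lia.
  rewrite /cond cval_out; last by lia.
  have -> : - (size l + d)%N%:Z - 1 - r%:Z
     = ((- (size l)%:Z - 1 - r%:Z) %/ g%:Z)%Z * g%:Z.
    have := divz_eq (- (size l)%:Z - 1 - r%:Z) g%:Z; rewrite -dE PoszD.
    by move: (_ %/ _)%Z => e; lia.
  by rewrite modzMl.
have bj0 : cval l j0 <= b by apply: ub => //; lia.
have j0E : cval l j0 = - j0%:Z by case: (j0) j0r => // j j0r; rewrite cval_out; lia.
have {att} [j /andP[jp cj] bE] : exists2 j, (0 < j)%N && cond j & b = cval l j.
  case: att => // bx; exists j0; first by rewrite cj0 andbT; lia.
  by move: bj0; rewrite j0E bx /x0; lia.
split.
- by rewrite bE; apply/eqP.
- by rewrite bE; apply/mayaP; exists j.-1; rewrite prednK.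
- move=> k kr /mayaP[i ik].
  case: (ltnP i (size l + g)) => il.
    by rewrite -ik; apply: ub; [lia | rewrite /cond ik kr].
  by move: ik; rewrite cval_out; lia.
Qed.

Lemma maya_beta r (k : int) : ((k - r%:Z) %% g%:Z)%Z = 0 -> maya l k = (k < beta g l r).
Proof.
move=> kr; have [br mb ub] := beta_spec r.
apply/idP/idP => [/(ub _ kr)|kb]; first by lia.
have gz : g%:Z != 0 by lia.
have e1 := divz_eq (k - r%:Z) g%:Z; rewrite kr addr0 in e1.
have e2 := divz_eq (beta g l r - r%:Z) g%:Z; rewrite br addr0 in e2.
move: e1 e2; move: (_ %/ _)%Z => d1; move: (_ %/ _)%Z => d2 e1 e2.
have d12 : d1 < d2 by move: kb; nia.
have := maya_iter (absz (d2 - d1 - 1)%R) mb; rewrite gez0_abs; last by lia.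
by congr maya; move: e1 e2; lia.
Qed.

Lemma beta_eqmod r m : ((beta g l r - m%:Z * g%:Z - r%:Z) %% g%:Z)%Z = 0.
Proof.
have [br _ _] := beta_spec r; rewrite -[RHS]br.
have -> : beta g l r - m%:Z * g%:Z - r%:Z = - m%:Z * g%:Z + (beta g l r - r%:Z) by ring.
by rewrite modzMDl.
Qed.

(** Both sides add [f] over all [lambda_i - i], listed by rows and by residue classes; the vanishing
    of [f] below [-B] makes both truncations harmless. *)
Lemma runner_sum (V : nmodType) (f : int -> V) (B M L : nat) :
  (forall a : int, a < - B%:Z -> f a = 0) -> (size l <= M)%N -> (B <= M)%N ->
  (forall r : 'I_g, beta g l r + B%:Z <= L%:Z) ->
  \sum_(i < M) f (cval l i.+1)
  = \sum_(r < g) \sum_(m < L) f (beta g l r - m.+1%:Z * g%:Z).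
Proof.
move=> f0 lM BM hL; have gz : g%:Z != 0 by lia.
pose h k := if maya l k then f k else 0.
have s1 : sums_to h (\sum_(i < M) f (cval l i.+1)).
  exists [seq cval l i.+1 | i <- iota 0 M]; split.
  - by rewrite map_inj_uniq ?iota_uniq // => i j; apply: cval_inj.
  - move=> k kn; rewrite /h; case: ifP => // /mayaP[i ik]; apply: f0.
    have iM : (M <= i)%N.
      rewrite leqNgt; apply: contra kn => iM; apply/mapP; exists i => //.
      by rewrite mem_iota.
    by rewrite -ik cval_out; lia.
  - rewrite big_map -(big_mkord xpredT (fun i => f (cval l i.+1))) /index_iota subn0.
    by apply: eq_bigr => i _; rewrite /h ifT //; apply/mayaP; exists i.
apply: sums_to_unique s1 _.
exists [seq beta g l (r : 'I_g) - m.+1%:Z * g%:Z | r : 'I_g <- enum 'I_g, m : nat <- iota 0 L]; split.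
- apply: allpairs_uniq; rewrite ?enum_uniq ?iota_uniq // => -[r m] [r' m'] _ _ /= e.
  have rr : r = r'.
    have h1 := beta_eqmod r m.+1; have h2 := beta_eqmod r' m'.+1; rewrite -e in h2.
    have e1 := divz_eq (beta g l r - m.+1%:Z * g%:Z - r%:Z) g%:Z; rewrite h1 addr0 in e1.
    have e2 := divz_eq (beta g l r - m.+1%:Z * g%:Z - r'%:Z) g%:Z; rewrite h2 addr0 in e2.
    apply/val_inj => /=; have := ltn_ord r; have := ltn_ord r'.
    move: e1 e2; move: (_ %/ _)%Z => d1; move: (_ %/ _)%Z => d2 e1 e2 l1 l2.
    have : (d2 - d1) * g%:Z = r%:Z - r'%:Z by lia.
    have : d2 - d1 = 0 by nia.
    by move=> ->; lia.
  rewrite -rr in e *; congr pair.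
  have /(mulIf gz) : m.+1%:Z * g%:Z = m'.+1%:Z * g%:Z by lia.
  by lia.
- move=> k kn; rewrite /h; case: ifP => // mk; apply: f0.
  pose r := absz (k %% g%:Z)%Z.
  have rE : r%:Z = (k %% g%:Z)%Z by rewrite /r gez0_abs // modz_ge0.
  have rg : (r < g)%N by rewrite -ltz_nat rE ltz_pmod.
  have kr : ((k - r%:Z) %% g%:Z)%Z = 0.
    by rewrite {1}(divz_eq k g%:Z) rE addrK modzMl.
  have kb := mk; rewrite (maya_beta kr) in kb.
  have [br _ _] := beta_spec r.
  have e1 := divz_eq (k - r%:Z) g%:Z; rewrite kr addr0 in e1.
  have e2 := divz_eq (beta g l r - r%:Z) g%:Z; rewrite br addr0 in e2.
  move: e1 e2; move: (_ %/ _)%Z => d1; move: (_ %/ _)%Z => d2 e1 e2.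
  have d12 : d1 < d2 by move: kb; nia.
  have mE : (absz (d2 - d1 - 1)%R).+1%:Z = d2 - d1 by lia.
  have kE : k = beta g l r - (absz (d2 - d1 - 1)%R).+1%:Z * g%:Z.
    by rewrite mE mulrBl -e1 -e2; ring.
  rewrite ltNge; apply: contra kn => kB; rewrite kE.
  apply/allpairsP; exists (Ordinal rg, absz (d2 - d1 - 1)%R) => /=; split=> //.
    by rewrite mem_enum.
  rewrite mem_iota /= add0n -ltz_nat.
  have := hL (Ordinal rg); move: kB kE; rewrite mE /=; nia.
- rewrite big_allpairs_dep big_enum /=; apply: eq_bigr => r _.
  rewrite -(big_mkord xpredT (fun m => f (beta g l r - m.+1%:Z * g%:Z))) /index_iota subn0.
  apply: eq_bigr => m _; rewrite /h (maya_beta (beta_eqmod r m.+1)) ifT //.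
  by rewrite gtrBl mulr_gt0.
Qed.
End Beta.

(** Reading the coordinate from the upper residue [2t - 1 - i] gives
    [w_i = 2 beta_(2t-1-i) - 2t + 1]. *)
Definition kvec (t : nat) (l : seq nat) (i : 'I_t) : int :=
  ((beta (2 * t) l (2 * t - 1 - i) - (2 * t - 1 - i)%N%:Z) %/ (2 * t)%N%:Z)%Z.

(* The values [beta_i] ([b = true]) and [beta_(2t-1-i)] ([b = false]), whose sum is
   [2t - 1]. *)
Definition bvec (t : nat) (k : 'I_t -> int) (i : 'I_t) (b : bool) : int :=
  if b then i%:Z - (2 * t)%:Z * k i else (2 * t)%:Z - 1 - i%:Z + (2 * t)%:Z * k i.

Section BetaVec.
Variables (t : nat) (l : seq nat).
Hypotheses (t0 : (0 < t)%N) (pl : is_partition l) (sl : self_conjugate l)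
  (cl : is_core (2 * t) l).
Let g0 : (0 < 2 * t)%N. Proof. by rewrite muln_gt0. Qed.
Let hm := maya_core g0 pl sl cl.

Lemma beta_hi (i : 'I_t) : beta (2 * t) l (2 * t - 1 - i) = bvec (@kvec t l) i false.
Proof.
have [br _ _] := beta_spec g0 pl (2 * t - 1 - i).
rewrite /bvec /kvec; set b := beta _ _ _ in br *.
have := divz_eq (b - (2 * t - 1 - i)%N%:Z) (2 * t)%N%:Z; rewrite br addr0.
move: (_ %/ _)%Z => d; have := ltn_ord i; lia.
Qed.

(** The reflection [z -> -1 - z] maps the class of [i] to that of [2t - 1 - i] and exchanges the set
    of values with its complement, so the two thresholds are opposite. *)
Lemma beta_lo (i : 'I_t) : beta (2 * t) l i = bvec (@kvec t l) i true.
Proof.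
suff -> : beta (2 * t) l i = (2 * t)%:Z - 1 - beta (2 * t) l (2 * t - 1 - i).
  by rewrite beta_hi /bvec; lia.
have ilt := ltn_ord i.
have [br mb ub] := beta_spec g0 pl i.
have [br' mb' ub'] := beta_spec g0 pl (2 * t - 1 - i).
have gz : (2 * t)%N%:Z != 0 by lia.
have e1 := divz_eq (beta (2 * t) l i - i%:Z) (2 * t)%N%:Z; rewrite br addr0 in e1.
have e2 := divz_eq (beta (2 * t) l (2 * t - 1 - i) - (2 * t - 1 - i)%N%:Z) (2 * t)%N%:Z.
rewrite br' addr0 in e2.
move: e1 e2; move: (_ %/ _)%Z => d1; move: (_ %/ _)%Z => d2 e1 e2.
set T := (2 * t)%N%:Z in e1 e2 gz *.
have T0 : 0 < T by rewrite /T; lia.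
have m1 (d : int) : maya l (i%:Z + d * T) = (d < d1).
  rewrite (maya_beta g0 pl hm (r := i)); last by rewrite addrC addKr modzMl.
  have -> : beta (2 * t) l i = i%:Z + d1 * T by rewrite -e1; ring.
  by rewrite ltrD2l ltr_pM2r.
have m2 (d : int) : maya l ((2 * t - 1 - i)%N%:Z + d * T) = (d < d2).
  rewrite (maya_beta g0 pl hm (r := (2 * t - 1 - i)%N)); last by rewrite addrC addKr modzMl.
  have -> : beta (2 * t) l (2 * t - 1 - i) = (2 * t - 1 - i)%N%:Z + d2 * T by rewrite -e2; ring.
  by rewrite ltrD2l ltr_pM2r.
have m12 (d : int) : (- d - 1 < d2) = ~~ (d < d1).
  rewrite -m1 -m2 -(maya_sym pl sl); congr maya; rewrite /T; lia.
have h1 := m12 d1; have h2 := m12 (d1 - 1).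
have d12 : d2 = - d1 by lia.
by move: e1 e2; rewrite d12 mulNr => <-; rewrite /T; lia.
Qed.

Lemma runner_sum_bvec (V : nmodType) (f : int -> V) (B M L : nat) :
  (forall a : int, a < - B%:Z -> f a = 0) -> (size l <= M)%N -> (B <= M)%N ->
  (forall i b, bvec (@kvec t l) i b + B%:Z <= L%:Z) ->
  \sum_(i < M) f (cval l i.+1)
  = \sum_(i < t) \sum_(b : bool) \sum_(m < L) f (bvec (@kvec t l) i b - m.+1%:Z * (2 * t)%N%:Z).
Proof.
move=> f0 lM BM hL; rewrite (@runner_sum _ _ g0 pl hm _ _ B M L) //.
  rewrite (sum_fold (fun r => \sum_(m < L) f (beta (2 * t) l r - m.+1%:Z * (2 * t)%N%:Z))).
  apply: eq_bigr => i _; rewrite big_bool.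
  by congr (_ + _); apply: eq_bigr => m _; rewrite ?beta_lo ?beta_hi.
move=> r; case: (ltnP r t) => rt.
  by rewrite (beta_lo (Ordinal rt)).
have rt' : (2 * t - 1 - r < t)%N by have := ltn_ord r; lia.
have -> : (r : nat) = (2 * t - 1 - Ordinal rt')%N by have := ltn_ord r; rewrite /=; lia.
by rewrite beta_hi.
Qed.
End BetaVec.

Lemma boxes_uniq l : uniq (boxes l).
Proof. by apply: allpairs_uniq_dep => [|i _|[i j] [i' j'] _ _ [-> ->]] //; apply: iota_uniq. Qed.

Section Counts.
Variable l : seq nat.
Hypotheses (pl : is_partition l) (sl : self_conjugate l).

Lemma head_size : nth 0%N l 0 = size l.
Proof.
rewrite -conj_partE // /conj_part; apply/eqP; rewrite -all_count.
apply/allP => x xl; have /andP[_ n0] := pl; rewrite lt0n.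
by apply: contra n0 => /eqP <-.
Qed.

(** The first [M] values lie in [[-M, M)], and symmetry leaves exactly one value in each pair
    [{k, -1 - k}]. *)
Lemma symm_sum (V : nmodType) (f : int -> V) (M : nat) : (size l <= M)%N ->
  \sum_(i < M) f (cval l i.+1)
  = \sum_(k < M) f (if maya l k%:Z then k%:Z else -1 - k%:Z).
Proof.
move=> lM; pose c (k : nat) : int := if maya l k%:Z then k%:Z else -1 - k%:Z.
rewrite -(big_mkord xpredT (fun i => f (cval l i.+1))) -(big_mkord xpredT (f \o c)).
rewrite -(big_map (fun i => cval l i.+1) xpredT f) -(big_map c xpredT f).
apply: perm_big; rewrite /index_iota subn0; apply: uniq_perm.
- by rewrite map_inj_uniq ?iota_uniq // => i j; apply: cval_inj.
- rewrite map_inj_uniq ?iota_uniq // => i j; rewrite /c.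
  by case: ifP => _; case: ifP => _; lia.
move=> k; apply/mapP/mapP => -[i]; rewrite mem_iota /= add0n => iM ->.
  have := part_mono pl (leq0n i); rewrite head_size => h.
  have cM : cval l i.+1 < M%:Z by rewrite cvalE; lia.
  have cM' : - M%:Z <= cval l i.+1 by rewrite cvalE; lia.
  have mi : maya l (cval l i.+1) by apply/mayaP; exists i.
  case: (lerP 0 (cval l i.+1)) => c0.
    exists (absz (cval l i.+1)); first by rewrite mem_iota; lia.
    by rewrite /c gez0_abs // mi.
  exists (absz (-1 - cval l i.+1)%R); first by rewrite mem_iota; lia.
  by rewrite /c gez0_abs ?maya_sym ?mi /=; lia.
have : maya l (c i).
  by rewrite /c; case: ifP => // h; rewrite maya_sym // h.
case/mayaP => j hj; exists j => //; rewrite mem_iota /= add0n.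
case: (ltnP j M) => // Mj; move: hj; rewrite cval_out; last by lia.
by rewrite /c; case: ifP; lia.
Qed.

Lemma psize_cval (M : nat) : (size l <= M)%N ->
  psize l = (\sum_(i < M) if (0 <= cval l i.+1)%R then absz (2 * cval l i.+1 + 1)%R else 0)%N.
Proof.
move=> lM; rewrite (symm_sum (fun a => if 0 <= a then absz (2 * a + 1) else 0%N)) //.
apply/eqP; rewrite -eqz_nat; apply/eqP.
have -> : (psize l)%:Z = \sum_(i < M) (cval l i.+1 + (i%:Z + 1)).
  rewrite /psize sumnE (big_nth 0%N) big_mkord -natz natr_sum.
  under eq_bigr do rewrite natz.
  rewrite (big_ord_widen M (fun i => (nth 0%N l i)%:Z)) // big_mkcond.
  apply: eq_bigr => i _; rewrite cvalE; case: ltnP => il; first by lia.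
  by rewrite nth_default //; lia.
(* Index [k] now contributes [2k + 1], a diagonal hook length, if [k] is a value, and
   [(-1 - k) + (k + 1) = 0] otherwise. *)
rewrite big_split /= (symm_sum id) // -big_split /= -natz natr_sum.
apply: eq_bigr => k _; rewrite natz; case: (maya l k%:Z) => /=; first by lia.
by rewrite (_ : (0 <= -1 - k%:Z) = false); lia.
Qed.

Lemma durfeeE i : (i < durfee l)%N = (0 <= cval l i.+1).
Proof.
rewrite /durfee; apply/idP/idP => [h|h].
  have [s0 s0P] : exists s : 'I_(size l).+1, (i < s <= part l s)%N.
    apply/existsP; move: h; apply: contraLR; rewrite negb_exists => /forallP h.
    rewrite -leqNgt; apply/bigmax_leqP => s sP; rewrite leqNgt; apply/negP => is_.
    by have := h s; rewrite is_ sP.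
  rewrite cvalE; have := @part_mono _ pl i s0.-1; rewrite /part in s0P; lia.
have il : (i.+1 < (size l).+1)%N.
  by rewrite ltnS lt_size_part //; move: h; rewrite cvalE; lia.
apply: (@leq_bigmax_cond _ (fun s : 'I_(size l).+1 => (s <= part l s)%N)
          (fun s => s : nat) (Ordinal il)).
by rewrite /part /=; move: h; rewrite cvalE; lia.
Qed.

Lemma durfee_count (M : nat) : (size l <= M)%N ->
  durfee l = (\sum_(i < M) (0 <= cval l i.+1)%R)%N.
Proof.
move=> lM; under eq_bigr do rewrite -durfeeE.
have dM : (durfee l <= M)%N.
  by apply/bigmax_leqP => s _; have := ltn_ord s; lia.
rewrite -big_mkcond /= -(big_ord_widen M (fun=> 1%N)) // sum1_card card_ord //.
Qed.

Lemma diag_count (g M : nat) : (size l <= M)%N ->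
  size [seq s <- Hplus g l | s \in diag l]
  = (\sum_(i < M) (0 < 2 * cval l i.+1 + 1 < g%:Z)%R)%N.
Proof.
move=> lM; pose c (i : nat) := (0 < 2 * cval l i.+1 + 1 < g%:Z)%R.
have ub := boxes_uniq l.
have /perm_size -> : perm_eq [seq s <- Hplus g l | s \in diag l]
     [seq (i.+1, i.+1) | i <- iota 0 M & c i].
  apply: uniq_perm; rewrite ?filter_uniq //.
    by rewrite map_inj_uniq ?filter_uniq ?iota_uniq // => i j [].
  move=> [i j]; rewrite !mem_filter mem_boxes; apply/idP/mapP.
    case/and3P => /mapP[i0]; rewrite mem_iota => hi [-> ->] /andP[hg _] /and3P[i0p _ ji].
    exists i0.-1; last by rewrite prednK.
    have hd : (i0.-1 < nth 0%N l i0.-1)%N by rewrite prednK.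
    have := hook_cval pl sl hd; have := box_cval pl sl i0.-1 i0.-1.
    rewrite hd mem_filter mem_iota /c !prednK //= => /esym h0 h1.
    have : (i0.-1 < size l)%N by rewrite lt_size_part //; lia.
    move: hg => /=; lia.
  case=> i0; rewrite mem_filter mem_iota => /andP[ci hi] [-> ->].
  have h0 : 0 <= cval l i0.+1 + cval l i0.+1 by move: ci; rewrite /c; lia.
  have hd : (i0 < nth 0%N l i0)%N by rewrite box_cval.
  have di : (i0 < durfee l)%N by rewrite durfeeE; lia.
  have := hook_cval pl sl hd; rewrite /= hd andbT leqnn andbT => h1.
  apply/andP; split; first by apply/mapP; exists i0.+1; rewrite ?mem_iota //; lia.
  by move: ci; rewrite /c; lia.
rewrite size_map size_filter -sum1_count big_mkcond /= -(subn0 M) -/(index_iota 0 M) big_mkord.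
by rewrite subn0; apply: eq_bigr => i _; rewrite /c; case: ifP.
Qed.

Lemma Hplus_count (g M : nat) : (size l <= M)%N ->
  size (Hplus g l) = (\sum_(i < M) \sum_(j < M)
     ((0 < cval l i.+1 + cval l j.+1 + 1 < g%:Z)%R && (i <= j)))%N.
Proof.
move=> lM; pose c (p : nat * nat) :=
  (0 < cval l p.1.+1 + cval l p.2.+1 + 1 < g%:Z)%R && (p.1 <= p.2)%N.
have ub := boxes_uniq l.
have /perm_size -> : perm_eq (Hplus g l)
     [seq (p.1.+1, p.2.+1) | p <- [seq (i, j) | i <- iota 0 M, j <- iota 0 M] & c p].
  apply: uniq_perm; rewrite ?filter_uniq //.
    rewrite map_inj_uniq ?filter_uniq ?allpairs_uniq ?iota_uniq //; last by move=> [i j] [i' j'] [-> ->].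
    by move=> [? ?] [? ?] _ _.
  move=> [i j]; rewrite !mem_filter mem_boxes; apply/idP/mapP.
    case/andP => /andP[/= hg ij] /and3P[i0 j0 ji]; case: i i0 hg ij ji => // i _; case: j j0 => // j _ hg ij ji.
    rewrite /= in ji.
    exists (i, j) => //; have := hook_cval pl sl ji; have := box_cval pl sl i j.
    rewrite ji => /esym h0 h1; rewrite mem_filter; apply/andP; split.
      by rewrite /c /=; move: hg; lia.
    apply/allpairsP; exists (i, j); rewrite !mem_iota /= !add0n; split=> //.
      by have : (i < size l)%N; [rewrite lt_size_part //; lia | lia].
    have := part_mono pl (leq0n i); rewrite head_size; lia.
  case=> -[i0 j0]; rewrite mem_filter => /andP[/andP[/= ci ij] _] [-> ->].
  have h0 : 0 <= cval l i0.+1 + cval l j0.+1 by lia.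
  have hd : (j0 < nth 0%N l i0)%N by rewrite box_cval.
  have := hook_cval pl sl hd; rewrite /= hd andbT ltnS ij andbT => h1.
  by lia.
rewrite size_map size_filter -sum1_count big_mkcond /= big_allpairs -(subn0 M) -/(index_iota 0 M) big_mkord.
rewrite subn0; apply: eq_bigr => i _; rewrite -/(index_iota 0 M) big_mkord.
by apply: eq_bigr => j _; rewrite /c /=; case: ifP.
Qed.

(** Doubling removes the condition [i <= j]: the symmetric sum no longer refers to the order of the
    rows and can be regrouped by residue classes. *)
Lemma Hplus_double (g M : nat) : (size l <= M)%N ->
  (2 * size (Hplus g l))%N = (\sum_(i < M) \sum_(j < M)
     (0 < cval l i.+1 + cval l j.+1 + 1 < g%:Z)%R
   + \sum_(i < M) (0 < 2 * cval l i.+1 + 1 < g%:Z)%R)%N.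
Proof.
move=> lM; rewrite (Hplus_count g lM) mul2n -addnn {2}exchange_big -big_split -big_split.
apply: eq_bigr => i _ /=; rewrite -big_split /=.
rewrite [in RHS](bigD1 i) //= [in LHS](bigD1 i) //= leqnn !andbT.
have -> : cval l i.+1 + cval l i.+1 + 1 = 2 * cval l i.+1 + 1 by ring.
rewrite addnAC; congr (_ + _ + _)%N. apply: eq_bigr => j ji.
have -> : cval l j.+1 + cval l i.+1 + 1 = cval l i.+1 + cval l j.+1 + 1 by ring.
case: (0 < _ < _)%R => //=; move: ji; rewrite -val_eqE /=.
by case: (ltngtP i j).
Qed.
End Counts.

(** * Size and sign of a core *)

Definition posn (z : int) : nat := if z is Posz m then m else 0.
(** [|z|] for [z >= 0] and [|z| - 1] for [z < 0]: the number of short hooks arising from two residue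
    classes and their mirror classes. *)
Definition hcount (z : int) : nat := match z with Posz m | Negz m => m end.

Lemma posn_hcount z : (posn z + posn (- z - 1))%N = hcount z.
Proof.
case: z => m.
  by have -> : - m%:Z - 1 = Negz m by [rewrite NegzE; lia]; rewrite addn0.
by have -> : - Negz m - 1 = m by rewrite NegzE; lia.
Qed.

Lemma split_runner (V : nmodType) (f : int -> V) (x T : int) (c L : nat) : (c <= L)%N ->
  \sum_(m < L) f (x + T * c%:Z - m.+1%:Z * T)
  = \sum_(j < c) f (x + T * j%:Z) + \sum_(m < L - c) f (x - m.+1%:Z * T).
Proof.
move=> cL; have := subnKC cL; move: (L - c)%N => d <-; rewrite big_split_ord /=; congr (_ + _).
  rewrite (reindex_inj rev_ord_inj) /=; apply: eq_bigr => j _; congr f.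
  have -> : (c - j.+1).+1%:Z = c%:Z - j%:Z by have := ltn_ord j; lia.
  by ring.
apply: eq_bigr => m _; congr f; rewrite -addnS PoszD; ring.
Qed.

Section RunnerCounts.
Variables (r T : nat) (n : int) (L : nat).
Hypotheses (rT : (r < T)%N) (nL : n <= L%:Z).

Lemma runner_neg m : r%:Z - m.+1%:Z * T%:Z < 0.
Proof. by have : 0 <= m%:Z * T%:Z; [rewrite mulr_ge0 | rewrite intS mulrDl mul1r; lia]. Qed.

Lemma runner_split (f : int -> nat) : (forall a : int, a < 0 -> f a = 0%N) ->
  (\sum_(m < L) f (r%:Z + T%:Z * n - m.+1%:Z * T%:Z)%R
  = \sum_(j < posn n) f (r%:Z + T%:Z * j%:Z)%R)%N.
Proof.
move=> f0; case: n nL => c cL.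
  rewrite (split_runner f); last by lia.
  rewrite [X in (_ + X)%R]big1 ?addr0 // => m _; apply: f0; exact: runner_neg.
rewrite big_ord0 big1 // => m _; apply: f0.
have := runner_neg m; have : 0 <= c.+1%:Z * T%:Z by rewrite mulr_ge0.
by rewrite NegzE; lia.
Qed.

Lemma runner_d :
  (\sum_(m < L) (0 <= (r%:Z + T%:Z * n - m.+1%:Z * T%:Z))%R)%N = posn n.
Proof.
rewrite (runner_split (f := fun a => (0 <= a)%R : nat)) => [|a a0]; last by lia.
by rewrite (eq_bigr (fun=> 1%N)) ?sum1_card ?card_ord.
Qed.

Lemma runner_delta :
  (\sum_(m < L) (0 < 2 * (r%:Z + T%:Z * n - m.+1%:Z * T%:Z) + 1 < T%:Z)%R)%N
  = (0 < n) && (2 * r + 1 < T)%N.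
Proof.
rewrite (runner_split (f := fun a => (0 < 2 * a + 1 < T%:Z)%R : nat)) => [|a a0]; last by lia.
case: n => [[|c]|c]; rewrite /posn ?big_ord0 //.
rewrite big_ord_recl /= big1 => [|j _]; first by rewrite mulr0 addr0 addn0 /=; lia.
have : 0 <= T%:Z * j%:Z by rewrite mulr_ge0.
by rewrite /= /bump /= add1n intS; move=> h; apply/eqP; rewrite eqb0; apply/negP; nia.
Qed.

Lemma runner_size :
  (\sum_(m < L) if (0 <= (r%:Z + T%:Z * n - m.+1%:Z * T%:Z))%R
                then absz (2 * (r%:Z + T%:Z * n - m.+1%:Z * T%:Z) + 1)%R else 0)%N
  = (posn n * (2 * r + 1) + T * (posn n * (posn n).-1))%N.
Proof.
rewrite (runner_split (f := fun a => if (0 <= a)%R then absz (2 * a + 1)%R else 0%N)) => [|a a0]; last first.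
  by rewrite leNgt a0.
elim: (posn n) => [|c IHc]; first by rewrite big_ord0 muln0.
rewrite big_ord_recr IHc -[nat_of_ord ord_max]/c.
have -> : absz (2 * (r%:Z + T%:Z * c%:Z) + 1) = (2 * (r + T * c) + 1)%N by lia.
by case: c {IHc} => [|c] /=; nia.
Qed.
End RunnerCounts.

Lemma count_diag (L : nat) (z : int) : z <= L%:Z ->
  (\sum_(m < L) \sum_(m' < L) ((m%:Z + m'%:Z + 1)%R == z))%N = posn z.
Proof.
move=> zL.
have E (m : 'I_L) : (\sum_(m' < L) ((m%:Z + m'%:Z + 1)%R == z))%N = (m%:Z + 1 <= z)%R.
  have [mz|mz] := boolP (m%:Z + 1 <= z).
    have ml : (absz (z - m%:Z - 1)%R < L)%N by lia.
    rewrite (bigD1 (Ordinal ml)) //= big1 ?addn0; first by rewrite gez0_abs; lia.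
    by move=> j; rewrite -val_eqE /=; lia.
  by rewrite big1 // => j _; apply/eqP; rewrite eqb0; lia.
under eq_bigr do rewrite E.
case: z zL {E} => c cL; last by rewrite big1 // => m _; lia.
rewrite (eq_bigr (fun m : 'I_L => if (m < c)%N then 1%N else 0%N)) => [|m _]; last first.
  have -> : (m%:Z + 1 <= c%:Z) = (m < c)%N by lia.
  by case: (m < c)%N.
rewrite -big_mkcond /= -(big_ord_widen L (fun=> 1%N)) ?sum1_card ?card_ord //.
Qed.

(** The quantity tested is [r + r' + 1] plus a multiple of [T], and [0 < r + r' + 1 < 2T]. So it
    lies strictly between 0 and [T] for exactly one value of [m + m'], and for none if
    [r + r' + 1 = T]. *)
Lemma runner_pair (r r' T : nat) (n n' : int) (L : nat) :
  (r < T)%N -> (r' < T)%N -> n + n' <= L%:Z ->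
  (\sum_(m < L) \sum_(m' < L)
    (0 < (r%:Z + T%:Z * n - m.+1%:Z * T%:Z) + (r'%:Z + T%:Z * n' - m'.+1%:Z * T%:Z) + 1 < T%:Z)%R)%N
  = (if (r + r' + 1 < T)%N then posn (n + n' - 1)
    else if (T < r + r' + 1)%N then posn (n + n') else 0)%N.
Proof.
move=> rT rT' nL.
have E (m m' : 'I_L) : (r%:Z + T%:Z * n - m.+1%:Z * T%:Z) + (r'%:Z + T%:Z * n' - m'.+1%:Z * T%:Z) + 1
   = (r + r' + 1)%N%:Z + T%:Z * (n + n' - (m%:Z + m'%:Z + 1) - 1).
  by rewrite !PoszD !intS; ring.
under eq_bigr do under eq_bigr do rewrite E.
case: ltnP => h1; last case: ltnP => h2.
- rewrite -(count_diag (L := L)); last by lia.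
  apply: eq_bigr => m _; apply: eq_bigr => m' _; congr nat_of_bool.
  move: (m%:Z + m'%:Z + 1) => s; apply/idP/eqP => [h|->]; last first.
    by rewrite (_ : n + n' - (n + n' - 1) - 1 = 0) ?mulr0; lia.
  by nia.
- rewrite -(count_diag (L := L)) //.
  apply: eq_bigr => m _; apply: eq_bigr => m' _; congr nat_of_bool.
  move: (m%:Z + m'%:Z + 1) => s; apply/idP/eqP => [h|->]; last first.
    by rewrite (_ : n + n' - (n + n') - 1 = -1) ?mulrN1; lia.
  by nia.
- have aux (s : int) : ~~ (0 < T%:Z + T%:Z * s < T%:Z).
    by apply/negP => h; case: (lerP 0 s) => hs; nia.
  rewrite big1 // => m _; rewrite big1 // => m' _; apply/eqP; rewrite eqb0.
  by have -> : (r + r' + 1)%N = T by [lia]; apply: aux.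
Qed.

Section CoreStatistics.
Variables (t : nat) (l : seq nat).
Hypotheses (t0 : (0 < t)%N) (pl : is_partition l) (sl : self_conjugate l)
  (cl : is_core (2 * t) l).
Let k := @kvec t l.
Let T := (2 * t)%N.

Let rk (i : 'I_t) (b : bool) : nat := if b then (i : nat) else (T - 1 - i)%N.
Let nk (i : 'I_t) (b : bool) : int := if b then - k i else k i.

Let bvecE i b m : bvec k i b - m.+1%:Z * T%:Z = (rk i b)%:Z + T%:Z * nk i b - m.+1%:Z * T%:Z.
Proof. by rewrite /bvec /rk /nk /T; case: b; have := ltn_ord i; lia. Qed.

Let rkT i b : (rk i b < T)%N.
Proof. by rewrite /rk /T; have := ltn_ord i; case: b; lia. Qed.

(** Exceeds the length and every [|beta_r|]; values below [-B] enter none of the counts that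
    follow. *)
Let B := (size l + \sum_(i < t) \sum_(b : bool) absz (bvec k i b) + 1)%N.

Let bvecB i b : (absz (bvec k i b) < B)%N.
Proof.
rewrite /B addn1 ltnS (bigD1 i) //= (bigD1 b) //=; lia.
Qed.

Let sizeB : (size l < B)%N.
Proof. by rewrite /B; lia. Qed.

Let nkB i b : (absz (nk i b) <= B)%N.
Proof.
have := bvecB i b; have := ltn_ord i.
rewrite /bvec /nk /T; case: b; nia.
Qed.

Let nkL i b : nk i b <= (2 * B)%N%:Z.
Proof. by have := nkB i b; lia. Qed.

Lemma runner_sum_nk (f : int -> nat) : (forall a : int, a < - B%:Z -> f a = 0%N) ->
  (\sum_(i < B) f (cval l i.+1) = \sum_(i < t) \sum_(b : bool) \sum_(m < 2 * B)
     f ((rk i b)%:Z + T%:Z * nk i b - m.+1%:Z * T%:Z)%R)%N.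
Proof.
move=> f0; rewrite (@runner_sum_bvec t l t0 pl sl cl _ f B B (2 * B)) //; [|exact: ltnW|]; last first.
  by move=> i b; rewrite -/k; have := bvecB i b; lia.
by apply: eq_bigr => i _; apply: eq_bigr => b _; apply: eq_bigr => m _; rewrite bvecE.
Qed.

Lemma psize_kvec : psize l = wexp k.
Proof.
rewrite (psize_cval pl sl (ltnW sizeB)).
rewrite (runner_sum_nk (f := fun a => if (0 <= a)%R then absz (2 * a + 1)%R else 0%N)); last first.
  by move=> a aB; rewrite ifF //; lia.
apply: eq_bigr => i _; rewrite big_bool !(runner_size (rkT _ _) (nkL _ _)).
rewrite /nk /rk /w0 /T; have := ltn_ord i; case: (k i) => c il.
- case: c => [|c]; first by rewrite /posn /=; lia.
  have -> : - Posz c.+1 = Negz c by [].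
  by rewrite /posn /=; nia.
have -> : - Negz c = c.+1 by [].
by rewrite /posn /= NegzE; nia.
Qed.

Lemma durfee_kvec : durfee l = (\sum_(i < t) absz (k i))%N.
Proof.
rewrite (durfee_count pl sl (ltnW sizeB)).
rewrite (runner_sum_nk (f := fun a => (0 <= a)%R : nat)); last by move=> a aB; lia.
apply: eq_bigr => i _; rewrite big_bool !(runner_d (rkT _ _) (nkL _ _)).
by rewrite /nk /=; case: (k i) => [[|c]|c] //=; rewrite addn0.
Qed.

Lemma diag_kvec :
  (\sum_(i < B) (0 < 2 * cval l i.+1 + 1 < T%:Z)%R = \sum_(i < t) (k i < 0)%R)%N.
Proof.
rewrite (runner_sum_nk (f := fun a => (0 < 2 * a + 1 < T%:Z)%R : nat)); last by move=> a aB; lia.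
apply: eq_bigr => i _; rewrite big_bool !(runner_delta (rkT _ _) (nkL _ _)).
rewrite /nk /rk /T /=; have il := ltn_ord i.
have -> : (2 * i + 1 < 2 * t)%N by lia.
have -> : (2 * (2 * t - 1 - i) + 1 < 2 * t)%N = false by lia.
by rewrite andbT andbF addn0 oppr_gt0.
Qed.

(** For [i < j], the two residues attached to [i] and the two attached to [j] form four pairs. Two
    of them combine to [hcount (k i + k j)], the other two to [hcount (k i - k j)]. For [i = j],
    opposite residues add to [2t - 1] and contribute nothing. *)
Lemma pairs_kvec :
  (\sum_(i < B) \sum_(j < B) (0 < cval l i.+1 + cval l j.+1 + 1 < T%:Z)%R
   = \sum_(i < t) hcount (2 * k i)%R
     + 2 * \sum_(i < t) \sum_(j < t | i < j) (hcount (k i + k j)%R + hcount (k i - k j)%R))%N.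
Proof.
have cvB j : cval l j.+1 < B%:Z - 1.
  by have := part_mono pl (leq0n j); rewrite (head_size pl sl) cvalE; have := sizeB; lia.
rewrite (runner_sum_nk (f := fun a => (\sum_(j < B) (0 < a + cval l j.+1 + 1 < T%:Z)%R)%N)); last first.
  by move=> a aB; rewrite big1 // => j _; have := cvB j; lia.
pose G i b j b' : nat := if (rk i b + rk j b' + 1 < T)%N then posn (nk i b + nk j b' - 1)
    else if (T < rk i b + rk j b' + 1)%N then posn (nk i b + nk j b') else 0%N.
transitivity (\sum_(i < t) \sum_(j < t) \sum_(b : bool) \sum_(b' : bool) G i b j b')%N.
  apply: eq_bigr => i _; rewrite [RHS]exchange_big; apply: eq_bigr => b _ /=.
  under eq_bigr => m _.
    rewrite (runner_sum_nk (f := fun a => (0 < (rk i b)%:Z + T%:Z * nk i b - m.+1%:Z * T%:Z + a + 1 < T%:Z)%R : nat)); last first.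
      by move=> a aB; rewrite -bvecE; have := bvecB i b; have : 0 <= m.+1%:Z * T%:Z by [rewrite mulr_ge0]; lia.
    over.
  rewrite exchange_big; apply: eq_bigr => j _; rewrite exchange_big; apply: eq_bigr => b' _.
  by rewrite runner_pair //; have := nkB i b; have := nkB j b'; lia.
pose H (i j : 'I_t) : nat := (\sum_(b : bool) \sum_(b' : bool) G i b j b')%N.
have il (i : 'I_t) := ltn_ord i.
have GFF i j : G i false j false = posn (k i + k j).
  rewrite /G /rk /nk /T; have := il i; have := il j => h1 h2.
  by case: ltnP => h; [lia|case: ltnP => //; lia].
have GTT i j : G i true j true = posn (- (k i + k j) - 1).
  rewrite /G /rk /nk /T; have := il i; have := il j => h1 h2; case: ltnP => h; last by lia.
  by congr posn; ring.
have GFT i j : G i false j true =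
    if (j < i)%N then posn (k i - k j - 1) else if (i < j)%N then posn (k i - k j) else 0%N.
  rewrite /G /rk /nk /T; have := il i; have := il j => h1 h2.
  have -> : (2 * t - 1 - i + j + 1 < 2 * t)%N = (j < i)%N by lia.
  by have -> : (2 * t < 2 * t - 1 - i + j + 1)%N = (i < j)%N by lia.
have GTF i j : G i true j false =
    if (i < j)%N then posn (k j - k i - 1) else if (j < i)%N then posn (k j - k i) else 0%N.
  rewrite /G /rk /nk /T; have := il i; have := il j => h1 h2.
  have -> : (i + (2 * t - 1 - j) + 1 < 2 * t)%N = (i < j)%N by lia.
  have -> : (2 * t < i + (2 * t - 1 - j) + 1)%N = (j < i)%N by lia.
  by rewrite ![- k i + _]addrC.
have HE i j : H i j = (posn (- (k i + k j) - 1) + G i true j false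
    + (G i false j true + posn (k i + k j)))%N by rewrite /H !big_bool GFF GTT.
have Hd i : H i i = hcount (2 * k i).
  rewrite HE GTF GFT ltnn addn0 add0n addnC -posn_hcount.
  by congr (posn _ + posn _)%N; ring.
have Hlt (i j : 'I_t) : (i < j)%N -> H i j = (hcount (k i + k j)%R + hcount (k i - k j)%R)%N.
  move=> ij; rewrite HE GTF GFT ij (ltnNge j) (ltnW ij) /= -!posn_hcount opprB.
  by move: (posn _) (posn _) (posn _) (posn _) => a b c d; lia.
have Hgt (i j : 'I_t) : (j < i)%N -> H i j = H j i.
  move=> ji; rewrite [RHS]Hlt // HE GTF GFT ji (ltnNge i) (ltnW ji) /= -!posn_hcount opprB.
  rewrite [k j + k i]addrC.
  by move: (posn _) (posn _) (posn _) (posn _) => a b c d; lia.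
have E (i : 'I_t) : (\sum_(j < t) H i j = hcount (2 * k i)%R +
    (\sum_(j < t | i < j) H i j + \sum_(j < t | j < i) H j i))%N.
  rewrite (bigD1 i) //= Hd; congr (_ + _)%N.
  rewrite (bigID (fun j : 'I_t => (i < j)%N)) /=; congr (_ + _)%N.
    by apply: eq_bigl => j; rewrite -val_eqE /=; lia.
  apply: eq_big => [j|j /andP[ji nij]]; first by rewrite -val_eqE /=; lia.
  by apply: Hgt; move: ji nij; rewrite -val_eqE /=; lia.
under eq_bigr do rewrite E.
rewrite !big_split /= mul2n -addnn; congr (_ + _)%N.
rewrite [X in (_ + X)%N](exchange_big_dep xpredT) //=.
by congr (_ + _)%N; apply: eq_bigr => i _; apply: eq_bigr => j ij; rewrite Hlt.
Qed.

Lemma sign_exp_kvec : exists e : nat, sign_exp (2 * t) l = (2 * e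
  + \sum_(i < t) (k i < 0)%R
  + \sum_(i < t) \sum_(j < t | i < j) (hcount (k i + k j)%R + hcount (k i - k j)%R))%N.
Proof.
exists (\sum_(i < t) absz (k i))%N.
have := Hplus_double pl sl T (ltnW sizeB); rewrite pairs_kvec diag_kvec.
rewrite /sign_exp (diag_count pl sl T (ltnW sizeB)) diag_kvec durfee_kvec.
(* Thus half of the diagonal terms is the Durfee size, and the two copies of it form the even part
   [2 * e]. *)
have : (\sum_(i < t) hcount (2 * k i)%R + \sum_(i < t) (k i < 0)%R = 2 * \sum_(i < t) absz (k i))%N.
  rewrite -big_split big_distrr /=; apply: eq_bigr => i _.
  case: (k i) => c; first by rewrite addn0.
  by rewrite NegzE mulrN -NegzE /=; lia.
by rewrite -/T; lia.
Qed.
End CoreStatistics.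

(** The left side is the sign of the Vandermonde product of [z], which is positive once [s] has put
    [z] in decreasing order; reordering multiplies it by the signature of [s]. *)
Lemma prod_sign_perm (t : nat) (z : 'I_t -> int) (s : {perm 'I_t}) :
  (forall i j : 'I_t, (i < j)%N -> z (s j) < z (s i)) ->
  \prod_(i < t) \prod_(j < t | (i < j)%N) (-1) ^+ (z i < z j)%R = (-1) ^+ s :> int.
Proof.
move=> zs; pose V (x : 'I_t -> int) : int := \prod_(i < t) \prod_(j < t | (i < j)%N) (x i - x j).
have VE x : V x = \det (\matrix_(k < t, j < t) ((1 : int) ^+ k * x j ^+ (t - 1 - k))).
  rewrite -(@hom_Vandermonde_rev _ t (fun=> 1) (fun=> 1)) => [|_]; last by rewrite mulr1.
  rewrite /V; apply: eq_bigr => i _; apply: eq_bigr => j _; by rewrite !mulr1.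
have Vs : V (z \o s) = (-1) ^+ s * V z.
  rewrite !VE mulrC -odd_permV -det_perm -det_mulmx -col_permE; congr (\det _).
  by apply/matrixP => i j; rewrite !mxE.
have Vpos : 0 < V (z \o s).
  apply: prodr_gt0 => i _; apply: prodr_gt0 => j ij; rewrite subr_gt0; exact: zs.
have sE : Num.sg (V z) = (-1) ^+ s.
  have := congr1 Num.sg Vs; rewrite gtr0_sg // sgrM => h.
  case: (odd_perm s) h => h; last by move: h; rewrite sgr1 mul1r.
  by move: h; rewrite expr1 sgrN1 mulN1r => h; rewrite -[LHS]opprK -h.
rewrite -sE /V (big_morph _ (@sgrM _) (@sgr1 _)); apply: eq_bigr => i _.
rewrite (big_morph _ (@sgrM _) (@sgr1 _)); apply: eq_bigr => j ij.
have zij : z i != z j.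
  have /eqP : (s^-1)%g i != (s^-1)%g j by rewrite (inj_eq perm_inj) -val_eqE /= ltn_eqF.
  case: (ltngtP ((s^-1)%g i) ((s^-1)%g j)) => [/zs|/zs|/val_inj //]; rewrite !permKV => h _.
    by rewrite gt_eqF.
  by rewrite lt_eqF.
by rewrite sgr_def subr_eq0 zij mulr1n subr_lt0.
Qed.

Section Sign.
Variables (t : nat) (k : 'I_t -> int).
Let w := wvec k.

Lemma wvec_lt0 i : (w i < 0) = (k i < 0).
Proof.
rewrite /w /wvec /w0; have := ltn_ord i; set m := k i => il.
by apply/idP/idP => h; case: (lerP 0 m) => m0; nia.
Qed.

(** For [i < j] both [w0 i + w0 j] and [w0 i - w0 j] lie strictly between 0 and [4t], so [w i + w j]
    and [w i - w j] have the signs of [k i + k j] and [k i - k j], zero counting as positive. *)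
Lemma wvec_sqr_lt (i j : 'I_t) : (i < j)%N ->
  (w i ^+ 2 < w j ^+ 2) = (k i + k j < 0) (+) (k i - k j < 0).
Proof.
move=> ij; have jt := ltn_ord j.
have e1 : (w i + w j < 0) = (k i + k j < 0) /\ w i + w j != 0.
  rewrite /w /wvec /w0; move: (k i) (k j) => a b; split.
    by apply/idP/idP => h; case: (lerP 0 (a + b)) => m0; nia.
  by case: (lerP 0 (a + b)) => m0; nia.
have e2 : (w i - w j < 0) = (k i - k j < 0) /\ w i - w j != 0.
  rewrite /w /wvec /w0; move: (k i) (k j) => a b; split.
    by apply/idP/idP => h; case: (lerP 0 (a - b)) => m0; nia.
  by case: (lerP 0 (a - b)) => m0; nia.
case: e1 e2 => <- u0 [<- v0].
rewrite -subr_lt0 subr_sqr; move: (w i - w j) (w i + w j) u0 v0 => v u u0 v0.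
by case: (ltrgt0P u) u0 => // hu _; case: (ltrgt0P v) v0 => // hv _;
  rewrite ?(pmulr_rlt0 _ hv) ?(nmulr_rlt0 _ hv); lia.
Qed.

Lemma wvec_sqr_neq (i j : 'I_t) : i != j -> w i ^+ 2 != w j ^+ 2.
Proof.
wlog ij : i j / (i < j)%N => [hw|_].
  case: (ltngtP i j) => [/hw//|/hw h|/val_inj -> /eqP//]; rewrite eq_sym => ?.
  by rewrite eq_sym; apply: h.
have jt := ltn_ord j.
rewrite -subr_eq0 subr_sqr mulf_neq0 // /w /wvec /w0; move: (k i) (k j) => a b.
  by case: (lerP 0 (a - b)) => m0; nia.
by case: (lerP 0 (a + b)) => m0; nia.
Qed.

(** [hcount z] has the parity of [|z|] plus one if [z < 0], and [a + b], [a - b] have the same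
    parity, so only the two signs survive. *)
Lemma sign_hcount (F : fieldType) (a b : int) :
  (-1) ^+ (hcount (a + b) + hcount (a - b))%N = (-1) ^+ ((a + b < 0) (+) (a - b < 0)) :> F.
Proof.
rewrite -signr_odd; congr (_ ^+ nat_of_bool _).
have hE (z : int) : odd (hcount z) = odd (absz z) (+) (z < 0).
  by case: z => c; rewrite /hcount ?addbF // NegzE abszN /= addbT negbK.
rewrite oddD !hE; have : odd (absz (a + b)%R) = odd (absz (a - b)%R) by lia.
by move=> ->; case: (odd _) (_ < 0) (_ < 0) => [] [] [].
Qed.

Lemma wdet_abs (F : fieldType) (y : 'I_t -> F) :
  wdet y (fun i => `|w i|) = (\prod_(i < t) (-1) ^+ (w i < 0)%R) * wdet y w.
Proof.
rewrite /wdet; transitivity (\det (diag_mx (\row_i (-1) ^+ (w i < 0)%R)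
    *m \matrix_(i < t, j < t) (y j ^ w i - y j ^ (- w i)))).
  congr (\det _); apply/matrixP => i j; rewrite mul_diag_mx !mxE.
  by case: (ger0P (w i)) => _; rewrite ?expr0 ?mul1r // expr1 mulN1r opprK opprB.
by rewrite det_mulmx det_diag; congr (_ * _); apply: eq_bigr => i _; rewrite mxE.
Qed.

Lemma wdet_perm (F : fieldType) (y : 'I_t -> F) (s : {perm 'I_t}) (x : 'I_t -> int) :
  wdet y (x \o s) = (-1) ^+ s * wdet y x.
Proof.
rewrite /wdet -det_perm -det_mulmx -row_permE; congr (\det _).
by apply/matrixP => i j; rewrite !mxE.
Qed.
End Sign.

(** * Terms of the theorem as determinants over the field of rational functions *)

Lemma tofrac_eval_neq (t : nat) (p r : {mpoly int[t]}) (v : 'I_t -> int) :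
  meval v p != meval v r -> tofrac p != tofrac r.
Proof. by apply: contra; rewrite tofrac_eq => /eqP ->. Qed.

Lemma yvar_neq0 (t : nat) (j : 'I_t) : yvar j != 0.
Proof.
rewrite /yvar -tofrac0; apply: (@tofrac_eval_neq _ _ _ (fun=> 1)).
by rewrite mevalXU meval0.
Qed.

Lemma weylden_yvar_neq0 (t : nat) : weylden (@yvar t) != 0.
Proof.
(* Distinct integers at least 2: their squares are distinct, and neither a square nor a product of
   two equals 1. *)
pose v (i : 'I_t) : int := i%:Z + 2.
apply: weylden_neq0 => [j|j|i j ij]; first exact: yvar_neq0.
  rewrite /yvar -tofracXn -tofrac1; apply: (@tofrac_eval_neq _ _ _ v).
  by rewrite expr2 mevalM mevalXU meval1 /v; nia.
rewrite /yvar -!tofracXn -tofracM -tofrac1; apply/andP; split; apply: (@tofrac_eval_neq _ _ _ v).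
  by rewrite !expr2 !mevalM !mevalXU /v; nia.
by rewrite !expr2 !mevalM !mevalXU meval1 /v; nia.
Qed.

Section CoreTerm.
Variables (t : nat) (l : seq nat).
Hypotheses (t0 : (0 < t)%N) (pl : is_partition l) (sl : self_conjugate l)
  (cl : is_core (2 * t) l).
Let k := @kvec t l.
Let w := wvec k.
Let geqz : rel int := fun a b => b <= a.

Let bp (i : 'I_t) : int := Num.max (bvec k i true) (bvec k i false).
Let bn (i : 'I_t) : int := Num.min (bvec k i true) (bvec k i false).

Let bpE i : 2 * bp i - (2 * t)%:Z + 1 = `|w i|.
Proof.
have h1 : w i = 2 * bvec k i false - (2 * t)%:Z + 1.
  by rewrite /w /wvec /w0 /bvec; lia.
have h2 : bvec k i true = (2 * t)%:Z - 1 - bvec k i false by rewrite /bvec; lia.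
rewrite h1 /bp h2; case: lerP => h; lia.
Qed.

Let betas := [seq beta (2 * t) l r | r <- iota 0 (2 * t)].

Let betas_perm : perm_eq betas ([seq bp i | i <- enum 'I_t] ++ [seq bn i | i <- enum 'I_t]).
Proof.
apply/seq.permP => p; rewrite count_cat.
have cE (s : seq int) : count p s = (\sum_(a <- s) if p a then 1 else 0)%N.
  by rewrite -sum1_count big_mkcond.
rewrite !cE 3!big_map.
rewrite -{1}(subn0 (2 * t)%N) -/(index_iota 0 (2 * t)) big_mkord.
rewrite (sum_fold (fun r => if p (beta (2 * t) l r) then 1%N else 0%N)) !big_enum -big_split /=.
apply: eq_bigr => i _; rewrite (beta_lo t0 pl sl cl) (beta_hi t0 pl) -/k /bp /bn.
by case: lerP => _ //; rewrite addnC.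
Qed.

Let geqz_total : total geqz. Proof. by move=> a b; apply: le_total. Qed.
Let geqz_trans : transitive geqz. Proof. by move=> b a c h1 h2; apply: le_trans h2 h1. Qed.
Let geqz_anti : antisymmetric geqz.
Proof. by move=> a b; rewrite /geqz => /andP[h1 h2]; apply/eqP; rewrite eq_le h1 h2. Qed.

(** Opposite values add to the odd number [2t - 1], so every [bp] exceeds every [bn] and the [t]
    largest values are the [bp]. *)
Let betas_sortedE : betas_sorted (2 * t) l
  = sort geqz [seq bp i | i <- enum 'I_t] ++ sort geqz [seq bn i | i <- enum 'I_t].
Proof.
apply: (sorted_eq geqz_trans geqz_anti); first exact: sort_sorted.
  rewrite (sorted_pairwise geqz_trans) pairwise_cat -!(sorted_pairwise geqz_trans).
  rewrite !sort_sorted // !andbT; apply/allrelP => a b.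
  rewrite !mem_sort => /mapP[i _ ->] /mapP[j _ ->]; rewrite /geqz.
  have := bpE i; have := bpE j.
  have : bn j = (2 * t)%:Z - 1 - bp j.
    have h2 : bvec k j true = (2 * t)%:Z - 1 - bvec k j false by rewrite /bvec; lia.
    by rewrite /bn /bp h2; case: lerP => h; lia.
  by lia.
rewrite perm_sort (perm_trans betas_perm) // perm_cat //.
  by rewrite perm_sym perm_sort.
by rewrite perm_sym perm_sort.
Qed.

Lemma vcoding_perm : exists s : {perm 'I_t},
  (forall i : 'I_t, 2 * vcoding (2 * t) t l i.+1 - (2 * t)%:Z + 1 = `|w (s i)|)
  /\ (forall i j : 'I_t, (i < j)%N -> w (s j) ^+ 2 < w (s i) ^+ 2).
Proof.
pose P := sort geqz [seq bp i | i <- enum 'I_t].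
have sizeP : size P = t by rewrite /P size_sort size_map size_enum_ord.
have /tuple_permP[s sE] : perm_eq P [tuple bp i | i < t].
  by rewrite /= perm_sort.
have nthP (i : 'I_t) : nth 0 P i = bp (s i).
  rewrite sE /= (nth_map i) ?size_enum_ord // nth_ord_enum.
  by rewrite tnth_mktuple.
have vE (i : 'I_t) : 2 * vcoding (2 * t) t l i.+1 - (2 * t)%:Z + 1 = `|w (s i)|.
  by rewrite /vcoding betas_sortedE -/P take_size_cat // nthP bpE.
exists s; split=> // i j ij.
(* Sorting yields only a weak inequality; strictness comes from the squares being distinct. *)
have ne : w (s j) ^+ 2 != w (s i) ^+ 2.
  by apply: wvec_sqr_neq; rewrite (inj_eq perm_inj) -val_eqE /= gtn_eqF.
rewrite lt_neqAle ne /= -real_normK ?num_real // -[leRHS]real_normK ?num_real //.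
rewrite lerXn2r ?nnegrE ?normr_ge0 // -!bpE.
have : geqz (bp (s i)) (bp (s j)).
  have /(sorted_ltn_nth geqz_trans 0) := sort_sorted geqz_total [seq bp i | i <- enum 'I_t].
  rewrite -/P => /(_ i j); rewrite !inE sizeP !ltn_ord !nthP; exact.
by rewrite /geqz; lia.
Qed.

(** Making the [w i] positive costs the sign [A] and sorting them costs [P]; by [sign_exp_kvec] the
    sign of the term is [A P] as well, so every sign occurs squared. *)
Lemma lhs_term_wdet : lhs_term t l * weylden (@yvar t) = wdet (@yvar t) w.
Proof.
have y0 (j : 'I_t) := yvar_neq0 j.
have wd0 := weylden_yvar_neq0 t.
have [s [vE ws]] := vcoding_perm.
rewrite /lhs_term /so_fun.
have -> : \matrix_(i < t, j < t) (yvar j ^ (2 * (t%:Z - i.+1%:Z) + 1)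
      - yvar j ^ (- (2 * (t%:Z - i.+1%:Z) + 1)))
    = \matrix_(i < t, j < t) (yvar j ^ w0 t i - yvar j ^ (- w0 t i)).
  apply/matrixP => i j; rewrite !mxE.
  by have -> : 2 * (t%:Z - i.+1%:Z) + 1 = w0 t i by rewrite /w0; lia.
rewrite weyl_denominator // -[_ * _ * weylden _]mulrA divfK //.
have -> : \matrix_(i < t, j < t) (yvar j ^ (2 * (mu_of t l i.+1 + t%:Z - i.+1%:Z) + 1)
      - yvar j ^ (- (2 * (mu_of t l i.+1 + t%:Z - i.+1%:Z) + 1)))
    = \matrix_(i < t, j < t) (yvar j ^ `|w (s i)| - yvar j ^ (- `|w (s i)|)).
  apply/matrixP => i j; rewrite !mxE -vE.
  by have -> : 2 * (mu_of t l i.+1 + t%:Z - i.+1%:Z) + 1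
    = 2 * vcoding (2 * t) t l i.+1 - (2 * t)%:Z + 1 by rewrite /mu_of; lia.
rewrite -/(wdet _ ((fun i => `|w i|) \o s)) wdet_perm wdet_abs.
have := @prod_sign_perm t (fun i => w i ^+ 2) s ws.
move=> /(congr1 (fun z : int => z%:~R : RatFun t)).
rewrite /= rmorph_sign => <-.
have [e ->] := sign_exp_kvec t0 pl sl cl.
rewrite 2!exprD exprM sqrrN !expr1n mul1r.
set P := intmul 1 _; pose A : RatFun t := \prod_(i < t) (-1) ^+ (w i < 0)%R.
rewrite -/w -/A.
have -> : (-1) ^+ (\sum_(i < t) (kvec l i < 0)%R)%N = A.
  by rewrite -prodrXr; apply: eq_bigr => i _; rewrite wvec_lt0.
have -> : (-1) ^+ (\sum_(i < t) \sum_(j < t | (i < j)%N)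
    (hcount (kvec l i + kvec l j)%R + hcount (kvec l i - kvec l j)%R))%N = P.
  rewrite /P rmorph_prod -prodrXr; apply: eq_bigr => i _.
  rewrite rmorph_prod -prodrXr; apply: eq_bigr => j ij.
  by rewrite rmorph_sign sign_hcount wvec_sqr_lt.
have AA : A * A = 1 by rewrite -big_split big1 // => i _; rewrite /= -expr2 sqrr_sign.
have PP : P * P = 1.
  rewrite /P -intrM -big_split big1 // => i _; rewrite -big_split big1 // => j _.
  by rewrite /= -expr2 sqrr_sign.
transitivity ((A * A) * (P * P) * wdet (@yvar t) w); first by ring.
by rewrite AA PP !mul1r.
Qed.
End CoreTerm.

(** * Reconstruction of a core from its coordinates *)

Lemma decr_range_eq (a b : nat -> int) :
  (forall i j, (i < j)%N -> a j < a i) -> (forall i j, (i < j)%N -> b j < b i) ->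
  (forall i, exists j, a i = b j) -> (forall i, exists j, b i = a j) -> a =1 b.
Proof.
move=> da db ab ba i; elim/ltn_ind: i => i IHi.
have [j aj] := ab i; have [j' bj'] := ba i.
have ij : (i <= j)%N.
  by rewrite leqNgt; apply/negP => ji; have := da _ _ ji; rewrite (IHi _ ji) aj ltxx.
have ij' : (i <= j')%N.
  by rewrite leqNgt; apply/negP => ji; have := db _ _ ji; rewrite -(IHi _ ji) bj' ltxx.
apply/eqP; rewrite eq_le {1}aj {2}bj'; apply/andP; split.
  by move: ij; rewrite leq_eqVlt => /orP[/eqP ->//|/db/ltW].
by move: ij'; rewrite leq_eqVlt => /orP[/eqP ->//|/da/ltW].
Qed.

Lemma maya_partition_inj l l' : is_partition l -> is_partition l' ->
  maya l =1 maya l' -> l = l'.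
Proof.
move=> pl pl' ll'.
have cE : (fun i => cval l i.+1) =1 (fun i => cval l' i.+1).
  apply: decr_range_eq => [i j ij|i j ij|i|i]; try exact: cval_decr.
    have /mayaP[j hj] : maya l' (cval l i.+1) by rewrite -ll'; apply/mayaP; exists i.
    by exists j.
  have /mayaP[j hj] : maya l (cval l' i.+1) by rewrite ll'; apply/mayaP; exists i.
  by exists j.
have nE i : nth 0%N l i = nth 0%N l' i by have := cE i; rewrite !cvalE; lia.
apply: (@eq_from_nth _ 0%N) => // ; apply/eqP; rewrite eqn_leq.
apply/andP; split; rewrite leqNgt.
  by rewrite (lt_size_part pl) nE -(lt_size_part pl') ltnn.
by rewrite (lt_size_part pl') -nE -(lt_size_part pl) ltnn.
Qed.

(** By [maya_compl] and the symmetry, rows and columns give two strictly decreasing enumerations of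
    the same set. *)
Lemma self_conjugate_of_maya l : is_partition l ->
  (forall z, maya l (-1 - z) = ~~ maya l z) -> self_conjugate l.
Proof.
move=> pl hs.
have conjE p : conj_part l p.+1 = nth 0%N l p.
  have cE : (fun i => cval l i.+1) =1 (fun p => -1 - (p%:Z - (conj_part l p.+1)%:Z)).
    apply: decr_range_eq => [i j ij|i j ij|i|i]; first exact: cval_decr.
    - have : (conj_part l j.+1 <= conj_part l i.+1)%N.
        by apply: sub_count => x /= jx; apply: leq_trans jx; lia.
      by lia.
    - have /(maya_compl pl)[p0 hp] : ~~ maya l (-1 - cval l i.+1).
        by rewrite hs negbK; apply/mayaP; exists i.
      by exists p0; rewrite -hp; lia.
    - have : ~~ maya l (i%:Z - (conj_part l i.+1)%:Z) by apply/maya_compl => //; exists i.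
      by rewrite -hs => /mayaP[j hj]; exists j.
  by have := cE p; rewrite cvalE; lia.
have hsz : head 0%N l = size l.
  rewrite -nth0 -conjE /conj_part; apply/eqP; rewrite -all_count.
  apply/allP => x xl; have /andP[_ n0] := pl; rewrite lt0n.
  by apply: contra n0 => /eqP <-.
apply/eqP; apply: (@eq_from_nth _ 0%N); rewrite /conj_partition size_map size_iota // => i il.
by rewrite (nth_map 0%N) ?size_iota // nth_iota // add1n conjE.
Qed.

Lemma nth_filter_neq0 (s : seq nat) i : sorted geq s ->
  nth 0%N [seq x <- s | x != 0%N] i = nth 0%N s i.
Proof.
elim: s i => //= x s IHs i xs.
case: (eqVneq x 0%N) => [x0|xn0] /=; last first.
  by case: i => //= i; apply: IHs; apply: path_sorted xs.
have /allP s0 := order_path_min geq_trans xs.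
have nil_s : [seq y <- s | y != 0%N] = [::].
  apply/eqP; rewrite -size_eq0 size_filter -leqn0 leqNgt -has_count.
  by apply/hasPn => y /s0 /=; rewrite x0 leqn0 negbK.
rewrite nil_s nth_nil; case: i => [|i] //=.
case: (ltnP i (size s)) => il; last by rewrite nth_default.
by have := s0 _ (mem_nth 0%N il); rewrite /= x0 leqn0 => /eqP.
Qed.

(** By symmetry [P] contains all [z < -M]. Its elements in [[-M, M)], listed decreasingly as [a_i],
    give the parts [a_i + i + 1]. *)
Lemma partition_of_maya (P : pred int) (M : nat) :
  (forall z, P (-1 - z) = ~~ P z) -> (forall z, M%:Z <= z -> ~~ P z) ->
  exists2 l, is_partition l & maya l =1 P.
Proof.
move=> hs hM.
pose A := [seq z <- [seq M%:Z - 1 - j%:Z | j <- iota 0 (2 * M)] | P z].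
(* One element from each pair [{z, -1 - z}]. The count must be exactly [M] for the zero parts to
   continue the list with [-M - 1, -M - 2, ...] *)
have szA : size A = M.
  rewrite /A size_filter -sum1_count big_mkcond big_map.
  rewrite -{1}(subn0 (2 * M)%N) -/(index_iota 0 (2 * M)) big_mkord.
  rewrite (sum_fold (fun j => if P (M%:Z - 1 - j%:Z) then 1%N else 0%N)).
  rewrite (eq_bigr (fun=> 1%N)) ?sum1_card ?card_ord // => j _.
  have -> : M%:Z - 1 - (2 * M - 1 - j)%N%:Z = -1 - (M%:Z - 1 - j%:Z).
    by have := ltn_ord j; lia.
  by rewrite hs; case: (P _).
have mA z : (z \in A) = [&& P z, - M%:Z <= z & z < M%:Z].
  rewrite mem_filter; congr (_ && _); apply/mapP/idP => [[j]|zM].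
    by rewrite mem_iota => jM ->; lia.
  by exists (absz (M%:Z - 1 - z)%R); rewrite ?mem_iota; lia.
have gtr : transitive (fun a b : int => b < a) by move=> a b c h1 h2; apply: lt_trans h2 h1.
have sA : sorted (fun a b : int => b < a) A.
  apply: sorted_filter => //; rewrite sorted_map.
  apply: sub_sorted (iota_ltn_sorted 0 (2 * M)) => i j /=; lia.
pose a i := nth 0 A i.
have adecr i j : (i < j < M)%N -> a j < a i.
  by case/andP => ij jM; apply: (sorted_ltn_nth gtr 0 sA); rewrite ?inE ?szA //; lia.
have adecr' d i : (i + d < M)%N -> a (i + d)%N + d%:Z <= a i.
  elim: d => [|d IHd] idM; first by rewrite addn0 addr0.
  have h1 := IHd (ltn_trans (ltnSn _) _); have := adecr (i + d)%N (i + d.+1)%N.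
  by move: h1; rewrite addnS; lia.
have aM i : (i < M)%N -> - M%:Z <= a i < M%:Z.
  move=> iM; have : a i \in A by rewrite mem_nth ?szA.
  by rewrite mA => /and3P[_ -> ->].
have age i : (i < M)%N -> 0 <= a i + i%:Z + 1.
  move=> iM; have := adecr' (M - 1 - i)%N i; rewrite subnKC; last by lia.
  by move=> /(_ ltac:(lia)); have /andP[] := aM (M - 1)%N ltac:(lia); lia.
pose lam := mkseq (fun i => absz (a i + i%:Z + 1)%R) M.
have slam : sorted geq lam.
  apply/(sortedP 0%N) => i; rewrite size_mkseq => iM; rewrite !nth_mkseq //; last by lia.
  have h1 := age i ltac:(lia); have h2 := age i.+1 iM.
  by have := adecr i i.+1; rewrite ltnSn iM => /(_ isT); lia.
pose l := [seq x <- lam | x != 0%N].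
have pl : is_partition l.
  rewrite /is_partition /l sorted_filter // ?mem_filter ?eqxx //; exact: geq_trans.
have cE i : cval l i.+1 = if (i < M)%N then a i else - i%:Z - 1.
  rewrite cvalE /l nth_filter_neq0 //; case: (ltnP i M) => iM.
    by rewrite nth_mkseq //; have := age i iM; lia.
  by rewrite nth_default ?size_mkseq //; lia.
exists l => // z; apply/mayaP/idP => [[i]|Pz].
  rewrite cE; case: ltnP => iM <-.
    by have : a i \in A by [rewrite mem_nth ?szA]; rewrite mA => /and3P[].
  have := hs i%:Z; rewrite (_ : -1 - i%:Z = - i%:Z - 1); last by ring.
  by move=> ->; apply: hM.
case: (ltrP z (- M%:Z)) => zM.
  by exists (absz (- z - 1)%R); rewrite cE ifF; lia.
have zM' : z < M%:Z by rewrite ltNge; apply/negP => /hM; rewrite Pz.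
have /(nthP 0)[i] : z \in A by rewrite mA Pz zM zM'.
by rewrite szA => iM az; exists i; rewrite cE iM.
Qed.

(* The set of all [lambda_i - i] for the core with coordinates [k]. *)
Definition runner_set (t : nat) (k : 'I_t -> int) (z : int) : bool :=
  [exists i : 'I_t, [exists b : bool,
     (z < bvec k i b) && (((bvec k i b - z) %% (2 * t)%N%:Z)%Z == 0)]].

Section RunnerSet.
Variables (t : nat) (k : 'I_t -> int).
Hypothesis t0 : (0 < t)%N.
Let T0 : (2 * t)%N%:Z != 0. Proof. by lia. Qed.

Lemma runner_repr (z : int) : exists i b m, bvec k i b = z + (2 * t)%N%:Z * m.
Proof.
have rE := divz_eq z (2 * t)%N%:Z.
have r0 := modz_ge0 z T0; have rT := ltz_pmod z (ltac:(lia) : 0 < (2 * t)%N%:Z).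
move: rE r0 rT; move: (_ %/ _)%Z (_ %% _)%Z => d [r|r] // zE _ rT.
case: (ltnP r t) => rt.
  exists (Ordinal rt), true, (- d - k (Ordinal rt)); rewrite zE /bvec /=; ring.
have rt' : (2 * t - 1 - r < t)%N by lia.
exists (Ordinal rt'), false, (k (Ordinal rt') - d); rewrite zE /bvec /=.
have -> : (2 * t - 1 - r)%N%:Z = (2 * t)%N%:Z - 1 - r%:Z by lia.
by ring.
Qed.

Lemma bvec_inj_mod i b i' b' m : bvec k i b = bvec k i' b' + (2 * t)%N%:Z * m ->
  (i == i') && (b == b').
Proof.
have il := ltn_ord i; have il' := ltn_ord i'.
have aux (x y : nat) (n : int) : (x < 2 * t)%N -> (y < 2 * t)%N ->
    x%:Z = y%:Z + (2 * t)%N%:Z * n -> x = y.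
  move=> xT yT h; have n0 : n = 0 by nia.
  by move: h; rewrite n0 mulr0; lia.
rewrite -val_eqE /bvec /=; case: b; case: b' => h.
- have e : (i : nat) = i'.
    by apply: (aux _ _ (k i - k i' + m)); [lia|lia|rewrite mulrDr mulrBr; lia].
  by rewrite e !eqxx.
- have e : (i : nat) = (2 * t - 1 - i')%N.
    by apply: (aux _ _ (k i + k i' + m)); [lia|lia|rewrite !mulrDr; lia].
  by lia.
- have e : (2 * t - 1 - i)%N = i'.
    by apply: (aux _ _ (- k i - k i' + m)); [lia|lia|rewrite !mulrDr !mulrN; lia].
  by lia.
- have e : (2 * t - 1 - i)%N = (2 * t - 1 - i')%N.
    by apply: (aux _ _ (k i' - k i + m)); [lia|lia|rewrite mulrDr mulrBr; lia].
  by rewrite andbT; lia.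
Qed.

Lemma runner_setE z i b m : bvec k i b = z + (2 * t)%N%:Z * m -> runner_set k z = (0 < m).
Proof.
move=> zE; apply/existsP/idP => [[i' /existsP[b' /andP[zlt /eqP zmod]]]|m0].
  have e := divz_eq (bvec k i' b' - z) (2 * t)%N%:Z; rewrite zmod addr0 in e.
  move: e; move: (_ %/ _)%Z => d e.
  have /andP[/eqP ii /eqP bb] : (i == i') && (b == b').
    by apply: (@bvec_inj_mod i b i' b' (m - d)); rewrite zE mulrBr mulrC [_ * d]mulrC -e; ring.
  by move: zlt; rewrite -ii -bb zE ltrDl pmulr_rgt0 //; lia.
exists i; apply/existsP; exists b; rewrite zE ltrDl pmulr_rgt0 ?m0 /=; last by lia.
by rewrite addrC addKr mulrC modzMl.
Qed.

Lemma runner_set_sym z : runner_set k (-1 - z) = ~~ runner_set k z.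
Proof.
have [i [b [m zE]]] := runner_repr z.
rewrite (runner_setE zE) (@runner_setE _ i (~~ b) (1 - m)); first by lia.
have -> : bvec k i (~~ b) = (2 * t)%N%:Z - 1 - bvec k i b by rewrite /bvec; case: (b) => /=; lia.
by rewrite zE; ring.
Qed.

Lemma runner_set_core z : runner_set k z -> runner_set k (z - (2 * t)%N%:Z).
Proof.
have [i [b [m zE]]] := runner_repr z.
rewrite (runner_setE zE) (@runner_setE _ i b (m + 1)); last by rewrite zE; ring.
by lia.
Qed.

Lemma runner_set_bounded : exists M : nat, forall z, M%:Z <= z -> ~~ runner_set k z.
Proof.
exists (\sum_(i < t) \sum_(b : bool) absz (bvec k i b))%N => z Mz.
apply/existsP => -[i /existsP[b /andP[zb _]]].
by move: Mz zb; rewrite (bigD1 i) //= (bigD1 b) //=; lia.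
Qed.

End RunnerSet.

Lemma runner_set_inj t (k k' : 'I_t -> int) : (0 < t)%N ->
  runner_set k =1 runner_set k' -> k =1 k'.
Proof.
move=> t0 kk' i; pose z (m : int) := (2 * t)%:Z - 1 - i%:Z + (2 * t)%N%:Z * m.
have h (m : int) : (m < k i) = (m < k' i).
  have e (x : 'I_t -> int) : runner_set x (z m) = (0 < x i - m).
    by apply: (@runner_setE _ _ t0 _ i false); rewrite /bvec /z; ring.
  by have := kk' (z m); rewrite !e !subr_gt0.
by have h1 := h (k i); have h2 := h (k' i); lia.
Qed.

(** * Bijection between cores and integer vectors, and conclusion *)

Definition sc_core (t : nat) (l : seq nat) : bool :=
  [&& is_partition l, self_conjugate l & is_core (2 * t) l].

Lemma maya_kvec t l : (0 < t)%N -> sc_core t l -> maya l =1 runner_set (@kvec t l).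
Proof.
move=> t0 /and3P[pl sl cl] z.
have g0 : (0 < 2 * t)%N by lia.
have hm := maya_core g0 pl sl cl.
have [i [b [m zE]]] := runner_repr (@kvec t l) t0 z.
rewrite (runner_setE t0 zE).
have [r rE] : exists r, bvec (@kvec t l) i b = beta (2 * t) l r.
  case: (b); first by exists i; rewrite beta_lo.
  by exists (2 * t - 1 - i)%N; rewrite beta_hi.
rewrite (@maya_beta _ _ g0 pl hm r).
  by rewrite -rE zE ltrDl pmulr_rgt0 //; lia.
have [br _ _] := beta_spec g0 pl r; rewrite -rE zE in br.
rewrite -[RHS]br; have -> : z + (2 * t)%N%:Z * m - r%:Z = m * (2 * t)%N%:Z + (z - r%:Z) by ring.
by rewrite modzMDl.
Qed.

Lemma kvec_inj t l l' : (0 < t)%N -> sc_core t l -> sc_core t l' ->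
  @kvec t l =1 @kvec t l' -> l = l'.
Proof.
move=> t0 cl cl' kk.
have /and3P[pl _ _] := cl; have /and3P[pl' _ _] := cl'.
apply: maya_partition_inj => // z; rewrite (maya_kvec t0 cl) (maya_kvec t0 cl').
by apply: eq_existsb => i; apply: eq_existsb => b; rewrite /bvec kk.
Qed.

Lemma kvec_surj t (k : 'I_t -> int) : (0 < t)%N ->
  exists2 l, sc_core t l & @kvec t l =1 k.
Proof.
move=> t0; have [M hM] := runner_set_bounded k t0.
have [l pl lE] := partition_of_maya (runner_set_sym k t0) hM.
have hs z : maya l (-1 - z) = ~~ maya l z by rewrite !lE runner_set_sym.
have sl := self_conjugate_of_maya pl hs.
have cl : sc_core t l.
  rewrite /sc_core pl sl /=; apply: core_of_maya => //.
  by move=> z; rewrite !lE; apply: (runner_set_core t0).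
exists l => //; apply: runner_set_inj => // z.
by rewrite -(maya_kvec t0 cl).
Qed.

Lemma wexp_ge t (k : 'I_t -> int) i : (absz (k i) <= wexp k)%N.
Proof.
rewrite /wexp (bigD1 i) //=; apply: leq_trans (leq_addr _ _).
have /andP[wb _] := w0_bound i.
by have := thetaU_exp_ge (k i) wb; lia.
Qed.

(* Coefficientwise in q = T^(1/2): for each n, the coefficient of q^n of the
   left-hand side is the sum over the (finitely many) self-conjugate 2t-cores
   omega with |omega| = n (enumerated by any duplicate-free list s). *)
Theorem theorem1p2 (t : nat) (ht : (1 <= t)%N) (n : nat) (s : seq (seq nat)) :
  uniq s ->
  (forall l : seq nat,
     l \in s = [&& is_partition l, self_conjugate l,
                   is_core (2 * t) l & psize l == n]) ->
  \sum_(l <- s) lhs_term t l = (rhs_trunc (@xvar t) n)`_n.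
Proof.
(* The box of [rhs_trunc_coef]; it contains the coordinates of every core of size [n], as [wexp_ge]
   bounds them by [n], so [inord] below is exact. *)
move=> us hs; pose K := n.+3.
have ms l : (l \in s) = sc_core t l && (wexp (@kvec t l) == n).
  rewrite hs /sc_core !andbA; apply: andb_id2l => /andP[/andP[pl sl] cl].
  by rewrite (psize_kvec ht pl sl cl).
pose v (l : seq nat) : {ffun 'I_t -> 'I_(2 * K).+1} :=
  [ffun i => inord (absz (@kvec t l i + K%:Z))].
have vE l : l \in s -> boxvec (v l) =1 @kvec t l.
  rewrite ms => /andP[_ /eqP wn] i; rewrite /boxvec ffunE.
  have := wexp_ge (@kvec t l) i; rewrite wn => h.
  by rewrite inordK /K; lia.
have wdetE (y : 'I_t -> RatFun t) k k' : k =1 k' -> wdet y (wvec k) = wdet y (wvec k').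
  move=> kk; congr (\det _); apply/matrixP => i j; by rewrite !mxE /wvec kk.
have wexpE (k k' : 'I_t -> int) : k =1 k' -> wexp k = wexp k'.
  by move=> kk; apply: eq_bigr => i _; rewrite kk.
apply: (mulfI (weylden_yvar_neq0 t)).
rewrite (rhs_trunc_coef _ ht (@yvar_neq0 t)) mulr_sumr.
have -> : \sum_(l <- s) weylden (@yvar t) * lhs_term t l
   = \sum_(u <- map v s) wdet (@yvar t) (wvec (boxvec u)).
  rewrite big_map big_seq [RHS]big_seq; apply: eq_bigr => l ls.
  have := ls; rewrite ms => /andP[/and3P[pl sl cl] _].
  by rewrite mulrC lhs_term_wdet // (wdetE _ _ _ (vE l ls)).
have vs : uniq (map v s).
  rewrite map_inj_in_uniq // => l l' ls ls' vv.
  have := ls; have := ls'; rewrite !ms => /andP[c' _] /andP[c _].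
  by apply: (kvec_inj ht c c') => i; rewrite -vE // -[RHS]vE // vv.
(* Both sums have the same terms; it remains that [v] maps the cores in [s] onto the box vectors of
   weight [n]. *)
rewrite -[RHS]big_filter; apply: perm_big.
apply: uniq_perm; rewrite ?filter_uniq ?index_enum_uniq // => u.
rewrite mem_filter mem_index_enum andbT; apply/mapP/idP => [[l ls ->]|un].
  by rewrite (wexpE _ _ (vE l ls)); move: ls; rewrite ms => /andP[].
have [l cl lk] := kvec_surj (boxvec u) ht.
have ls : l \in s by rewrite ms cl (wexpE _ _ lk).
exists l => //; apply/ffunP => i; apply/val_inj.
have /= := vE l ls i; rewrite lk /boxvec => /addIr[]; exact: esym.
Qed.
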